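(* Let $K\ge 1$ and let $f=h+\overline{g}$ be a $K$-quasiregular harmonic mapping in the unit disk $\mathbb{D}$, with $h,g$ analytic in $\mathbb{D}$, such that $f(0)=0$ and $\lambda_f(0)=1$. If $\lambda_f(z)\leq M$ for all $z\in\mathbb{D}$, where $M$ is a constant, then the following hold. (i) If $KM>1$, then $f$ is univalent in the disk $\mathbb{D}_{r_0}$ and $f(\mathbb{D}_{r_0})$ contains a schlicht disk $\mathbb{D}_{r_1}$, where $$r_0=\frac{1}{KM}\quad\text{and}\quad r_1=KM+\left((KM)^3-KM\right)\log\left(1-\frac{1}{(KM)^2}\right).$$ The radius $r_0$ is sharp for $K=1$: for every $M>1$, the analytic function $$f_0(z)=\int_0^z M\,\frac{1-M\zeta}{M-\zeta}\,d\zeta$$ satisfies the hypotheses with $K=1$ and is not univalent in any disk $\mathbb{D}_r$ with $1/M<r\le 1$. (ii) If $KM=1$, then $f$ is univalent in $\mathbb{D}$ and $f(\mathbb{D})$ contains a schlicht disk $\mathbb{D}$. In fact, $f(z)=e^{i\theta}z$ for some $\theta\in\mathbb{R}$.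
   Context: $\mathbb{D}_r(a)=\{z\in\mathbb{C}:|z-a|<r\}$, $\mathbb{D}_r=\mathbb{D}_r(0)$, $\mathbb{D}=\mathbb{D}_1$. A harmonic mapping in $\mathbb{D}$ is a complex-valued, twice continuously differentiable function $f$ with $4f_{z\bar z}=0$; it can be written $f=h+\overline{g}$ with $h,g$ analytic in $\mathbb{D}$. Put $\Lambda_f(z)=|f_z(z)|+|f_{\bar z}(z)|=|h'(z)|+|g'(z)|$, $\lambda_f(z)=\big||f_z(z)|-|f_{\bar z}(z)|\big|=\big||h'(z)|-|g'(z)|\big|$, and $J_f(z)=|h'(z)|^2-|g'(z)|^2$. The mapping $f$ is sense-preserving if $J_f>0$ in $\mathbb{D}$. A sense-preserving harmonic mapping $f$ is $K$-quasiregular ($K\ge1$) in $\mathbb{D}$ if $\Lambda_f(z)\le K\lambda_f(z)$ for all $z\in\mathbb{D}$. Univalent means injective. A disk $\mathbb{D}_\rho(a)$ is a schlicht disk of $f$ if there is a subdomain $\Omega\subset\mathbb{D}$ such that $f$ is univalent in $\Omega$ and $f(\Omega)=\mathbb{D}_\rho(a)$; ''$f(\mathbb{D}_r)$ contains a schlicht disk $\mathbb{D}_\rho$'' means that $\Omega$ can be taken inside $\mathbb{D}_r$.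
   Formalization: Sense-preserving is taken to mean J_f > 0 in the disk except possibly at isolated points, since the extremal function f_0 has f_0'(1/M) = 0 and so would fail J_f > 0 everywhere; parts (i) and (ii) thereby cover more mappings. *)

(* Defs.v *)
From Stdlib Require Import Reals.
From Coquelicot Require Import Coquelicot.

Open Scope R_scope.

Definition disk (a : C) (r : R) (z : C) : Prop := Cmod (z - a) < r.

Definition unit_disk : C -> Prop := disk 0 1.

Definition holomorphic_in (A : C -> Prop) (f : C -> C) : Prop :=
  forall z : C, A z -> @ex_derive C_AbsRing C_NormedModule f z.

Definition dx (f : C -> C) (z : C) : C :=
  (Derive (fun t : R => Re (f (t, Im z))) (Re z),
   Derive (fun t : R => Im (f (t, Im z))) (Re z)).

Definition dy (f : C -> C) (z : C) : C :=
  (Derive (fun t : R => Re (f (Re z, t))) (Im z),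
   Derive (fun t : R => Im (f (Re z, t))) (Im z)).

Definition ex_dx (f : C -> C) (z : C) : Prop :=
  ex_derive (fun t : R => Re (f (t, Im z))) (Re z) /\
  ex_derive (fun t : R => Im (f (t, Im z))) (Re z).

Definition ex_dy (f : C -> C) (z : C) : Prop :=
  ex_derive (fun t : R => Re (f (Re z, t))) (Im z) /\
  ex_derive (fun t : R => Im (f (Re z, t))) (Im z).

(* Real continuous differentiability of a map of the plane; it is only used on
   open sets A. *)
Definition C1_in (A : C -> Prop) (f : C -> C) : Prop :=
  forall z : C, A z ->
    ex_dx f z /\ ex_dy f z /\ continuous (dx f) z /\ continuous (dy f) z.

Definition C2_in (A : C -> Prop) (f : C -> C) : Prop :=
  C1_in A f /\ C1_in A (dx f) /\ C1_in A (dy f).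

(* Wirtinger derivatives f_z and f_{\bar z}. *)
Definition d_z (f : C -> C) (z : C) : C := ((dx f z - Ci * dy f z) / 2)%C.
Definition d_zbar (f : C -> C) (z : C) : C := ((dx f z + Ci * dy f z) / 2)%C.

Definition harmonic_mapping (f : C -> C) : Prop :=
  C2_in unit_disk f /\
  forall z : C, unit_disk z -> (4 * d_zbar (d_z f) z)%C = 0%C.

Definition Lambda (f : C -> C) (z : C) : R :=
  Cmod (d_z f z) + Cmod (d_zbar f z).
Definition lambda (f : C -> C) (z : C) : R :=
  Rabs (Cmod (d_z f z) - Cmod (d_zbar f z)).
Definition Jac (f : C -> C) (z : C) : R :=
  Cmod (d_z f z) ^ 2 - Cmod (d_zbar f z) ^ 2.

(* J_f > 0 in the unit disk, except possibly at isolated points. Isolated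
   critical points have to be allowed: the extremal function f0 below has
   f0'(1/M) = 0, hence Jac (f0 M) (1/M) = 0. Mappings with J_f > 0 everywhere
   are covered, see sense_preserving_strict. *)
Definition sense_preserving (f : C -> C) : Prop :=
  forall a : C, unit_disk a ->
    locally' a (fun z : C => unit_disk z -> 0 < Jac f z).

Lemma sense_preserving_strict (f : C -> C) :
  (forall z : C, unit_disk z -> 0 < Jac f z) -> sense_preserving f.
Proof.
  intros H a _; apply filter_forall; exact H.
Qed.

Definition quasiregular (K : R) (f : C -> C) : Prop :=
  sense_preserving f /\
  forall z : C, unit_disk z -> Lambda f z <= K * lambda f z.

Definition univalent_in (A : C -> Prop) (f : C -> C) : Prop :=
  forall z w : C, A z -> A w -> f z = f w -> z = w.

Definition connected_set (A : C -> Prop) : Prop :=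
  forall U V : C -> Prop, open U -> open V ->
    (forall z : C, A z -> U z \/ V z) ->
    (exists z : C, A z /\ U z) -> (exists z : C, A z /\ V z) ->
    exists z : C, A z /\ U z /\ V z.

Definition is_domain (A : C -> Prop) : Prop :=
  open A /\ (exists z : C, A z) /\ connected_set A.

(* The image under f of the disk of radius r about 0 contains the schlicht disk
   of centre a and radius rho. *)
Definition contains_schlicht_disk (f : C -> C) (r : R) (a : C) (rho : R) : Prop :=
  exists Omega : C -> Prop,
    is_domain Omega /\
    (forall z : C, Omega z -> disk 0 r z) /\
    univalent_in Omega f /\
    (forall w : C, (exists z : C, Omega z /\ f z = w) <-> disk a rho w).

Definition landau_hypotheses (K M : R) (f h g : C -> C) : Prop :=
  harmonic_mapping f /\
  holomorphic_in unit_disk h /\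
  holomorphic_in unit_disk g /\
  (forall z : C, unit_disk z -> f z = (h z + Cconj (g z))%C) /\
  quasiregular K f /\
  f 0%C = 0%C /\
  lambda f 0%C = 1 /\
  (forall z : C, unit_disk z -> lambda f z <= M).

(* The contour integral is taken along the segment t |-> t z, 0 <= t <= 1. *)
Definition f0 (M : R) (z : C) : C :=
  @RInt C_R_CompleteNormedModule
    (fun t : R => (M * ((1 - M * (t * z)) / (M - t * z)) * z)%C) 0 1.

(* Main.v *)
Require Import Defs.
From Stdlib Require Import Reals Lra Lia ClassicalEpsilon List Ranalysis5.
From Coquelicot Require Import Coquelicot.

Open Scope R_scope.

(** Let [N = K * M].  For every unimodular [e] the function [F = h + e g] is
    holomorphic with [|F'| <= N] and [|F'(0)| >= 1], so the Schwarz-Pick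
    inequality for [F'] gives a unimodular [c] with
    [Re (c F'(z)) >= N (1 - N|z|) / (N - |z|)], which is positive for
    [|z| < 1 / N].  Integrating along segments bounds [|F z1 - F z2|] from
    below, and choosing [e] so that
    [|F z1 - F z2| = ||h z1 - h z2| - |g z1 - g z2||] transfers the bound to
    [f = h + conj g].  This yields univalence and, integrating along radii,
    [|f z| >= psi (|z|)] with [psi (1 / N) = r1].  The values in the disk of
    radius r1 are then attained by a continuity method: since the Jacobian does
    not vanish, an interior minimum of [|f - w|] is a zero.  For [N = 1] the
    equality case of Schwarz-Pick makes [h'] and [g'] constant.

    The Schwarz-Pick inequality rests on the mean value property of continuously
    complex-differentiable functions; that [h'] and [g'] are such functions
    follows from [f] being twice continuously differentiable. *)

(** * Complex differentiation *)

(** Schwarz-Pick needs a holomorphic function, and [f] is not one. The rotations [h + e g] replace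
    it because [| |a| - |b| |] is the least value of [|a + e b|] over unimodular [e]. The minimizing
    [e] changes with the pair of points, so the bounds on [F'] must be uniform in [e]: [|F'| <= |h'|
    + |g'| = Lambda <= K lambda <= K M] and [|F'(0)| >= lambda(0) = 1]. This is where [N = K M]
    comes from; [1 / N] is the zero of the resulting lower bound for [Re (c F')]. That bound
    degenerates at [|z| = 1 / N]. Estimates with a uniform constant therefore hold only on
    [|z| <= r] with [r < 1 / N], and the disk of radius [r1] is exhausted by smaller ones. A
    schlicht disk also requires [Omega] to be connected. [Omega] is the part of the disk of radius
    [r0] that [f] maps into the target disk, and connectedness is obtained by lifting segments
    through the inverse of [f], which is Lipschitz on each smaller disk. *)

Definition ccont (F : C -> C) (z : C) : Prop :=
  forall eps : R, 0 < eps -> exists delta : R, 0 < delta /\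
    forall w : C, Cmod (w - z) < delta -> Cmod (F w - F z) < eps.

(* Caratheodory's form of complex differentiability, in which the chain,
   product and quotient rules are algebraic identities between slopes. *)
Definition cder (F : C -> C) (z l : C) : Prop :=
  exists q : C -> C, ccont q z /\ q z = l /\
    exists delta : R, 0 < delta /\
      forall w : C, Cmod (w - z) < delta -> F w = (F z + q w * (w - z))%C.

Definition vcont (gamma : R -> C) (t : R) : Prop :=
  forall eps : R, 0 < eps -> exists delta : R, 0 < delta /\
    forall u : R, Rabs (u - t) < delta -> Cmod (gamma u - gamma t) < eps.

Definition vder (gamma : R -> C) (t : R) (l : C) : Prop :=
  exists q : R -> C, vcont q t /\ q t = l /\
    exists delta : R, 0 < delta /\
      forall u : R, Rabs (u - t) < delta ->
        gamma u = (gamma t + q u * RtoC (u - t))%C.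

Lemma Cmod_sqr (z : C) : Cmod z * Cmod z = Re z * Re z + Im z * Im z.
Proof.
  generalize (Cmod2_alt z); simpl; intros H; lra.
Qed.

Lemma im_le_Cmod (z : C) : Rabs (Im z) <= Cmod z.
Proof.
  apply Rle_trans with (2 := Rmax_Cmod z), Rmax_r.
Qed.

Lemma Re_le_Cmod (z : C) : Re z <= Cmod z.
Proof.
  apply Rle_trans with (2 := re_le_Cmod z), Rle_abs.
Qed.

Lemma Cmod_minus_sym (z w : C) : Cmod (z - w) = Cmod (w - z).
Proof.
  rewrite <- Cmod_opp; f_equal; ring.
Qed.

Lemma Cmod_triangle_rev (z w : C) : Cmod z - Cmod w <= Cmod (z - w).
Proof.
  assert (H := Cmod_triangle (z - w) w).
  replace (z - w + w)%C with z in H by ring; lra.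
Qed.

Lemma Cmod_le_Re_Im (z : C) : Cmod z <= Rabs (Re z) + Rabs (Im z).
Proof.
  assert (H := Cmod_sqr z); assert (P := Cmod_ge_0 z).
  assert (A := Rabs_pos (Re z)); assert (B := Rabs_pos (Im z)).
  assert (A2 : Rabs (Re z) * Rabs (Re z) = Re z * Re z)
    by (rewrite <- Rabs_mult; apply Rabs_pos_eq; nra).
  assert (B2 : Rabs (Im z) * Rabs (Im z) = Im z * Im z)
    by (rewrite <- Rabs_mult; apply Rabs_pos_eq; nra).
  nra.
Qed.

Lemma ccont_const (c z : C) : ccont (fun _ => c) z.
Proof.
  intros eps He; exists 1; split; [lra|]; intros w _.
  replace (c - c)%C with (RtoC 0) by ring; rewrite Cmod_0; exact He.
Qed.

Lemma ccont_id (z : C) : ccont (fun w => w) z.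
Proof.
  intros eps He; exists eps; split; [exact He|]; tauto.
Qed.

Lemma ccont_plus (F G : C -> C) (z : C) :
  ccont F z -> ccont G z -> ccont (fun w => (F w + G w)%C) z.
Proof.
  intros HF HG eps He.
  destruct (HF (eps / 2)) as [d1 [P1 H1]]; [lra|].
  destruct (HG (eps / 2)) as [d2 [P2 H2]]; [lra|].
  exists (Rmin d1 d2); split; [now apply Rmin_pos|]; intros w Hw.
  assert (W1 := H1 w (Rlt_le_trans _ _ _ Hw (Rmin_l _ _))).
  assert (W2 := H2 w (Rlt_le_trans _ _ _ Hw (Rmin_r _ _))).
  replace (F w + G w - (F z + G z))%C with ((F w - F z) + (G w - G z))%C by ring.
  assert (T := Cmod_triangle (F w - F z) (G w - G z)); lra.
Qed.

Lemma ccont_mult (F G : C -> C) (z : C) :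
  ccont F z -> ccont G z -> ccont (fun w => (F w * G w)%C) z.
Proof.
  intros HF HG eps He.
  set (A := Cmod (F z) + 1); set (B := Cmod (G z)).
  assert (HA : 1 <= A) by (unfold A; assert (X := Cmod_ge_0 (F z)); lra).
  assert (HB : 0 <= B) by apply Cmod_ge_0.
  destruct (HF (Rmin 1 (eps / 2 / (B + 1)))) as [d1 [P1 H1]].
  { apply Rmin_pos; [lra|]; apply Rdiv_lt_0_compat; lra. }
  destruct (HG (eps / 2 / A)) as [d2 [P2 H2]].
  { apply Rdiv_lt_0_compat; lra. }
  exists (Rmin d1 d2); split; [now apply Rmin_pos|]; intros w Hw.
  assert (W1 := H1 w (Rlt_le_trans _ _ _ Hw (Rmin_l _ _))).
  assert (W2 := H2 w (Rlt_le_trans _ _ _ Hw (Rmin_r _ _))).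
  assert (W3 := Rlt_le_trans _ _ _ W1 (Rmin_l _ _)).
  assert (W4 := Rlt_le_trans _ _ _ W1 (Rmin_r _ _)).
  replace (F w * G w - F z * G z)%C
    with (F w * (G w - G z) + (F w - F z) * G z)%C by ring.
  apply Rle_lt_trans with (1 := Cmod_triangle _ _).
  rewrite !Cmod_mult; fold B.
  assert (V1 : Cmod (F w) <= A).
  { assert (X := Cmod_triangle_rev (F w) (F z)); unfold A; lra. }
  assert (V2 : Cmod (F w) * Cmod (G w - G z) <= A * Cmod (G w - G z)).
  { apply Rmult_le_compat_r; [apply Cmod_ge_0|exact V1]. }
  assert (V3 : A * Cmod (G w - G z) < A * (eps / 2 / A)).
  { apply Rmult_lt_compat_l; lra. }
  replace (A * (eps / 2 / A)) with (eps / 2) in V3 by (field; lra).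
  assert (V4 : Cmod (F w - F z) * B <= (eps / 2 / (B + 1)) * B).
  { apply Rmult_le_compat_r; lra. }
  assert (V5 : (eps / 2 / (B + 1)) * B <= eps / 2).
  { assert (X : eps / 2 / (B + 1) * (B + 1) = eps / 2) by (field; lra).
    assert (Y : 0 < eps / 2 / (B + 1)) by (apply Rdiv_lt_0_compat; lra). lra. }
  lra.
Qed.

Lemma ccont_opp (F : C -> C) (z : C) :
  ccont F z -> ccont (fun w => (- F w)%C) z.
Proof.
  intros H eps He; destruct (H eps He) as [d [P Q]].
  exists d; split; [exact P|]; intros w Hw.
  replace (- F w - - F z)%C with (- (F w - F z))%C by ring.
  rewrite Cmod_opp; auto.
Qed.

Lemma ccont_minus (F G : C -> C) (z : C) :
  ccont F z -> ccont G z -> ccont (fun w => (F w - G w)%C) z.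
Proof.
  intros HF HG; apply ccont_plus; [exact HF|now apply ccont_opp].
Qed.

Lemma ccont_conj (F : C -> C) (z : C) :
  ccont F z -> ccont (fun w => Cconj (F w)) z.
Proof.
  intros H eps He; destruct (H eps He) as [d [P Q]].
  exists d; split; [exact P|]; intros w Hw.
  rewrite <- Cminus_conj, Cmod_conj; auto.
Qed.

(** The bound [|F z| / 2] is quantitative so that [1 / F] stays bounded near [z] in [ccont_inv]. *)
Lemma ccont_neq0 (F : C -> C) (z : C) :
  ccont F z -> F z <> 0%C ->
  exists delta : R, 0 < delta /\
    forall w : C, Cmod (w - z) < delta -> Cmod (F z) / 2 < Cmod (F w).
Proof.
  intros H Hz; apply Cmod_gt_0 in Hz.
  destruct (H (Cmod (F z) / 2)) as [d [P Q]]; [lra|].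
  exists d; split; [exact P|]; intros w Hw.
  assert (X := Q w Hw); assert (Y := Cmod_triangle_rev (F z) (F w)).
  rewrite Cmod_minus_sym in Y; lra.
Qed.

Lemma ccont_inv (F : C -> C) (z : C) :
  ccont F z -> F z <> 0%C -> ccont (fun w => (/ F w)%C) z.
Proof.
  intros H Hz eps He.
  destruct (ccont_neq0 F z H Hz) as [d1 [P1 H1]].
  assert (Hp := proj1 (Cmod_gt_0 _) Hz).
  set (a := Cmod (F z)) in *.
  destruct (H (eps * (a * a) / 2)) as [d2 [P2 H2]].
  { assert (0 < eps * (a * a)) by (apply Rmult_lt_0_compat; nra); lra. }
  exists (Rmin d1 d2); split; [now apply Rmin_pos|]; intros w Hw.
  assert (W1 := H1 w (Rlt_le_trans _ _ _ Hw (Rmin_l _ _))).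
  assert (W2 := H2 w (Rlt_le_trans _ _ _ Hw (Rmin_r _ _))).
  assert (Fw : F w <> 0%C) by (apply Cmod_gt_0; lra).
  replace (/ F w - / F z)%C with ((F z - F w) / (F w * F z))%C by (field; auto).
  rewrite Cmod_div by (now apply Cmult_neq_0).
  rewrite Cmod_minus_sym, Cmod_mult; fold a.
  apply Rmult_lt_reg_r with (Cmod (F w) * a); [nra|].
  replace (Cmod (F w - F z) / (Cmod (F w) * a) * (Cmod (F w) * a))
    with (Cmod (F w - F z)) by (field; nra).
  assert (eps * (a * a) / 2 < eps * (Cmod (F w) * a)).
  { replace (eps * (a * a) / 2) with (eps * (a / 2 * a)) by field.
    apply Rmult_lt_compat_l; nra. }
  lra.
Qed.

Lemma ccont_div (F G : C -> C) (z : C) :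
  ccont F z -> ccont G z -> G z <> 0%C -> ccont (fun w => (F w / G w)%C) z.
Proof.
  intros HF HG Hz; apply ccont_mult; [exact HF|now apply ccont_inv].
Qed.

Lemma ccont_ext_loc (F G : C -> C) (z : C) :
  (exists delta : R, 0 < delta /\
     forall w : C, Cmod (w - z) < delta -> F w = G w) ->
  ccont F z -> ccont G z.
Proof.
  intros [d [P E]] H eps He; destruct (H eps He) as [d' [P' H']].
  exists (Rmin d d'); split; [now apply Rmin_pos|]; intros w Hw.
  rewrite <- !E; [apply H'| |].
  - apply Rlt_le_trans with (1 := Hw), Rmin_r.
  - replace (z - z)%C with (RtoC 0) by ring; now rewrite Cmod_0.
  - apply Rlt_le_trans with (1 := Hw), Rmin_l.
Qed.

Lemma cder_ccont (F : C -> C) (z l : C) : cder F z l -> ccont F z.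
Proof.
  intros [q [Hq [_ [d [Pd E]]]]].
  apply ccont_ext_loc with (fun w => (F z + q w * (w - z))%C).
  { exists d; split; [exact Pd|]; intros w Hw; now rewrite <- E. }
  apply ccont_plus; [apply ccont_const|].
  apply ccont_mult; [exact Hq|]; apply ccont_minus;
    [apply ccont_id|apply ccont_const].
Qed.

Lemma cder_const (c z : C) : cder (fun _ => c) z 0%C.
Proof.
  exists (fun _ => 0%C); split; [apply ccont_const|]; split; [reflexivity|].
  exists 1; split; [lra|]; intros w _; ring.
Qed.

Lemma cder_id (z : C) : cder (fun w => w) z 1%C.
Proof.
  exists (fun _ => 1%C); split; [apply ccont_const|]; split; [reflexivity|].
  exists 1; split; [lra|]; intros w _; ring.
Qed.

Lemma cder_plus (F G : C -> C) (z l m : C) :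
  cder F z l -> cder G z m -> cder (fun w => (F w + G w)%C) z (l + m)%C.
Proof.
  intros [q [Hq [Eq [d [Pd E]]]]] [q' [Hq' [Eq' [d' [Pd' E']]]]].
  exists (fun w => (q w + q' w)%C); split; [now apply ccont_plus|].
  split; [now rewrite Eq, Eq'|].
  exists (Rmin d d'); split; [now apply Rmin_pos|]; intros w Hw.
  rewrite (E w), (E' w); [ring| |].
  - apply Rlt_le_trans with (1 := Hw), Rmin_r.
  - apply Rlt_le_trans with (1 := Hw), Rmin_l.
Qed.

Lemma cder_mult (F G : C -> C) (z l m : C) :
  cder F z l -> cder G z m ->
  cder (fun w => (F w * G w)%C) z (l * G z + F z * m)%C.
Proof.
  intros HF HG; assert (CG := cder_ccont _ _ _ HG).
  destruct HF as [q [Hq [Eq [d [Pd E]]]]].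
  destruct HG as [q' [Hq' [Eq' [d' [Pd' E']]]]].
  exists (fun w => (q w * G w + F z * q' w)%C); split.
  { apply ccont_plus; apply ccont_mult; auto using ccont_const. }
  split; [now rewrite Eq, Eq'|].
  exists (Rmin d d'); split; [now apply Rmin_pos|]; intros w Hw.
  rewrite (E w), (E' w); [ring| |].
  - apply Rlt_le_trans with (1 := Hw), Rmin_r.
  - apply Rlt_le_trans with (1 := Hw), Rmin_l.
Qed.

Lemma cder_scal (c : C) (F : C -> C) (z l : C) :
  cder F z l -> cder (fun w => (c * F w)%C) z (c * l)%C.
Proof.
  intros H; replace (c * l)%C with (0 * F z + c * l)%C by ring.
  apply (cder_mult (fun _ => c)); [apply cder_const|exact H].
Qed.

Lemma cder_minus (F G : C -> C) (z l m : C) :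
  cder F z l -> cder G z m -> cder (fun w => (F w - G w)%C) z (l - m)%C.
Proof.
  intros HF [q' [Hq' [Eq' [d' [Pd' E']]]]].
  apply cder_plus; [exact HF|].
  exists (fun w => (- q' w)%C); split; [now apply ccont_opp|].
  split; [now rewrite Eq'|].
  exists d'; split; [exact Pd'|]; intros w Hw; rewrite (E' w Hw); ring.
Qed.

Lemma cder_inv (F : C -> C) (z l : C) :
  cder F z l -> F z <> 0%C -> cder (fun w => (/ F w)%C) z (- l / (F z * F z))%C.
Proof.
  intros HF Hz; assert (CF := cder_ccont _ _ _ HF).
  destruct HF as [q [Hq [Eq [d [Pd E]]]]].
  destruct (ccont_neq0 F z CF Hz) as [d1 [P1 H1]].
  exists (fun w => (- q w / (F w * F z))%C); split.
  { apply ccont_div; [now apply ccont_opp| |now apply Cmult_neq_0].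
    apply ccont_mult; [exact CF|apply ccont_const]. }
  split; [now rewrite Eq|].
  exists (Rmin d d1); split; [now apply Rmin_pos|]; intros w Hw.
  assert (Fw : F w <> 0%C).
  { apply Cmod_gt_0; assert (X := Cmod_ge_0 (F z)).
    assert (Y := H1 w (Rlt_le_trans _ _ _ Hw (Rmin_r _ _))); lra. }
  assert (E1 : (q w * (w - z))%C = (F w - F z)%C).
  { rewrite (E w (Rlt_le_trans _ _ _ Hw (Rmin_l _ _))); ring. }
  replace (/ F z + - q w / (F w * F z) * (w - z))%C
    with (/ F z - (q w * (w - z)) / (F w * F z))%C by (field; auto).
  rewrite E1; field; auto.
Qed.

Lemma cder_div (F G : C -> C) (z l m : C) :
  cder F z l -> cder G z m -> G z <> 0%C ->
  cder (fun w => (F w / G w)%C) z ((l * G z - F z * m) / (G z * G z))%C.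
Proof.
  intros HF HG Hz.
  replace ((l * G z - F z * m) / (G z * G z))%C
    with (l * / G z + F z * (- m / (G z * G z)))%C by (field; auto).
  apply (cder_mult F (fun w => / G w)%C); [exact HF|now apply cder_inv].
Qed.

Lemma cder_ext_loc (F G : C -> C) (z l : C) :
  (exists delta : R, 0 < delta /\
     forall w : C, Cmod (w - z) < delta -> F w = G w) ->
  cder F z l -> cder G z l.
Proof.
  intros [d [P H]] [q [Hq [Eq [d' [Pd' E]]]]].
  exists q; split; [exact Hq|]; split; [exact Eq|].
  exists (Rmin d d'); split; [now apply Rmin_pos|]; intros w Hw.
  rewrite <- !H; [apply E| |].
  - apply Rlt_le_trans with (1 := Hw), Rmin_r.
  - replace (z - z)%C with (RtoC 0) by ring; now rewrite Cmod_0.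
  - apply Rlt_le_trans with (1 := Hw), Rmin_l.
Qed.

Lemma cder_eps_delta (F : C -> C) (z l : C) :
  (forall eps : R, 0 < eps -> exists delta : R, 0 < delta /\
     forall w : C, Cmod (w - z) < delta ->
       Cmod (F w - F z - (w - z) * l) <= eps * Cmod (w - z)) ->
  cder F z l.
Proof.
  intros H.
  (* The slope is the difference quotient, filled in at [z] by [l]; the estimate says exactly that
     this filling is continuous. *)
  set (q := fun w => if excluded_middle_informative (w = z) then l
                     else ((F w - F z) / (w - z))%C).
  assert (Qz : q z = l).
  { unfold q; destruct (excluded_middle_informative (z = z)); congruence. }
  exists q; split; [|split; [exact Qz|]].
  - intros eps He; destruct (H (eps / 2)) as [d [Pd Hd]]; [lra|].
    exists d; split; [exact Pd|]; intros w Hw; rewrite Qz.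
    unfold q; destruct (excluded_middle_informative (w = z)) as [->|Hn].
    + replace (l - l)%C with (RtoC 0) by ring; now rewrite Cmod_0.
    + assert (Hz : (w - z)%C <> 0%C).
      { intros E; apply Hn; replace w with (w - z + z)%C by ring; rewrite E; ring. }
      assert (Pz := proj1 (Cmod_gt_0 _) Hz).
      replace ((F w - F z) / (w - z) - l)%C
        with ((F w - F z - (w - z) * l) / (w - z))%C by (field; auto).
      rewrite Cmod_div by exact Hz.
      apply Rle_lt_trans with (eps / 2); [|lra].
      apply Rmult_le_reg_r with (Cmod (w - z)); [exact Pz|].
      unfold Rdiv at 1; rewrite Rmult_assoc, Rinv_l, Rmult_1_r by lra; auto.
  - exists 1; split; [lra|]; intros w _.
    unfold q; destruct (excluded_middle_informative (w = z)) as [->|Hn].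
    + ring.
    + field; intros E; apply Hn; replace w with (w - z + z)%C by ring; rewrite E; ring.
Qed.

Lemma is_derive_cder (F : C -> C) (z l : C) :
  @is_derive C_AbsRing C_NormedModule F z l -> cder F z l.
Proof.
  intros [_ H]; apply cder_eps_delta; intros eps He.
  destruct (H z (fun P HP => HP) (mkposreal eps He)) as [d Hd].
  exists d; split; [apply cond_pos|]; intros w Hw.
  exact (Hd w Hw).
Qed.

Lemma cder_is_derive (F : C -> C) (z l : C) :
  cder F z l -> @is_derive C_AbsRing C_NormedModule F z l.
Proof.
  intros [q [Hq [Eq [d [Pd E]]]]]; split.
  - apply is_linear_scal_l.
  - intros x Hx.
    apply (@is_filter_lim_locally_unique _ (AbsRing_NormedModule C_AbsRing)) in Hx.
    subst x.
    intros eps; destruct (Hq eps (cond_pos eps)) as [d' [Pd' H']].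
    assert (Pm : 0 < Rmin d d') by now apply Rmin_pos.
    exists (mkposreal _ Pm); intros w Hw.
    change (Cmod (w - z) < Rmin d d') in Hw.
    change (Cmod (F w - F z - (w - z) * l) <= eps * Cmod (w - z)).
    rewrite (E w) by (apply Rlt_le_trans with (1 := Hw), Rmin_l).
    replace (F z + q w * (w - z) - F z - (w - z) * l)%C
      with ((q w - q z) * (w - z))%C by (rewrite Eq; ring).
    rewrite Cmod_mult; apply Rmult_le_compat_r; [apply Cmod_ge_0|].
    left; apply H', Rlt_le_trans with (1 := Hw), Rmin_r.
Qed.

(** Precomposing a curve with [Re] makes it a function on the plane, so the closure rules proved for
    [ccont] also serve curves. *)
Lemma vcont_ccont (q : R -> C) (t : R) :
  vcont q t <-> ccont (fun w => q (Re w)) (RtoC t).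
Proof.
  split; intros H eps He; destruct (H eps He) as [d [Pd Hd]];
    exists d; split; try exact Pd.
  - intros w Hw; apply Hd.
    apply Rle_lt_trans with (2 := Hw), (re_le_Cmod (w - RtoC t)).
  - intros u Hu; apply (Hd (RtoC u)).
    now rewrite <- RtoC_minus, Cmod_R.
Qed.

Lemma vcont_mult (q p : R -> C) (t : R) :
  vcont q t -> vcont p t -> vcont (fun u => (q u * p u)%C) t.
Proof.
  rewrite !vcont_ccont; intros Hq Hp; exact (ccont_mult _ _ _ Hq Hp).
Qed.

Lemma cder_vder (F : C -> C) (gamma : R -> C) (t : R) (l m : C) :
  cder F (gamma t) l -> vder gamma t m -> vder (fun u => F (gamma u)) t (l * m)%C.
Proof.
  intros [q [Hq [Eq [d [Pd E]]]]] [p [Hp [Ep [d' [Pd' E']]]]].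
  (* The slope of the composite is [q (gamma u) * p u], whose continuity needs that of [gamma]. It
     follows because [p] is bounded by [B] near [t]. *)
  assert (CG : vcont gamma t).
  { intros eps He.
    destruct (Hp 1) as [d1 [P1 H1]]; [lra|].
    set (B := Cmod (p t) + 1).
    assert (HB : 0 < B) by (unfold B; assert (X := Cmod_ge_0 (p t)); lra).
    exists (Rmin (Rmin d' d1) (eps / B)); split.
    { repeat apply Rmin_pos; auto; now apply Rdiv_lt_0_compat. }
    intros u Hu.
    assert (Hu1 := Rlt_le_trans _ _ _ Hu (Rmin_l _ _)).
    assert (Hu2 := Rlt_le_trans _ _ _ Hu (Rmin_r _ _)).
    rewrite (E' u (Rlt_le_trans _ _ _ Hu1 (Rmin_l _ _))).
    replace (gamma t + p u * RtoC (u - t) - gamma t)%C with (p u * RtoC (u - t))%C by ring.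
    rewrite Cmod_mult, Cmod_R.
    assert (X := H1 u (Rlt_le_trans _ _ _ Hu1 (Rmin_r _ _))).
    assert (Y := Cmod_triangle_rev (p u) (p t)).
    apply Rle_lt_trans with (B * Rabs (u - t)).
    - apply Rmult_le_compat_r; [apply Rabs_pos|]; unfold B; lra.
    - apply Rmult_lt_reg_r with (/ B); [now apply Rinv_0_lt_compat|].
      replace (B * Rabs (u - t) * / B) with (Rabs (u - t)) by (field; lra); exact Hu2. }
  assert (CQ : vcont (fun u => q (gamma u)) t).
  { intros eps He; destruct (Hq eps He) as [d1 [P1 H1]].
    destruct (CG d1 P1) as [d2 [P2 H2]]; exists d2; auto. }
  destruct (CG d Pd) as [d0 [P0 H0]].
  exists (fun u => (q (gamma u) * p u)%C); split; [|split; [now rewrite Eq, Ep|]].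
  - now apply (vcont_mult (fun u => q (gamma u))).
  - exists (Rmin d' d0); split; [now apply Rmin_pos|]; intros u Hu.
    rewrite (E (gamma u)) by (apply H0, Rlt_le_trans with (1 := Hu), Rmin_r).
    assert (E1 : (gamma u - gamma t)%C = (p u * RtoC (u - t))%C).
    { rewrite (E' u (Rlt_le_trans _ _ _ Hu (Rmin_l _ _))); ring. }
    rewrite E1; ring.
Qed.

Lemma is_derive_slope (x q : R -> R) (t : R) :
  (forall eps : R, 0 < eps -> exists delta : R, 0 < delta /\
     forall u : R, Rabs (u - t) < delta ->
       x u = x t + q u * (u - t) /\ Rabs (q u - q t) < eps) ->
  is_derive x t (q t).
Proof.
  intros H; apply is_derive_Reals; intros eps He.
  destruct (H eps He) as [d [Pd Hd]]; exists (mkposreal d Pd); intros k Hk Hd'.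
  simpl in Hd'.
  destruct (Hd (t + k)) as [E1 E2]; [now replace (t + k - t) with k by ring|].
  rewrite E1; replace ((x t + q (t + k) * (t + k - t) - x t) / k - q t)
    with (q (t + k) - q t) by (field; exact Hk); exact E2.
Qed.

Lemma vder_Re (gamma : R -> C) (t : R) (l : C) :
  vder gamma t l -> is_derive (fun u => Re (gamma u)) t (Re l).
Proof.
  intros [q [Hq [Eq [d [Pd E]]]]]; rewrite <- Eq.
  apply (is_derive_slope _ (fun u => Re (q u))); intros eps He.
  destruct (Hq eps He) as [d' [Pd' H']].
  exists (Rmin d d'); split; [now apply Rmin_pos|]; intros u Hu; split.
  - rewrite (E u) by (apply Rlt_le_trans with (1 := Hu), Rmin_l).
    unfold Re, Im; simpl; ring.
  - apply Rle_lt_trans with (2 := H' u (Rlt_le_trans _ _ _ Hu (Rmin_r _ _))).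
    exact (re_le_Cmod (q u - q t)).
Qed.

Lemma vder_Im (gamma : R -> C) (t : R) (l : C) :
  vder gamma t l -> is_derive (fun u => Im (gamma u)) t (Im l).
Proof.
  intros [q [Hq [Eq [d [Pd E]]]]]; rewrite <- Eq.
  apply (is_derive_slope _ (fun u => Im (q u))); intros eps He.
  destruct (Hq eps He) as [d' [Pd' H']].
  exists (Rmin d d'); split; [now apply Rmin_pos|]; intros u Hu; split.
  - rewrite (E u) by (apply Rlt_le_trans with (1 := Hu), Rmin_l).
    unfold Re, Im; simpl; ring.
  - apply Rle_lt_trans with (2 := H' u (Rlt_le_trans _ _ _ Hu (Rmin_r _ _))).
    exact (im_le_Cmod (q u - q t)).
Qed.

Lemma vder_line (p e : C) (t : R) : vder (fun u => (p + RtoC u * e)%C) t e.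
Proof.
  exists (fun _ => e); split; [|split; [reflexivity|]].
  - intros eps He; exists 1; split; [lra|]; intros u _.
    replace (e - e)%C with (RtoC 0) by ring; now rewrite Cmod_0.
  - exists 1; split; [lra|]; intros u _; rewrite RtoC_minus; ring.
Qed.

Lemma vder_pair (x y : R -> R) (t a b : R) :
  is_derive x t a -> is_derive y t b -> vder (fun u => (x u, y u)) t (a, b).
Proof.
  intros Hx Hy; apply is_derive_Reals in Hx; apply is_derive_Reals in Hy.
  set (sl := fun (f : R -> R) (l u : R) =>
         if excluded_middle_informative (u = t) then l else (f u - f t) / (u - t)).
  assert (St : forall f l, sl f l t = l).
  { intros f l; unfold sl; destruct (excluded_middle_informative (t = t)); congruence. }
  assert (Su : forall f l u, f u = f t + sl f l u * (u - t)).
  { intros f l u; unfold sl; destruct (excluded_middle_informative (u = t)) as [->|Hn];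
      [ring|field; lra]. }
  assert (Sc : forall f l, derivable_pt_lim f t l -> forall eps, 0 < eps ->
            exists delta, 0 < delta /\ forall u, Rabs (u - t) < delta ->
              Rabs (sl f l u - l) < eps).
  { intros f l H eps He; destruct (H eps He) as [d Hd].
    exists d; split; [apply cond_pos|]; intros u Hu; unfold sl.
    destruct (excluded_middle_informative (u = t)) as [->|Hn].
    - replace (l - l) with 0 by ring; rewrite Rabs_R0; exact He.
    - specialize (Hd (u - t)); replace (t + (u - t)) with u in Hd by ring.
      apply Hd; [lra|exact Hu]. }
  exists (fun u => (sl x a u, sl y b u)); split; [|split].
  - intros eps He.
    destruct (Sc x a Hx (eps / 2)) as [d1 [P1 H1]]; [lra|].
    destruct (Sc y b Hy (eps / 2)) as [d2 [P2 H2]]; [lra|].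
    exists (Rmin d1 d2); split; [now apply Rmin_pos|]; intros u Hu.
    apply Rle_lt_trans with (1 := Cmod_le_Re_Im _); simpl; rewrite !St.
    assert (W1 := H1 u (Rlt_le_trans _ _ _ Hu (Rmin_l _ _))).
    assert (W2 := H2 u (Rlt_le_trans _ _ _ Hu (Rmin_r _ _))).
    unfold Rminus in *; lra.
  - now rewrite !St.
  - exists 1; split; [lra|]; intros u _.
    apply injective_projections; simpl.
    + rewrite (Su x a u) at 1; ring.
    + rewrite (Su y b u) at 1; ring.
Qed.

(** * Maximum principle and Schwarz-Pick inequality *)

Definition rcont (u : C -> R) (z : C) : Prop :=
  forall eps : R, 0 < eps -> exists delta : R, 0 < delta /\
    forall w : C, Cmod (w - z) < delta -> Rabs (u w - u z) < eps.

(** If no maximum existed, each point would have a strictly larger value elsewhere, and by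
    continuity that value would beat all of a neighbourhood. Finitely many neighbourhoods cover the
    disk, and the best of the finitely many values would then beat itself. *)
Lemma extreme_value_disk (u : C -> R) (r : R) :
  0 <= r -> (forall z, Cmod z <= r -> rcont u z) ->
  exists p, Cmod p <= r /\ forall z, Cmod z <= r -> u z <= u p.
Proof.
  intros Hr Hu; apply NNPP; intros Hn.
  assert (Hex : forall z, Cmod z <= r -> exists z', Cmod z' <= r /\ u z < u z').
  { intros z Hz; apply NNPP; intros H; apply Hn; exists z; split; [exact Hz|].
    intros w Hw; apply Rnot_lt_le; intros L; apply H; now exists w. }
  set (pt := fun t : Compactness.Tn 2 R => (fst t, fst (snd t)) : C).
  (* The factor 2 is there because the compactness lemma controls each coordinate by [d], hence the
     modulus by [2 * d]. *)
  set (good := fun (t : Compactness.Tn 2 R) (d : R) (y : C) =>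
         Cmod y <= r /\ forall w, Cmod (w - pt t) < 2 * d -> Cmod w <= r -> u w < u y).
  assert (Hd : forall t, exists d : posreal, exists y, good t d y).
  { intros t; destruct (Rle_lt_dec (Cmod (pt t)) r) as [Ht|Ht].
    - destruct (Hex _ Ht) as [y [Hy1 Hy2]].
      destruct (Hu _ Ht (u y - u (pt t))) as [d [Pd Hd]]; [lra|].
      assert (P2 : 0 < d / 2) by lra.
      exists (mkposreal _ P2); exists y; split; [exact Hy1|]; simpl.
      intros w Hw _; assert (X := Hd w); replace (2 * (d / 2)) with d in Hw by field.
      assert (Y := Rle_abs (u w - u (pt t))); specialize (X Hw); lra.
    - assert (P2 : 0 < (Cmod (pt t) - r) / 2) by lra.
      exists (mkposreal _ P2); exists 0%C; split; [rewrite Cmod_0; exact Hr|]; simpl.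
      intros w Hw Hw'; assert (X := Cmod_triangle_rev (pt t) w).
      rewrite Cmod_minus_sym in X; lra. }
  set (delta := fun t => proj1_sig (constructive_indefinite_description _ (Hd t))).
  assert (Hdelta : forall t, exists y, good t (delta t) y).
  { intros t; exact (proj2_sig (constructive_indefinite_description _ (Hd t))). }
  (* The cover is taken over the square [[-r, r] x [-r, r]]. Base points outside the disk received a
     radius so small that their condition in [good] is vacuous. The conclusion of the compactness
     lemma is doubly negated, which suffices as the goal is [False]. *)
  apply (compactness_list 2 (- r, (- r, tt)) (r, (r, tt)) delta); intros [l Hl].
  assert (Hmax : forall l', exists y, Cmod y <= r /\ forall t, In t l' ->
            forall w, Cmod (w - pt t) < 2 * delta t -> Cmod w <= r -> u w < u y).
  { induction l' as [|t l' [y [Hy IH]]].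
    - exists 0%C; split; [rewrite Cmod_0; exact Hr|]; intros t [].
    - destruct (Hdelta t) as [y' [Hy' H']].
      destruct (Rle_lt_dec (u y) (u y')) as [L|L].
      + exists y'; split; [exact Hy'|]; intros t0 [<-|Ht0] w Hw1 Hw2; [now apply H'|].
        apply Rlt_le_trans with (2 := L); now apply IH with t0.
      + exists y; split; [exact Hy|]; intros t0 [<-|Ht0] w Hw1 Hw2.
        * apply Rlt_trans with (2 := L); now apply H'.
        * now apply IH with t0. }
  destruct (Hmax l) as [y [Hy H]].
  destruct (Hl (fst y, (snd y, tt))) as [[t1 [t2 []]] [Ht1 [_ [Hc1 [Hc2 _]]]]].
  { assert (X := re_le_Cmod y); assert (Y := im_le_Cmod y).
    unfold Re in X; unfold Im in Y; simpl.
    apply Rabs_le_between in X; apply Rabs_le_between in Y; repeat split; lra. }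
  apply (Rlt_irrefl (u y)), (H _ Ht1); [|exact Hy].
  apply Rle_lt_trans with (1 := Cmod_le_Re_Im _).
  apply Rlt_le_trans with (1 := Rplus_lt_compat _ _ _ _ Hc1 Hc2), Req_le; ring.
Qed.

(** * Circular means of holomorphic functions *)

Definition circ (p : C) (s th : R) : C := (fst p + s * cos th, snd p + s * sin th).

Lemma Cmod_cis (th : R) : Cmod (cos th, sin th) = 1.
Proof.
  unfold Cmod; simpl.
  replace (cos th * (cos th * 1) + sin th * (sin th * 1)) with 1; [apply sqrt_1|].
  generalize (sin2_cos2 th); unfold Rsqr; lra.
Qed.

Lemma Cmod_circ (p : C) (s th : R) : Cmod (circ p s th - p) = Rabs s.
Proof.
  replace (circ p s th - p)%C with (RtoC s * (cos th, sin th))%C.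
  - rewrite Cmod_mult, Cmod_R, Cmod_cis; ring.
  - apply injective_projections; simpl; ring.
Qed.

Lemma continuity_2d_ccont (H : C -> C) (x y : R -> R -> R) (s th : R) :
  continuity_2d_pt x s th -> continuity_2d_pt y s th ->
  ccont H (x s th, y s th) ->
  continuity_2d_pt (fun a b => Re (H (x a b, y a b))) s th /\
  continuity_2d_pt (fun a b => Im (H (x a b, y a b))) s th.
Proof.
  intros Hx Hy HH.
  assert (K : forall eps : posreal, locally_2d (fun a b =>
    Cmod (H (x a b, y a b) - H (x s th, y s th)) < eps) s th).
  { intros eps; destruct (HH eps (cond_pos eps)) as [d [Pd Hd]].
    assert (P2 : 0 < d / 2) by lra.
    generalize (locally_2d_and _ _ _ _ (Hx (mkposreal _ P2)) (Hy (mkposreal _ P2))).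
    apply locally_2d_impl, locally_2d_forall; intros a b [H1 H2]; apply Hd.
    apply Rle_lt_trans with (1 := Cmod_le_Re_Im _).
    unfold Re, Im; simpl in *; unfold Rminus in *; lra. }
  split; intros eps; generalize (K eps);
    apply locally_2d_impl, locally_2d_forall; intros a b Hab;
    apply Rle_lt_trans with (2 := Hab).
  - exact (re_le_Cmod (H (x a b, y a b) - H (x s th, y s th))).
  - exact (im_le_Cmod (H (x a b, y a b) - H (x s th, y s th))).
Qed.

(** The product with [(cos b, sin b)] is the form taken by the radial derivative in
    [is_derive_circ_radius]; joint continuity is what differentiation under the integral sign
    requires. *)
Lemma continuity_2d_circ (H : C -> C) (p : C) (s th : R) :
  ccont H (circ p s th) ->
  continuity_2d_pt (fun a b => Re (H (circ p a b) * (cos b, sin b))) s th.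
Proof.
  intros HH.
  assert (Hc : continuity_2d_pt (fun _ b => cos b) s th).
  { apply (continuity_1d_2d_pt_comp cos (fun _ b => b));
      [apply continuity_cos|apply continuity_2d_pt_id2]. }
  assert (Hs : continuity_2d_pt (fun _ b => sin b) s th).
  { apply (continuity_1d_2d_pt_comp sin (fun _ b => b));
      [apply continuity_sin|apply continuity_2d_pt_id2]. }
  destruct (continuity_2d_ccont H (fun a b => fst p + a * cos b)
              (fun a b => snd p + a * sin b) s th) as [H1 H2]; try exact HH.
  - apply continuity_2d_pt_plus; [apply continuity_2d_pt_const|].
    apply continuity_2d_pt_mult; [apply continuity_2d_pt_id1|exact Hc].
  - apply continuity_2d_pt_plus; [apply continuity_2d_pt_const|].
    apply continuity_2d_pt_mult; [apply continuity_2d_pt_id1|exact Hs].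
  - apply (continuity_2d_pt_minus
      (fun a b => Re (H (circ p a b)) * cos b) (fun a b => Im (H (circ p a b)) * sin b)).
    + now apply continuity_2d_pt_mult.
    + now apply continuity_2d_pt_mult.
Qed.

Lemma is_derive_circ_radius (G : C -> C) (p : C) (s th : R) (l : C) :
  cder G (circ p s th) l ->
  is_derive (fun a => Re (G (circ p a th))) s (Re (l * (cos th, sin th))).
Proof.
  intros H; apply (vder_Re (fun a => G (circ p a th))).
  apply (cder_vder G (fun a => circ p a th)); [exact H|].
  apply vder_pair; auto_derive; auto; ring.
Qed.

Lemma vder_circ_angle (G : C -> C) (p : C) (s th : R) (l : C) :
  cder G (circ p s th) l ->
  vder (fun b => G (circ p s b)) th (l * ((- s * sin th)%R, (s * cos th)%R))%C.
Proof.
  intros H; apply (cder_vder G (fun b => circ p s b)); [exact H|].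
  apply vder_pair; auto_derive; auto; ring.
Qed.

Lemma ex_RInt_circ (G : C -> C) (p : C) (s a b : R) :
  (forall th, exists l, cder G (circ p s th) l) ->
  ex_RInt (fun th => Re (G (circ p s th))) a b.
Proof.
  intros H; apply (@ex_RInt_continuous R_CompleteNormedModule); intros th _.
  apply (@ex_derive_continuous R_AbsRing R_NormedModule).
  destruct (H th) as [l Hl]; eexists.
  exact (vder_Re _ _ _ (vder_circ_angle _ _ _ _ _ Hl)).
Qed.

(* The radial derivative of the circular mean of [Re G] is, by the
   Cauchy-Riemann equations, the integral of the angular derivative of [Im G]
   over a period, hence zero. *)
Lemma circular_mean_derive (G G' : C -> C) (p : C) (s0 s : R) :
  (forall z, 0 < Cmod (z - p) < s0 -> cder G z (G' z) /\ ccont G' z) ->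
  0 < s < s0 ->
  is_derive (fun a => RInt (fun th => Re (G (circ p a th))) 0 (2 * PI)) s 0.
Proof.
  intros HG Hs.
  assert (HC : forall a th, 0 < a < s0 ->
    cder G (circ p a th) (G' (circ p a th)) /\ ccont G' (circ p a th)).
  { intros a th Ha; apply HG; rewrite Cmod_circ, Rabs_pos_eq; lra. }
  assert (Hloc : locally s (fun a => 0 < a < s0)).
  { apply (open_and (fun a => 0 < a) (fun a => a < s0));
      [apply open_gt|apply open_lt|exact Hs]. }
  assert (Hz : RInt (fun th => Derive (fun a => Re (G (circ p a th))) s) 0 (2 * PI) = 0).
  { apply is_RInt_unique.
    replace 0 with (minus (Im (G (circ p s (2 * PI))) / s) (Im (G (circ p s 0)) / s)) at 2.
    2: { replace (circ p s (2 * PI)) with (circ p s 0).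
         - exact (minus_eq_zero (Im (G (circ p s 0)) / s)).
         - unfold circ; now rewrite cos_2PI, sin_2PI, cos_0, sin_0. }
    apply (is_RInt_derive (V := R_CompleteNormedModule)
             (fun th => Im (G (circ p s th)) / s)
             (fun th => Derive (fun a => Re (G (circ p a th))) s)).
    - intros th _; destruct (HC s th Hs) as [H1 _].
      replace (Derive (fun a => Re (G (circ p a th))) s)
        with (Re (G' (circ p s th) * (cos th, sin th)))
        by (symmetry; apply is_derive_unique, is_derive_circ_radius; exact H1).
      replace (Re (G' (circ p s th) * (cos th, sin th)))
        with (Im (G' (circ p s th) * ((- s * sin th)%R, (s * cos th)%R)) * / s).
      2: { unfold Re, Im; simpl; field; lra. }
      apply (is_derive_scal_l (fun th => Im (G (circ p s th))) th _ (/ s)).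
      exact (vder_Im _ _ _ (vder_circ_angle _ _ _ _ _ H1)).
    - intros th _.
      apply continuous_ext with (fun th => Re (G' (circ p s th) * (cos th, sin th))).
      { intros t; symmetry; apply is_derive_unique, is_derive_circ_radius.
        now apply HC. }
      apply continuity_pt_filterlim; intros eps He.
      destruct (HC s th Hs) as [_ H2].
      destruct (continuity_2d_circ G' p s th H2 (mkposreal _ He)) as [d Hd].
      exists d; split; [apply cond_pos|]; intros t [_ Ht].
      apply Hd; [|exact Ht].
      replace (s - s) with 0 by ring; rewrite Rabs_R0; apply cond_pos. }
  (* The value 0 of the derivative is traded for the integral in [Hz], the form in which
     differentiation under the integral sign delivers it. *)
  apply (@eq_ind R _ (is_derive _ s)) with (2 := Hz); apply is_derive_RInt_param.
  - revert Hloc; apply filter_imp; intros a Ha th _; eexists.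
    apply is_derive_circ_radius; now apply HC.
  - intros th _.
    apply continuity_2d_pt_ext_loc
      with (fun a b => Re (G' (circ p a b) * (cos b, sin b))).
    + destruct Hloc as [d Hd]; exists d; intros a b Ha _.
      symmetry; apply is_derive_unique, is_derive_circ_radius.
      now apply HC, Hd.
    + apply continuity_2d_circ; now apply HC.
  - revert Hloc; apply filter_imp; intros a Ha.
    apply ex_RInt_circ; intros th; eexists; now apply HC.
Qed.

(** The mean does not depend on the radius since its derivative vanishes, and it tends to the
    central value as the radius shrinks. At the centre only continuity is asked, so that the lemma
    applies at 0 to the quotient [F z / z] of the Schwarz lemma. *)
Lemma circular_mean_value (G G' : C -> C) (p : C) (s0 s : R) :
  ccont G p ->
  (forall z, 0 < Cmod (z - p) < s0 -> cder G z (G' z) /\ ccont G' z) ->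
  0 < s < s0 ->
  RInt (fun th => Re (G (circ p s th))) 0 (2 * PI) = 2 * PI * Re (G p).
Proof.
  intros Hp HG Hs; assert (HPI := PI_RGT_0).
  set (I := fun a => RInt (fun th => Re (G (circ p a th))) 0 (2 * PI)).
  assert (Hconst : forall a, 0 < a < s -> I s = I a).
  { intros a Ha.
    destruct (MVT_gen I a s (fun _ => 0)) as [c [_ Hc]]; [| |lra].
    - intros x; rewrite Rmin_left, Rmax_right by lra; intros Hx.
      apply (circular_mean_derive G G' p s0); [exact HG|lra].
    - intros x; rewrite Rmin_left, Rmax_right by lra; intros Hx.
      apply derivable_continuous_pt; exists 0; apply is_derive_Reals.
      apply (circular_mean_derive G G' p s0); [exact HG|lra]. }
  assert (Hlim : forall eps, 0 < eps -> Rabs (I s - 2 * PI * Re (G p)) <= 2 * PI * eps).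
  { intros eps He; destruct (Hp eps He) as [d [Pd Hd]].
    set (a := Rmin d s / 2).
    assert (Ha : 0 < a < s /\ a < d).
    { unfold a; assert (X := Rmin_l d s); assert (Y := Rmin_r d s).
      assert (Z := Rmin_pos d s Pd (proj1 Hs)); lra. }
    rewrite (Hconst a) by lra.
    assert (Hth : forall th, Re (G p) - eps <= Re (G (circ p a th)) <= Re (G p) + eps).
    { intros th.
      assert (X : Cmod (G (circ p a th) - G p) < eps).
      { apply Hd; rewrite Cmod_circ, Rabs_pos_eq; lra. }
      assert (Y := re_le_Cmod (G (circ p a th) - G p)).
      apply Rabs_le_between in Y; unfold Re in *; simpl in Y; lra. }
    assert (Hex : ex_RInt (fun th => Re (G (circ p a th))) 0 (2 * PI)).
    { apply ex_RInt_circ; intros th; eexists; apply HG.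
      rewrite Cmod_circ, Rabs_pos_eq; lra. }
    assert (L : RInt (fun _ => Re (G p) - eps) 0 (2 * PI) <= I a).
    { apply RInt_le; [lra|apply ex_RInt_const|exact Hex|]; intros; apply Hth. }
    assert (U : I a <= RInt (fun _ => Re (G p) + eps) 0 (2 * PI)).
    { apply RInt_le; [lra|exact Hex|apply ex_RInt_const|]; intros; apply Hth. }
    rewrite RInt_const in L, U; unfold scal in L, U; simpl in L, U.
    unfold mult in L, U; simpl in L, U.
    apply Rabs_le; nra. }
  apply Rminus_diag_uniq; change (I s - 2 * PI * Re (G p) = 0).
  destruct (Req_dec (I s - 2 * PI * Re (G p)) 0) as [E|E]; [exact E|].
  apply Rabs_pos_lt in E; set (x := Rabs (I s - 2 * PI * Re (G p))) in *.
  (* This [eps] turns the estimate into [x <= x / 2], impossible for [x > 0]. *)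
  assert (X := Hlim (x / (4 * PI))).
  replace (2 * PI * (x / (4 * PI))) with (x / 2) in X by (field; lra).
  assert (0 < x / (4 * PI)) by (apply Rdiv_lt_0_compat; lra).
  fold x in X; specialize (X H); lra.
Qed.

(** Adding [eps |z|^2] makes [Re F] strictly subharmonic. At an interior maximum [p] of the sum,
    [|z|^2 = |p|^2 + 2 Re (conj p (z - p)) + |z - p|^2] shows that [Re F] plus a linear term lies
    below its central value by [eps s^2] on a circle of radius [s], against the mean value property.
    The origin is exempt from differentiability because of the quotient in [schwarz]. *)
Lemma max_principle_Re (F F' : C -> C) (r B : R) :
  0 < r ->
  (forall z, Cmod z <= r -> ccont F z) ->
  (forall z, 0 < Cmod z < r -> cder F z (F' z) /\ ccont F' z) ->
  (forall z, Cmod z = r -> Re (F z) <= B) ->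
  forall z, Cmod z <= r -> Re (F z) <= B.
Proof.
  intros Hr HF HD HB z0 Hz0; apply Rnot_lt_le; intros Hlt.
  (* On the disk the perturbation is at most half of the excess of [Re (F z0)] over [B], so the
     maximum of [v] cannot lie on the boundary circle. *)
  set (eps := (Re (F z0) - B) / (2 * (r * r))).
  assert (Hrr : 0 < r * r) by nra.
  assert (He : 0 < eps) by (unfold eps; apply Rdiv_lt_0_compat; lra).
  assert (Her : eps * (r * r) = (Re (F z0) - B) / 2) by (unfold eps; field; lra).
  set (v := fun z => Re (F z) + eps * (Re z * Re z + Im z * Im z)).
  destruct (extreme_value_disk v r) as [p [Hp Hmax]]; [lra| |].
  { intros z Hz.
    assert (Hc : ccont (fun w => F w + RtoC eps * (w * Cconj w))%C z).
    { apply ccont_plus; [now apply HF|].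
      apply ccont_mult; [apply ccont_const|].
      apply ccont_mult; [apply ccont_id|]; apply ccont_conj, ccont_id. }
    intros e He'; destruct (Hc e He') as [d [Pd Hd]].
    exists d; split; [exact Pd|]; intros w Hw.
    apply Rle_lt_trans with (2 := Hd w Hw).
    apply Rle_trans with (2 := re_le_Cmod _), Req_le, f_equal.
    unfold v, Re, Im; simpl; ring. }
  assert (Hpr : Cmod p < r).
  { destruct Hp as [Hp|Hp]; [exact Hp|exfalso].
    assert (X := Hmax z0 Hz0); unfold v in X.
    rewrite <- !Cmod_sqr, Hp in X; assert (Y := HB p Hp).
    assert (0 <= Cmod z0 * Cmod z0) by (apply Rmult_le_pos; apply Cmod_ge_0).
    nra. }
  assert (Hs0 : exists s0, 0 < s0 /\ s0 + Cmod p <= r /\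
            forall z, 0 < Cmod (z - p) < s0 -> 0 < Cmod z < r).
  { destruct (Req_dec (Cmod p) 0) as [E|E].
    - exists r; rewrite E; split; [exact Hr|]; split; [lra|]; intros z Hz.
      apply Cmod_eq_0 in E; subst p.
      now replace (z - 0)%C with z in Hz by ring.
    - assert (P0 := Cmod_ge_0 p).
      exists (Rmin (Cmod p) (r - Cmod p)).
      assert (X := Rmin_l (Cmod p) (r - Cmod p)).
      assert (Y := Rmin_r (Cmod p) (r - Cmod p)).
      split; [apply Rmin_pos; lra|]; split; [lra|]; intros z Hz.
      assert (U := Cmod_triangle_rev z p); assert (V := Cmod_triangle_rev p z).
      rewrite (Cmod_minus_sym p z) in V; lra. }
  destruct Hs0 as [s0 [Ps0 [Hs0 Hin]]].
  set (s := s0 / 2); assert (Hs : 0 < s < s0) by (unfold s; lra).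
  set (k := (RtoC (2 * eps) * Cconj p)%C).
  set (G := fun z => (F z + k * (z - p))%C).
  (* [Re G z - Re F z] is the linear part of [eps * |z|^2] at [p]. *)
  assert (HM : RInt (fun th => Re (G (circ p s th))) 0 (2 * PI) = 2 * PI * Re (G p)).
  { apply (circular_mean_value G (fun z => (F' z + k * 1)%C) p s0); [| |exact Hs].
    - apply ccont_plus; [apply HF; lra|].
      apply ccont_mult; [apply ccont_const|].
      apply ccont_minus; [apply ccont_id|apply ccont_const].
    - intros z Hz; destruct (HD z (Hin z Hz)) as [D1 D2]; split.
      + apply cder_plus; [exact D1|]; apply cder_scal.
        replace (RtoC 1) with (1 - 0)%C by ring.
        apply cder_minus; [apply cder_id|apply cder_const].
      + apply ccont_plus; [exact D2|apply ccont_const]. }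
  assert (EG : forall z, Re (G z) = Re (F z)
    + 2 * eps * (Re p * (Re z - Re p) + Im p * (Im z - Im p))).
  { intros z; unfold G, k, Re, Im; simpl; ring. }
  assert (Hle : forall th, Re (G (circ p s th)) <= Re (G p) - eps * (s * s)).
  { intros th; assert (Hz : Cmod (circ p s th) <= r).
    { assert (U := Cmod_triangle_rev (circ p s th) p).
      rewrite Cmod_circ, Rabs_pos_eq in U; lra. }
    assert (X := Hmax _ Hz); unfold v in X.
    assert (E : s * s = (Re (circ p s th) - Re p) * (Re (circ p s th) - Re p)
                      + (Im (circ p s th) - Im p) * (Im (circ p s th) - Im p)).
    { unfold circ, Re, Im; simpl.
      generalize (sin2_cos2 th); unfold Rsqr; intros T.
      replace (s * s) with (s * s * (sin th * sin th + cos th * cos th))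
        by (rewrite T; ring); ring. }
    rewrite E, !EG; nra. }
  assert (HPI := PI_RGT_0).
  assert (L : RInt (fun th => Re (G (circ p s th))) 0 (2 * PI)
              <= RInt (fun _ => Re (G p) - eps * (s * s)) 0 (2 * PI)).
  { apply RInt_le; [lra| |apply ex_RInt_const|intros; apply Hle].
    apply ex_RInt_circ; intros th; exists (F' (circ p s th) + k * 1)%C.
    assert (Hz : 0 < Cmod (circ p s th - p) < s0)
      by (rewrite Cmod_circ, Rabs_pos_eq; lra).
    apply cder_plus; [apply HD, Hin, Hz|]; apply cder_scal.
    replace (RtoC 1) with (1 - 0)%C by ring.
    apply cder_minus; [apply cder_id|apply cder_const]. }
  rewrite HM, RInt_const in L; unfold scal in L; simpl in L; unfold mult in L; simpl in L.
  assert (0 < eps * (s * s)) by (apply Rmult_lt_0_compat; nra).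
  nra.
Qed.

(** Multiplying by the constant [conj (F z)], with [z] fixed, turns the modulus at [z] into a real
    part: [Re (c * F z) = |F z|^2]. *)
Lemma max_modulus (F F' : C -> C) (r B : R) :
  0 < r ->
  (forall z, Cmod z <= r -> ccont F z) ->
  (forall z, 0 < Cmod z < r -> cder F z (F' z) /\ ccont F' z) ->
  (forall z, Cmod z = r -> Cmod (F z) <= B) ->
  forall z, Cmod z <= r -> Cmod (F z) <= B.
Proof.
  intros Hr HF HD HB z Hz.
  set (c := Cconj (F z)).
  assert (H : Re (c * F z) <= Cmod c * B).
  { apply (max_principle_Re (fun w => c * F w)%C (fun w => c * F' w)%C r); auto.
    - intros w Hw; apply ccont_mult; [apply ccont_const|now apply HF].
    - intros w Hw; destruct (HD w Hw) as [D1 D2]; split.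
      + now apply cder_scal.
      + apply ccont_mult; [apply ccont_const|exact D2].
    - intros w Hw; apply Rle_trans with (1 := Re_le_Cmod _).
      rewrite Cmod_mult; apply Rmult_le_compat_l; [apply Cmod_ge_0|now apply HB]. }
  assert (E : Re (c * F z) = Cmod (F z) * Cmod (F z)).
  { rewrite Cmod_sqr; unfold c, Re, Im; simpl; ring. }
  rewrite E in H; unfold c in H; rewrite Cmod_conj in H.
  destruct (Req_dec (Cmod (F z)) 0) as [Z|Z].
  (* When [F z = 0] what is left is [0 <= B], which the boundary point [r] provides. *)
  - rewrite Z; apply Rle_trans with (Cmod (F (RtoC r))); [apply Cmod_ge_0|].
    apply HB; rewrite Cmod_R; apply Rabs_pos_eq; lra.
  - assert (P := Cmod_ge_0 (F z)); apply Rmult_le_reg_l with (Cmod (F z)); lra.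
Qed.

(** Continuity of the derivative is included because the circular mean is differentiated under the
    integral sign. *)
Definition hol1 (F F' : C -> C) : Prop :=
  forall z, Cmod z < 1 -> cder F z (F' z) /\ ccont F' z.

(** The quotient [F z / z], completed at 0 by [F'(0)], is continuous on the disk and differentiable
    off 0, so its modulus is at most [1 / r] on [|z| <= r]; then [r] approaches 1. *)
Lemma schwarz (F F' : C -> C) :
  hol1 F F' -> F 0%C = 0%C -> (forall z, Cmod z < 1 -> Cmod (F z) <= 1) ->
  forall z, Cmod z < 1 -> Cmod (F z) <= Cmod z.
Proof.
  intros HF H0 HB z Hz.
  set (Q := fun w : C => if excluded_middle_informative (w = 0%C) then F' 0%C
                         else (F w / w)%C).
  assert (Q0 : Q 0%C = F' 0%C).
  { unfold Q; destruct (excluded_middle_informative _) as [_|n];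
      [reflexivity|now destruct n]. }
  assert (QE : forall w : C, w <> 0%C -> Q w = (F w / w)%C).
  { intros w Hw; unfold Q; destruct (excluded_middle_informative _) as [e|_];
      [now destruct Hw|reflexivity]. }
  assert (Qloc : forall w : C, w <> 0%C -> exists d, 0 < d /\
            forall u, Cmod (u - w) < d -> (F u / u)%C = Q u).
  { intros w Hw; exists (Cmod w); split; [now apply Cmod_gt_0|]; intros u Hu.
    symmetry; apply QE; intros ->; replace (0 - w)%C with (- w)%C in Hu by ring.
    rewrite Cmod_opp in Hu; lra. }
  assert (Qc : forall w, Cmod w < 1 -> ccont Q w).
  { intros w Hw; destruct (HF w Hw) as [D1 D2].
    destruct (excluded_middle_informative (w = 0%C)) as [->|Hn].
    - destruct D1 as [q [Hq [Eq [d [Pd E]]]]].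
      apply ccont_ext_loc with q; [|exact Hq].
      exists d; split; [exact Pd|]; intros u Hu.
      destruct (excluded_middle_informative (u = 0%C)) as [->|Hu0]; [congruence|].
      rewrite (QE u Hu0), (E u Hu), H0; field; exact Hu0.
    - apply ccont_ext_loc with (1 := Qloc w Hn).
      apply ccont_div; [now apply cder_ccont in D1|apply ccont_id|exact Hn]. }
  assert (Qb : forall r, 0 < r < 1 -> Cmod z <= r -> r * Cmod (Q z) <= 1).
  { intros r Hr Hzr.
    assert (L : Cmod (Q z) <= / r).
    { apply (max_modulus Q (fun w => (F' w * w - F w * 1) / (w * w))%C r); try lra; auto.
      - intros w Hw; apply Qc; lra.
      - intros w Hw; assert (Hn : w <> 0%C) by (apply Cmod_gt_0; lra).
        destruct (HF w) as [D1 D2]; [lra|]; split.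
        + apply cder_ext_loc with (1 := Qloc w Hn).
          apply (cder_div F (fun u => u)); [exact D1|apply cder_id|exact Hn].
        + apply ccont_div.
          * apply ccont_minus; apply ccont_mult;
              auto using ccont_id, ccont_const; now apply cder_ccont in D1.
          * apply ccont_mult; apply ccont_id.
          * now apply Cmult_neq_0.
      - intros w Hw; assert (Hn : w <> 0%C) by (apply Cmod_gt_0; lra).
        rewrite (QE w Hn), Cmod_div, Hw by exact Hn.
        assert (X : Cmod (F w) <= 1) by (apply HB; lra).
        apply Rle_trans with (1 / r); [|apply Req_le; field; lra].
        apply Rmult_le_compat_r; [|exact X]; left; apply Rinv_0_lt_compat; lra. }
    apply Rmult_le_compat_l with (r := r) in L; [|lra].
    rewrite Rinv_r in L; lra. }
  destruct (excluded_middle_informative (z = 0%C)) as [->|Hn].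
  { rewrite H0, Cmod_0; lra. }
  assert (Pz := proj1 (Cmod_gt_0 _) Hn).
  assert (HQ : Cmod (Q z) <= 1).
  { apply Rnot_lt_le; intros L.
    set (m := Cmod (Q z)) in *.
    (* For [m = |Q z| > 1] this radius [r] is below 1 and satisfies [r m >= (m + 1) / 2 > 1],
       contradicting [Qb]. *)
    assert (X := Qb (Rmax (Cmod z) ((1 + / m) / 2))).
    assert (Hm : 0 < / m < 1).
    { split; [apply Rinv_0_lt_compat; lra|].
      rewrite <- Rinv_1; apply Rinv_lt_contravar; lra. }
    assert (Y := Rmax_r (Cmod z) ((1 + / m) / 2)).
    assert (Z := Rmax_l (Cmod z) ((1 + / m) / 2)).
    assert (W : Rmax (Cmod z) ((1 + / m) / 2) < 1) by (apply Rmax_lub_lt; lra).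
    assert (V := X ltac:(lra) Z); fold m in V.
    assert (U : (1 + / m) / 2 * m <= Rmax (Cmod z) ((1 + / m) / 2) * m)
      by (apply Rmult_le_compat_r; lra).
    replace ((1 + / m) / 2 * m) with ((m + 1) / 2) in U by (field; lra); lra. }
  rewrite (QE z Hn), Cmod_div in HQ by exact Hn.
  apply Rmult_le_compat_r with (r := Cmod z) in HQ; [|lra].
  unfold Rdiv in HQ; rewrite Rmult_assoc, Rinv_l in HQ; lra.
Qed.

(** The difference of the squares of the two sides is [(N^2 - |a|^2) (N^2 - |w|^2)]. *)
Lemma mobius_contraction (N : R) (a w : C) :
  0 < N -> Cmod a <= N -> Cmod w <= N ->
  N * Cmod (w - a) <= Cmod (RtoC (N * N) - Cconj a * w).
Proof.
  intros HN Ha Hw.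
  assert (Pa := Cmod_ge_0 a); assert (Pw := Cmod_ge_0 w).
  assert (X := Cmod_sqr a); assert (Y := Cmod_sqr w).
  assert (U := Cmod_sqr (w - a)); assert (V := Cmod_sqr (RtoC (N * N) - Cconj a * w)).
  assert (P1 := Cmod_ge_0 (w - a)).
  assert (P2 := Cmod_ge_0 (RtoC (N * N) - Cconj a * w)).
  apply Rsqr_incr_0; [|apply Rmult_le_pos; lra|exact P2].
  replace (Rsqr (N * Cmod (w - a))) with (N * N * (Cmod (w - a) * Cmod (w - a)))
    by (unfold Rsqr; ring).
  unfold Rsqr; rewrite U, V.
  assert (0 <= (N * N - Cmod a * Cmod a) * (N * N - Cmod w * Cmod w)).
  { apply Rmult_le_pos; nra. }
  rewrite X, Y in H; unfold Re, Im in *; simpl; nra.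
Qed.

(** The Schwarz lemma is applied to [w] followed by the Moebius map of the disk of radius [N1] that
    sends [w 0] to 0. The slack [N < N1] keeps the denominator away from 0; with [N1 = N] it
    vanishes for a constant of modulus [N], the situation that occurs in the case of equality. *)
Lemma schwarz_pick_strict (w w' : C -> C) (N N1 : R) :
  0 < N < N1 -> hol1 w w' -> (forall z, Cmod z < 1 -> Cmod (w z) <= N) ->
  forall z, Cmod z < 1 ->
    N1 * Cmod (w z - w 0%C)
      <= Cmod z * Cmod (RtoC (N1 * N1) - Cconj (w 0%C) * w z).
Proof.
  intros HN Hw HB z Hz; set (a := w 0%C).
  assert (Ha : Cmod a <= N) by (apply HB; rewrite Cmod_0; lra).
  set (D := fun u => (RtoC (N1 * N1) - Cconj a * w u)%C).
  assert (HD : forall u, Cmod u < 1 -> D u <> 0%C).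
  { intros u Hu; apply Cmod_gt_0; unfold D.
    assert (X := Cmod_triangle_rev (RtoC (N1 * N1)) (Cconj a * w u)).
    rewrite Cmod_R, Rabs_pos_eq, Cmod_mult, Cmod_conj in X by nra.
    assert (Cmod a * Cmod (w u) <= N * N).
    { apply Rmult_le_compat; try apply Cmod_ge_0; auto. }
    nra. }
  set (F := fun u => (RtoC N1 * (w u - a) / D u)%C).
  set (F' := fun u => ((RtoC N1 * w' u * D u
                        - RtoC N1 * (w u - a) * (- (Cconj a * w' u))) / (D u * D u))%C).
  assert (HF : Cmod (F z) <= Cmod z).
  { apply (schwarz F F'); auto.
    - intros u Hu; destruct (Hw u Hu) as [D1 D2].
      assert (Cw := cder_ccont _ _ _ D1).
      assert (CD : ccont D u).
      { apply ccont_minus; [apply ccont_const|].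
        apply ccont_mult; [apply ccont_const|exact Cw]. }
      split.
      + apply (cder_div (fun u => RtoC N1 * (w u - a))%C D); [| |now apply HD].
        * apply cder_scal; replace (w' u) with (w' u - 0)%C by ring.
          apply cder_minus; [exact D1|apply cder_const].
        * replace (- (Cconj a * w' u))%C with (0 - Cconj a * w' u)%C by ring.
          apply cder_minus; [apply cder_const|now apply cder_scal].
      + apply ccont_div; [|now apply ccont_mult|now apply Cmult_neq_0; apply HD].
        apply ccont_minus; apply ccont_mult.
        * apply ccont_mult; [apply ccont_const|exact D2].
        * exact CD.
        * apply ccont_mult; [apply ccont_const|].
          apply ccont_minus; [exact Cw|apply ccont_const].
        * apply ccont_opp, ccont_mult; [apply ccont_const|exact D2].
    - unfold F; fold a; replace (a - a)%C with (RtoC 0) by ring.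
      field; apply HD; rewrite Cmod_0; lra.
    - intros u Hu; assert (X := proj1 (Cmod_gt_0 _) (HD u Hu)).
      unfold F; rewrite Cmod_div, Cmod_mult, Cmod_R, Rabs_pos_eq by (auto; lra).
      apply Rmult_le_reg_r with (Cmod (D u)); [exact X|].
      unfold Rdiv; rewrite Rmult_assoc, Rinv_l, Rmult_1_r, Rmult_1_l by lra.
      apply mobius_contraction; try lra.
      apply Rle_trans with N; [now apply HB|lra]. }
  assert (X := proj1 (Cmod_gt_0 _) (HD z Hz)).
  unfold F in HF; rewrite Cmod_div, Cmod_mult, Cmod_R, Rabs_pos_eq in HF by (auto; lra).
  apply Rmult_le_compat_r with (r := Cmod (D z)) in HF; [|lra].
  unfold Rdiv in HF; rewrite Rmult_assoc, Rinv_l, Rmult_1_r in HF by lra; exact HF.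
Qed.

Lemma schwarz_pick (w w' : C -> C) (N : R) :
  0 < N -> hol1 w w' -> (forall z, Cmod z < 1 -> Cmod (w z) <= N) ->
  forall z, Cmod z < 1 ->
    N * Cmod (w z - w 0%C)
      <= Cmod z * Cmod (RtoC (N * N) - Cconj (w 0%C) * w z).
Proof.
  intros HN Hw HB z Hz.
  set (X := Cmod (w z - w 0%C)).
  set (Y := Cmod (RtoC (N * N) - Cconj (w 0%C) * w z)).
  assert (PX : 0 <= X) by apply Cmod_ge_0.
  assert (PY : 0 <= Y) by apply Cmod_ge_0.
  assert (Pz := Cmod_ge_0 z).
  (* Taking [N1 = N + eta] changes [N^2] by [(2 N + eta) eta], which is at most [(2 N + 1) eta]. *)
  assert (K : forall eta, 0 < eta <= 1 -> N * X <= Cmod z * Y + (2 * N + 1) * eta).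
  { intros eta He.
    assert (H := schwarz_pick_strict w w' N (N + eta) ltac:(lra) Hw HB z Hz); fold X in H.
    set (Y1 := Cmod (RtoC ((N + eta) * (N + eta)) - Cconj (w 0%C) * w z)) in H.
    assert (T : Y1 <= Y + (2 * N + 1) * eta).
    { unfold Y1; replace (RtoC ((N + eta) * (N + eta)) - Cconj (w 0%C) * w z)%C
        with ((RtoC (N * N) - Cconj (w 0%C) * w z) + RtoC ((2 * N + eta) * eta))%C.
      - apply Rle_trans with (1 := Cmod_triangle _ _); fold Y.
        rewrite Cmod_R, Rabs_pos_eq by nra; nra.
      - rewrite !RtoC_mult, !RtoC_plus, RtoC_mult; ring. }
    assert (Cmod z * Y1 <= Cmod z * (Y + (2 * N + 1) * eta))
      by (apply Rmult_le_compat_l; lra).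
    assert (0 <= (1 - Cmod z) * ((2 * N + 1) * eta))
      by (apply Rmult_le_pos; [lra|apply Rmult_le_pos; lra]).
    nra. }
  apply Rnot_lt_le; intros L.
  set (g := N * X - Cmod z * Y); assert (Hg : 0 < g) by (unfold g; lra).
  (* With this [eta] the error term is at most half of the supposed gap [g]. *)
  set (eta := Rmin 1 (g / (2 * (2 * N + 1)))).
  assert (He : 0 < eta <= 1).
  { split; [apply Rmin_pos; [lra|]; apply Rdiv_lt_0_compat; lra|apply Rmin_l]. }
  assert (H := K eta He).
  assert (E : eta <= g / (2 * (2 * N + 1))) by apply Rmin_r.
  apply Rmult_le_compat_l with (r := 2 * N + 1) in E; [|lra].
  replace ((2 * N + 1) * (g / (2 * (2 * N + 1)))) with (g / 2) in E by (field; lra).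
  unfold g in *; lra.
Qed.

(** The factor [c] rotates [w 0] onto the positive real axis. Squared, Schwarz-Pick is a quadratic
    inequality in [X = Re (conj a * w z)], and its smaller root gives
    [Re (c w) >= N (A - rho N) / (N - rho A)], the leftmost point of the disk that contains the
    rotated values. This increases with [A = |w 0|], so [A = 1] is the worst case. *)
Lemma schwarz_pick_Re (w w' : C -> C) (N : R) :
  1 <= N -> hol1 w w' -> (forall z, Cmod z < 1 -> Cmod (w z) <= N) ->
  1 <= Cmod (w 0%C) ->
  exists c, Cmod c = 1 /\ forall z, Cmod z < 1 ->
    N * (1 - N * Cmod z) / (N - Cmod z) <= Re (c * w z).
Proof.
  intros HN Hw HB HA.
  set (a := w 0%C) in *; set (A := Cmod a) in *.
  assert (HAN : A <= N) by (apply HB; rewrite Cmod_0; lra).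
  assert (Ha : RtoC A <> 0%C) by (intros E; apply RtoC_inj in E; lra).
  exists (Cconj a / RtoC A)%C; split.
  { rewrite Cmod_div, Cmod_conj, Cmod_R, Rabs_pos_eq by (auto; lra).
    fold A; field; lra. }
  intros z Hz; set (rho := Cmod z) in *.
  assert (Pz : 0 <= rho) by apply Cmod_ge_0.
  assert (SP := schwarz_pick w w' N ltac:(lra) Hw HB z Hz); fold a rho in SP.
  set (X := Re (Cconj a * w z)).
  replace (Re (Cconj a / RtoC A * w z)) with (X / A).
  2: { unfold X, Cdiv; rewrite <- RtoC_inv by lra.
       unfold Re, Im; simpl; field; lra. }
  set (Y := Cmod (Cconj a * w z) * Cmod (Cconj a * w z)).
  assert (HXY : X * X <= Y).
  { unfold Y; rewrite Cmod_sqr; fold X; nra. }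
  assert (EY : Y = A * A * (Cmod (w z) * Cmod (w z))).
  { unfold Y; rewrite Cmod_mult, Cmod_conj; fold A; ring. }
  assert (SQ : N * N * (Cmod (w z - a) * Cmod (w z - a))
     <= rho * rho * (Cmod (RtoC (N * N) - Cconj a * w z)
                     * Cmod (RtoC (N * N) - Cconj a * w z))).
  { assert (P1 := Cmod_ge_0 (w z - a)).
    apply Rsqr_incr_1 in SP; [unfold Rsqr in SP; nra| |].
    - apply Rmult_le_pos; lra.
    - apply Rmult_le_pos; [exact Pz|apply Cmod_ge_0]. }
  assert (E1 : Cmod (w z - a) * Cmod (w z - a)
               = Cmod (w z) * Cmod (w z) - 2 * X + A * A).
  { unfold A, X; rewrite !Cmod_sqr; unfold Re, Im; simpl; ring. }
  assert (E2 : Cmod (RtoC (N * N) - Cconj a * w z)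
               * Cmod (RtoC (N * N) - Cconj a * w z)
               = N * N * (N * N) - 2 * (N * N) * X + Y).
  { unfold Y, X; rewrite !Cmod_sqr; unfold Re, Im; simpl; ring. }
  rewrite E1, E2 in SQ.
  set (W := Cmod (w z) * Cmod (w z)) in *.
  assert (HrA : rho * A < N).
  { assert (0 < (1 - rho) * A) by (apply Rmult_lt_0_compat; lra); lra. }
  assert (Q : X * X * (N * N - rho * rho * (A * A))
     - 2 * (A * A) * (N * N) * X * (1 - rho * rho)
     + N * N * (A * A) * (A * A - rho * rho * (N * N)) <= 0).
  { assert (rho * rho * (A * A) <= N * N).
    { replace (rho * rho * (A * A)) with (rho * A * (rho * A)) by ring.
      assert (0 <= rho * A) by (apply Rmult_le_pos; lra).
      apply Rmult_le_compat; lra. }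
    assert (X * X * (N * N - rho * rho * (A * A)) <= Y * (N * N - rho * rho * (A * A)))
      by (apply Rmult_le_compat_r; lra).
    assert (A * A * (N * N * (W - 2 * X + A * A))
      <= A * A * (rho * rho * (N * N * (N * N) - 2 * (N * N) * X + Y)))
      by (apply Rmult_le_compat_l; [nra|exact SQ]).
    nra. }
  assert (Hd1 : 0 < N - rho * A) by lra.
  assert (Hd2 : 0 < N + rho * A) by nra.
  (* The quadratic inequality [Q] factors through its two real roots. *)
  assert (QF : (X * (N - rho * A) - N * A * (A - rho * N))
               * (X * (N + rho * A) - N * A * (A + rho * N)) <= 0) by nra.
  assert (R1 : N * A * (A - rho * N) <= X * (N - rho * A)).
  { apply Rnot_lt_le; intros L.
    assert (M : 0 <= X * (N + rho * A) - N * A * (A + rho * N)).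
    { apply Rnot_lt_le; intros L'; nra. }
    (* This is the numerator of the difference of the two roots: they are in the expected order, so
       [X] cannot lie below the first and above the second. *)
    assert (T : 0 <= N * A * (2 * rho * (N * N - A * A))).
    { apply Rmult_le_pos; [nra|]; apply Rmult_le_pos; nra. }
    nra. }
  assert (R2 : N * (A - rho * N) <= X / A * (N - rho * A)).
  { apply Rmult_le_reg_l with A; [lra|].
    replace (A * (X / A * (N - rho * A))) with (X * (N - rho * A)) by (field; lra); lra. }
  assert (Hd3 : 0 < N - rho) by lra.
  (* The difference of the two sides is [N * ((A - 1) * N * (1 - rho^2))], which expresses
     monotonicity in [A]. *)
  assert (R3 : N * (1 - rho * N) * (N - rho * A) <= N * (A - rho * N) * (N - rho)).
  { assert (0 <= N * ((A - 1) * N * (1 - rho * rho))).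
    { apply Rmult_le_pos; [lra|]; apply Rmult_le_pos; nra. }
    nra. }
  apply Rmult_le_reg_r with ((N - rho) * (N - rho * A)); [nra|].
  replace (N * (1 - N * rho) / (N - rho) * ((N - rho) * (N - rho * A)))
    with (N * (1 - rho * N) * (N - rho * A)) by (field; lra).
  nra.
Qed.

(** * Covering by harmonic mappings *)

(** Neighbourhoods in [C] are defined by product balls, that is by squares; halving the radius fits
    a square into a disk. *)
Lemma locally_Cmod (z : C) (P : C -> Prop) :
  locally z P <->
  exists delta, 0 < delta /\ forall w, Cmod (w - z) < delta -> P w.
Proof.
  split.
  - intros [d Hd]; exists d; split; [apply cond_pos|]; intros w Hw; apply Hd; split.
    + apply Rle_lt_trans with (2 := Hw); exact (re_le_Cmod (w - z)).
    + apply Rle_lt_trans with (2 := Hw); exact (im_le_Cmod (w - z)).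
  - intros [d [Pd Hd]]; assert (P2 : 0 < d / 2) by lra.
    exists (mkposreal _ P2); intros w [H1 H2]; apply Hd.
    apply Rle_lt_trans with (1 := Cmod_le_Re_Im _).
    change (Rabs (fst w - fst z) < d / 2) in H1.
    change (Rabs (snd w - snd z) < d / 2) in H2.
    change (Rabs (fst w - fst z) + Rabs (snd w - snd z) < d); lra.
Qed.

(** For [|A| <> |B|] the real differential of [f] at [z] is invertible, so some direction [e] is
    mapped to [v = f z - w] itself. Along it the derivative of [|f - w|^2] at 0 is [2 |v|^2], which
    must vanish at a minimum. *)
Lemma local_min_harmonic (f h g : C -> C) (z w A B : C) :
  (exists delta, 0 < delta /\ forall u, Cmod (u - z) < delta ->
     f u = (h u + Cconj (g u))%C) ->
  cder h z A -> cder g z B -> Cmod A <> Cmod B ->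
  (exists delta, 0 < delta /\ forall u, Cmod (u - z) < delta ->
     Cmod (f z - w) <= Cmod (f u - w)) ->
  f z = w.
Proof.
  intros [d1 [P1 E]] HA HB HJ [d2 [P2 Hmin]].
  set (v := (f z - w)%C).
  set (J := Cmod A * Cmod A - Cmod B * Cmod B).
  assert (PA := Cmod_ge_0 A); assert (PB := Cmod_ge_0 B).
  assert (HJ0 : J <> 0) by (unfold J; intros H; apply HJ; nra).
  (* The direction in which the differential [e |-> A e + conj (B e)] equals [v]. *)
  set (e := ((Cconj A * v - Cconj B * Cconj v) * RtoC (/ J))%C).
  assert (Ev : (A * e + Cconj (B * e))%C = v).
  { apply injective_projections; unfold e, J; rewrite !Cmod_sqr;
      unfold J in HJ0; rewrite !Cmod_sqr in HJ0; unfold Re, Im in *; simpl;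
      field; exact HJ0. }
  (* [X] and [Y] are the real and imaginary parts of [f - w] on the line through [z] in direction
     [e], written with [h] and [g], whose derivatives are known. *)
  set (X := fun t => Re (h (z + RtoC t * e)%C) + Re (g (z + RtoC t * e)%C) - Re w).
  set (Y := fun t => Im (h (z + RtoC t * e)%C) - Im (g (z + RtoC t * e)%C) - Im w).
  assert (L0 : (z + RtoC 0 * e)%C = z) by ring.
  assert (Vh : vder (fun t => h (z + RtoC t * e)%C) 0 (A * e)%C).
  { apply (cder_vder h (fun t => z + RtoC t * e)%C); [now rewrite L0|apply vder_line]. }
  assert (Vg : vder (fun t => g (z + RtoC t * e)%C) 0 (B * e)%C).
  { apply (cder_vder g (fun t => z + RtoC t * e)%C); [now rewrite L0|apply vder_line]. }
  assert (DX : is_derive X 0 (Re v)).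
  { replace (Re v) with (Re (A * e) + Re (B * e) - 0)
      by (rewrite <- Ev; unfold Re; simpl; ring).
    apply (is_derive_minus (V := R_NormedModule));
      [|apply (is_derive_const (V := R_NormedModule))].
    apply (is_derive_plus (V := R_NormedModule));
      [exact (vder_Re _ _ _ Vh)|exact (vder_Re _ _ _ Vg)]. }
  assert (DY : is_derive Y 0 (Im v)).
  { replace (Im v) with (Im (A * e) - Im (B * e) - 0)
      by (rewrite <- Ev; unfold Im; simpl; ring).
    apply (is_derive_minus (V := R_NormedModule));
      [|apply (is_derive_const (V := R_NormedModule))].
    apply (is_derive_minus (V := R_NormedModule));
      [exact (vder_Im _ _ _ Vh)|exact (vder_Im _ _ _ Vg)]. }
  assert (Hz : f z = (h z + Cconj (g z))%C).
  { apply E; replace (z - z)%C with (RtoC 0) by ring; now rewrite Cmod_0. }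
  set (phi := fun t => X t * X t + Y t * Y t).
  assert (Dphi : is_derive phi 0 (2 * (Cmod v * Cmod v))).
  { replace (2 * (Cmod v * Cmod v))
      with ((Re v * X 0 + X 0 * Re v) + (Im v * Y 0 + Y 0 * Im v)).
    - apply (is_derive_plus (V := R_NormedModule)).
      + apply (is_derive_mult (K := R_AbsRing) X X); auto; apply Rmult_comm.
      + apply (is_derive_mult (K := R_AbsRing) Y Y); auto; apply Rmult_comm.
    - assert (EX : X 0 = Re v)
        by (unfold X, v; rewrite L0, Hz; unfold Re; simpl; ring).
      assert (EY : Y 0 = Im v)
        by (unfold Y, v; rewrite L0, Hz; unfold Im; simpl; ring).
      rewrite EX, EY, Cmod_sqr; ring. }
  assert (Ephi : forall t, Cmod (RtoC t * e) < d1 ->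
            phi t = Cmod (f (z + RtoC t * e)%C - w) * Cmod (f (z + RtoC t * e)%C - w)).
  { intros t Ht; rewrite Cmod_sqr, E.
    - unfold phi, X, Y, Re, Im; simpl; ring.
    - now replace (z + RtoC t * e - z)%C with (RtoC t * e)%C by ring. }
  set (d := Rmin d1 d2 / (Cmod e + 1)).
  assert (Pe := Cmod_ge_0 e).
  assert (Pd : 0 < d) by (apply Rdiv_lt_0_compat; [now apply Rmin_pos|lra]).
  assert (Hd : forall t, Rabs t < d -> Cmod (RtoC t * e) < Rmin d1 d2).
  { intros t Ht; rewrite Cmod_mult, Cmod_R.
    apply Rle_lt_trans with (Rabs t * (Cmod e + 1)).
    - apply Rmult_le_compat_l; [apply Rabs_pos|lra].
    - replace (Rmin d1 d2) with (d * (Cmod e + 1)) by (unfold d; field; lra).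
      apply Rmult_lt_compat_r; lra. }
  assert (Z : 2 * (Cmod v * Cmod v) = 0).
  { apply is_derive_Reals in Dphi.
    assert (pr : derivable_pt phi 0) by (exists (2 * (Cmod v * Cmod v)); exact Dphi).
    rewrite <- (derive_pt_eq_0 _ _ _ pr Dphi).
    apply (deriv_minimum phi (- d) d 0 pr); [lra|lra|]; intros t H1 H2.
    assert (Ht : Rabs t < d) by (apply Rabs_def1; lra).
    assert (H3 := Hd t Ht).
    rewrite (Ephi t) by (apply Rlt_le_trans with (1 := H3), Rmin_l).
    rewrite (Ephi 0) by (rewrite Cmod_mult, Cmod_0, Rmult_0_l; exact P1).
    rewrite L0.
    assert (M := Hmin (z + RtoC t * e)%C).
    replace (z + RtoC t * e - z)%C with (RtoC t * e)%C in M by ring.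
    assert (M' := M (Rlt_le_trans _ _ _ H3 (Rmin_r _ _))).
    assert (P := Cmod_ge_0 (f z - w)); nra. }
  assert (Cv : Cmod v = 0) by (assert (P := Cmod_ge_0 v); nra).
  apply Cmod_eq_0 in Cv; unfold v in Cv.
  replace (f z) with (f z - w + w)%C by ring; rewrite Cv; ring.
Qed.

(* Continuity method along the segment from [0] to [w]: if [w0] is attained and
   [w1] is so near that [w0] is closer to it than every value on the bounding
   circle, then [|f - w1|] attains its minimum in the open disk. *)
Lemma disk_covering (f : C -> C) (r rho : R) (w : C) :
  0 < r -> f 0%C = 0%C ->
  (forall z, Cmod z <= r -> ccont f z) ->
  (forall z, Cmod z = r -> rho <= Cmod (f z)) ->
  (forall z v, Cmod z < r ->
     (exists delta, 0 < delta /\ forall u, Cmod (u - z) < delta ->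
        Cmod (f z - v) <= Cmod (f u - v)) -> f z = v) ->
  Cmod w < rho ->
  exists z, Cmod z < r /\ f z = w.
Proof.
  intros Hr H0 Hc Hb Hm Hw.
  (* The number of steps is chosen so that one step, of length [|w| / N], is shorter than the gap
     [rho - |w|]. *)
  destruct (nfloor_ex (2 * Cmod w / (rho - Cmod w))) as [n Hn].
  { apply Rmult_le_pos; [assert (X := Cmod_ge_0 w); lra|].
    left; apply Rinv_0_lt_compat; lra. }
  set (N := INR n + 1).
  assert (PN : 0 < N) by (unfold N; assert (X := pos_INR n); lra).
  assert (Hstep : 2 * (Cmod w / N) < rho - Cmod w).
  { apply Rmult_lt_reg_r with (N / (rho - Cmod w)).
    - apply Rdiv_lt_0_compat; lra.
    - replace (2 * (Cmod w / N) * (N / (rho - Cmod w)))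
        with (2 * Cmod w / (rho - Cmod w)) by (field; lra).
      replace ((rho - Cmod w) * (N / (rho - Cmod w))) with N by (field; lra).
      unfold N; lra. }
  assert (K : forall k : nat, (k <= S n)%nat ->
            exists z, Cmod z < r /\ f z = (RtoC (INR k / N) * w)%C).
  { induction k as [|k IH]; intros Hk.
    - exists 0%C; rewrite Cmod_0, H0; split; [exact Hr|].
      simpl; unfold Rdiv; rewrite Rmult_0_l; ring.
    - destruct (IH ltac:(lia)) as [z0 [Hz0 Ez0]].
      set (v := (RtoC (INR (S k) / N) * w)%C).
      assert (Hv : Cmod v <= Cmod w).
      { unfold v; rewrite Cmod_mult, Cmod_R, Rabs_pos_eq.
        - rewrite <- (Rmult_1_l (Cmod w)) at 2.
          apply Rmult_le_compat_r; [apply Cmod_ge_0|].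
          apply Rmult_le_reg_r with N; [exact PN|].
          replace (INR (S k) / N * N) with (INR (S k)) by (field; lra).
          unfold N; rewrite <- S_INR, Rmult_1_l; now apply le_INR.
        - apply Rmult_le_pos; [apply pos_INR|left; now apply Rinv_0_lt_compat]. }
      assert (Hd : Cmod (f z0 - v) = Cmod w / N).
      { rewrite Ez0; unfold v; rewrite S_INR.
        replace (RtoC (INR k / N) * w - RtoC ((INR k + 1) / N) * w)%C
          with (RtoC (- / N) * w)%C.
        - rewrite Cmod_mult, Cmod_R, Rabs_Ropp, Rabs_pos_eq; [field; lra|].
          left; now apply Rinv_0_lt_compat.
        - replace ((INR k + 1) / N) with (INR k / N + / N) by (field; lra).
          rewrite RtoC_plus, RtoC_opp; ring. }
      destruct (extreme_value_disk (fun z => - Cmod (f z - v)) r) as [p [Hp Hmax]];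
        [lra| |].
      { intros z Hz eps He; destruct (Hc z Hz eps He) as [d [Pd Hdd]].
        exists d; split; [exact Pd|]; intros u Hu; assert (X := Hdd u Hu).
        assert (U1 := Cmod_triangle_rev (f u - v) (f z - v)).
        assert (U2 := Cmod_triangle_rev (f z - v) (f u - v)).
        replace (f u - v - (f z - v))%C with (f u - f z)%C in U1 by ring.
        replace (f z - v - (f u - v))%C with (f z - f u)%C in U2 by ring.
        rewrite (Cmod_minus_sym (f z) (f u)) in U2; apply Rabs_def1; lra. }
      assert (Hpr : Cmod p < r).
      { destruct Hp as [Hp|Hp]; [exact Hp|exfalso].
        assert (X := Hmax z0 ltac:(lra)); cbv beta in X.
        assert (Y := Hb p Hp); assert (Z := Cmod_triangle_rev (f p) v).
        assert (T := Cmod_ge_0 (f z0 - v)); lra. }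
      exists p; split; [exact Hpr|]; apply Hm; [exact Hpr|].
      exists (r - Cmod p); split; [lra|]; intros u Hu.
      assert (X := Hmax u); assert (Y := Cmod_triangle_rev u p).
      specialize (X ltac:(lra)); cbv beta in X; lra. }
  destruct (K (S n) (le_n _)) as [z [Hz Ez]]; exists z; split; [exact Hz|].
  rewrite Ez, S_INR; fold N.
  replace (N / N) with 1 by (field; lra); ring.
Qed.

(** Two given points lie in a common closed disk of radius [r < r0], so [m] may degenerate as [r]
    tends to [r0]. *)
Lemma univalent_of_lower_bound (f : C -> C) (r0 : R) :
  (forall r, r < r0 -> exists m, 0 < m /\ forall z1 z2,
     Cmod z1 <= r -> Cmod z2 <= r -> m * Cmod (z1 - z2) <= Cmod (f z1 - f z2)) ->
  univalent_in (disk 0 r0) f.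
Proof.
  intros Hlow z1 z2 Hz1 Hz2 E; unfold disk in Hz1, Hz2.
  replace (z1 - 0)%C with z1 in Hz1 by ring; replace (z2 - 0)%C with z2 in Hz2 by ring.
  destruct (Hlow (Rmax (Cmod z1) (Cmod z2))) as [m [Pm Hm]].
  { now apply Rmax_lub_lt. }
  assert (X := Hm z1 z2 (Rmax_l _ _) (Rmax_r _ _)).
  replace (f z1 - f z2)%C with (RtoC 0) in X by (rewrite E; ring).
  rewrite Cmod_0 in X; assert (Y := Cmod_ge_0 (z1 - z2)).
  assert (Z : Cmod (z1 - z2) = 0) by nra.
  apply Cmod_eq_0 in Z; replace z1 with (z1 - z2 + z2)%C by ring; rewrite Z; ring.
Qed.

(** [Omega] is the set of points of the disk of radius [r0] whose values have modulus below [r1].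
    The growth hypothesis is used twice: it gives the boundary estimate for [disk_covering], and it
    confines preimages of [|w| <= rho] to a smaller disk, where the inverse of [f] is Lipschitz.
    Thus segments lift to continuous paths. *)
Lemma schlicht_disk_criterion (f : C -> C) (r0 r1 : R) :
  0 < r0 -> 0 < r1 -> f 0%C = 0%C ->
  (forall z, Cmod z < r0 -> ccont f z) ->
  (forall r, r < r0 -> exists m, 0 < m /\ forall z1 z2,
     Cmod z1 <= r -> Cmod z2 <= r -> m * Cmod (z1 - z2) <= Cmod (f z1 - f z2)) ->
  (forall rho, rho < r1 -> exists r, 0 < r < r0 /\
     forall z, r <= Cmod z < r0 -> rho < Cmod (f z)) ->
  (forall z v, Cmod z < r0 ->
     (exists delta, 0 < delta /\ forall u, Cmod (u - z) < delta ->
        Cmod (f z - v) <= Cmod (f u - v)) -> f z = v) ->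
  contains_schlicht_disk f r0 0 r1.
Proof.
  intros Hr0 Hr1 H0 Hc Hlow Hprop Hmin.
  assert (Edisk : forall r z, disk 0 r z <-> Cmod z < r).
  { intros r z; unfold disk; now replace (z - 0)%C with z by ring. }
  assert (Hinj : univalent_in (disk 0 r0) f) by now apply univalent_of_lower_bound.
  assert (Hsurj : forall w, Cmod w < r1 -> exists z, Cmod z < r0 /\ f z = w).
  { intros w Hw; destruct (Hprop ((Cmod w + r1) / 2)) as [r [Hr Hf]]; [lra|].
    destruct (disk_covering f r ((Cmod w + r1) / 2) w) as [z [Hz Ez]]; auto; try lra.
    - intros z Hz; apply Hc; lra.
    - intros z Hz; left; apply Hf; lra.
    - intros z v Hz; apply Hmin; lra.
    - exists z; split; [lra|exact Ez]. }
  set (Omega := fun z => Cmod z < r0 /\ Cmod (f z) < r1).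
  exists Omega; split; [|split; [|split]].
  - split; [|split].
    + intros z [Hz Hfz]; apply locally_Cmod.
      destruct (Hc z Hz (r1 - Cmod (f z))) as [d [Pd Hd]]; [lra|].
      exists (Rmin d (r0 - Cmod z)); split; [apply Rmin_pos; lra|]; intros u Hu.
      assert (X := Hd u (Rlt_le_trans _ _ _ Hu (Rmin_l _ _))).
      assert (Y := Rlt_le_trans _ _ _ Hu (Rmin_r _ _)).
      assert (U := Cmod_triangle_rev u z).
      assert (V := Cmod_triangle_rev (f u) (f z)); split; lra.
    + exists 0%C; split; [|rewrite H0]; rewrite Cmod_0; assumption.
    + (* The segment between two values lifts to a Lipschitz path in [Omega]. *)
      intros U V HU HV Hcov [z1 [[Hz1 Hf1] U1]] [z2 [[Hz2 Hf2] V2]].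
      apply NNPP; intros Hno.
      assert (Hdisj : forall z, Omega z -> U z -> V z -> False).
      { intros z Oz Uz Vz; apply Hno; now exists z. }
      (* Clamping the parameter to [[0, 1]] defines the path on the whole line, since the
         intermediate value theorem used below asks for continuity everywhere. *)
      set (tau := fun t => Rmax 0 (Rmin 1 t)).
      assert (Htau : forall t, 0 <= tau t <= 1).
      { intros t; split; [apply Rmax_l|]; apply Rmax_lub; [lra|apply Rmin_l]. }
      assert (Ltau : forall s t, Rabs (tau s - tau t) <= Rabs (s - t)).
      { intros s t; unfold tau, Rmax, Rmin.
        repeat (destruct (Rle_dec _ _)); unfold Rabs;
          repeat (destruct (Rcase_abs _)); lra. }
      set (om := fun t => (f z1 + RtoC (tau t) * (f z2 - f z1))%C).
      set (rho := Rmax (Cmod (f z1)) (Cmod (f z2))).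
      assert (Hrho : rho < r1) by now apply Rmax_lub_lt.
      assert (Hom : forall t, Cmod (om t) <= rho).
      { intros t; unfold om; destruct (Htau t) as [T0 T1].
        replace (f z1 + RtoC (tau t) * (f z2 - f z1))%C
          with (RtoC (1 - tau t) * f z1 + RtoC (tau t) * f z2)%C
          by (rewrite RtoC_minus; ring).
        apply Rle_trans with (1 := Cmod_triangle _ _).
        rewrite !Cmod_mult, !Cmod_R, !Rabs_pos_eq by lra.
        assert (X := Rmax_l (Cmod (f z1)) (Cmod (f z2))); fold rho in X.
        assert (Y := Rmax_r (Cmod (f z1)) (Cmod (f z2))); fold rho in Y.
        nra. }
      assert (Hex : forall t, exists z, Cmod z < r0 /\ f z = om t).
      { intros t; apply Hsurj; specialize (Hom t); lra. }
      set (zt := fun t => proj1_sig (constructive_indefinite_description _ (Hex t))).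
      assert (Hzt : forall t, Cmod (zt t) < r0 /\ f (zt t) = om t).
      { intros t; exact (proj2_sig (constructive_indefinite_description _ (Hex t))). }
      assert (Ozt : forall t, Omega (zt t)).
      { intros t; destruct (Hzt t) as [A B]; split; [exact A|].
        rewrite B; specialize (Hom t); lra. }
      (* The segment stays in a closed disk of radius [rho < r1], so all its preimages lie in one
         disk of radius [r < r0] and share one constant [m]. *)
      destruct (Hprop rho Hrho) as [r [Hr Hout]].
      assert (Rzt : forall t, Cmod (zt t) <= r).
      { intros t; apply Rnot_lt_le; intros L; destruct (Hzt t) as [A B].
        assert (X := Hout (zt t)); rewrite B in X.
        specialize (Hom t); specialize (X ltac:(lra)); lra. }
      destruct (Hlow r (proj2 Hr)) as [m [Pm Hm]].
      assert (Czt : forall t eps, 0 < eps -> exists d, 0 < d /\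
                forall s, Rabs (s - t) < d -> Cmod (zt s - zt t) < eps).
      { intros t eps He; set (L := Cmod (f z2 - f z1) + 1).
        assert (PL : 0 < L) by (unfold L; assert (X := Cmod_ge_0 (f z2 - f z1)); lra).
        exists (eps * m / L); split; [apply Rdiv_lt_0_compat; nra|]; intros s Hs.
        assert (X := Hm _ _ (Rzt s) (Rzt t)).
        rewrite (proj2 (Hzt s)), (proj2 (Hzt t)) in X.
        replace (om s - om t)%C with (RtoC (tau s - tau t) * (f z2 - f z1))%C in X
          by (unfold om; rewrite RtoC_minus; ring).
        rewrite Cmod_mult, Cmod_R in X.
        apply Rmult_lt_reg_l with m; [exact Pm|].
        apply Rle_lt_trans with (1 := X).
        apply Rle_lt_trans with (Rabs (s - t) * L).
        - apply Rmult_le_compat; [apply Rabs_pos|apply Cmod_ge_0|apply Ltau|].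
          unfold L; lra.
        - apply Rlt_le_trans with (eps * m / L * L).
          + now apply Rmult_lt_compat_r.
          + apply Req_le; field; lra. }
      (* The preimages were picked by choice; injectivity identifies those of the endpoints. *)
      assert (Z0 : zt 0 = z1).
      { apply Hinj; [now apply Edisk, Hzt|now apply Edisk|].
        rewrite (proj2 (Hzt 0)); unfold om, tau.
        rewrite Rmin_right, Rmax_left by lra; ring. }
      assert (Z1 : zt 1 = z2).
      { apply Hinj; [now apply Edisk, Hzt|now apply Edisk|].
        rewrite (proj2 (Hzt 1)); unfold om, tau.
        rewrite Rmin_left, Rmax_right by lra; ring. }
      (* If [U] and [V] separated [Omega], this function with values 1 and -1 would be locally
         constant along the path, hence continuous, yet change sign without taking the value 0. *)
      set (chi := fun t => if excluded_middle_informative (U (zt t)) then 1 else -1).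
      assert (Cchi : continuity chi).
      { intros t eps He.
        assert (Hloc : exists d, 0 < d /\ forall s, Rabs (s - t) < d -> chi s = chi t).
        { assert (W : forall O : C -> Prop, open O -> O (zt t) ->
             exists d, 0 < d /\ forall s, Rabs (s - t) < d -> O (zt s)).
          { intros O HO Ot; apply HO, locally_Cmod in Ot.
            destruct Ot as [d1 [P1 Hd1]]; destruct (Czt t d1 P1) as [d2 [P2 Hd2]].
            exists d2; auto. }
          destruct (excluded_middle_informative (U (zt t))) as [HUt|HUt].
          - destruct (W U HU HUt) as [d [Pd Hd]]; exists d; split; [exact Pd|].
            intros s Hs; specialize (Hd s Hs); unfold chi.
            destruct (excluded_middle_informative (U (zt s))); [|contradiction].
            destruct (excluded_middle_informative (U (zt t))); [reflexivity|contradiction].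
          - destruct (W V HV) as [d [Pd Hd]].
            { destruct (Hcov _ (Ozt t)); [contradiction|assumption]. }
            exists d; split; [exact Pd|]; intros s Hs; specialize (Hd s Hs); unfold chi.
            destruct (excluded_middle_informative (U (zt s))) as [HUs|HUs].
            + destruct (Hdisj _ (Ozt s) HUs Hd).
            + destruct (excluded_middle_informative (U (zt t)));
                [contradiction|reflexivity]. }
        destruct Hloc as [d [Pd Hd]]; exists d; split; [exact Pd|].
        intros s [_ Hs]; unfold R_dist in *; simpl in *; unfold Rdist in *.
        rewrite (Hd s Hs); replace (chi t - chi t) with 0 by ring.
        rewrite Rabs_R0; exact He. }
      assert (C0 : chi 0 = 1).
      { unfold chi; rewrite Z0; destruct (excluded_middle_informative (U z1));
          [reflexivity|contradiction]. }
      assert (C1 : chi 1 = -1).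
      { unfold chi; destruct (excluded_middle_informative (U (zt 1))) as [H|H];
          [|reflexivity].
        rewrite <- Z1 in V2; destruct (Hdisj _ (Ozt 1) H V2). }
      destruct (IVT_gen chi 0 1 0 Cchi) as [x [_ Hx]].
      { rewrite C0, C1, Rmin_right, Rmax_left; lra. }
      unfold chi in Hx; destruct (excluded_middle_informative _); lra.
  - intros z [Hz _]; now apply Edisk.
  - intros a b [Ha _] [Hb _]; apply Hinj; now apply Edisk.
  - intros w; rewrite Edisk; split.
    + intros [z [[_ Hz] <-]]; exact Hz.
    + intros Hw; destruct (Hsurj w Hw) as [z [Hz Ez]]; exists z.
      split; [|exact Ez]; split; [exact Hz|now rewrite Ez].
Qed.

(** * Distortion estimates *)

(** The rotation makes [e * b] point opposite to [a]. By [Cmod_rotation_ge] no other unimodular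
    factor gives a smaller modulus. *)
Lemma rotation_align (a b : C) :
  exists e, Cmod e = 1 /\ Cmod (a + e * b) = Rabs (Cmod a - Cmod b).
Proof.
  assert (Pa := Cmod_ge_0 a); assert (Pb := Cmod_ge_0 b).
  destruct (Req_dec (Cmod a) 0) as [Ea|Ea].
  { exists 1%C; split; [apply Cmod_1|].
    rewrite Ea; apply Cmod_eq_0 in Ea; subst a.
    replace (0 + 1 * b)%C with b by ring.
    rewrite Rabs_minus_sym, Rabs_pos_eq; lra. }
  destruct (Req_dec (Cmod b) 0) as [Eb|Eb].
  { exists 1%C; split; [apply Cmod_1|].
    rewrite Eb; apply Cmod_eq_0 in Eb; subst b.
    replace (a + 1 * 0)%C with a by ring.
    rewrite Rabs_pos_eq; lra. }
  assert (Na : RtoC (Cmod a) <> 0%C) by (intros E; apply RtoC_inj in E; lra).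
  assert (Nb : RtoC (Cmod b) <> 0%C) by (intros E; apply RtoC_inj in E; lra).
  exists (- (a / RtoC (Cmod a)) * (Cconj b / RtoC (Cmod b)))%C; split.
  - rewrite Cmod_mult, Cmod_opp, !Cmod_div, Cmod_conj, !Cmod_R, !Rabs_pos_eq by auto.
    field; auto.
  - assert (Eb2 : (Cconj b * b)%C = (RtoC (Cmod b) * RtoC (Cmod b))%C).
    { rewrite <- RtoC_mult, Cmod_sqr.
      apply injective_projections; unfold Re, Im; simpl; ring. }
    replace (a + - (a / RtoC (Cmod a)) * (Cconj b / RtoC (Cmod b)) * b)%C
      with (a / RtoC (Cmod a) * RtoC (Cmod a - Cmod b))%C.
    + rewrite Cmod_mult, Cmod_div, !Cmod_R by auto.
      rewrite (Rabs_pos_eq (Cmod a)) by lra; field; auto.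
    + rewrite RtoC_minus.
      replace (- (a / RtoC (Cmod a)) * (Cconj b / RtoC (Cmod b)) * b)%C
        with (- (a / RtoC (Cmod a)) * ((Cconj b * b) / RtoC (Cmod b)))%C by (field; auto).
      rewrite Eb2; field; auto.
Qed.

Lemma Cmod_rotation_ge (a b e : C) :
  Cmod e = 1 -> Rabs (Cmod a - Cmod b) <= Cmod (a + e * b).
Proof.
  intros He; apply Rabs_le.
  assert (X := Cmod_triangle_rev a (- (e * b))).
  assert (Y := Cmod_triangle_rev (e * b) (- a)).
  rewrite Cmod_opp, Cmod_mult, He in X.
  rewrite Cmod_opp, Cmod_mult, He in Y.
  replace (a - - (e * b))%C with (a + e * b)%C in X by ring.
  replace (e * b - - a)%C with (a + e * b)%C in Y by ring; lra.
Qed.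

Lemma is_derive_segment (F : C -> C) (k z d l : C) (t : R) :
  cder F (z + RtoC t * d)%C l ->
  is_derive (fun u => Re (k * F (z + RtoC u * d)%C)) t (Re (k * (l * d))).
Proof.
  intros H; apply (vder_Re (fun u => k * F (z + RtoC u * d)%C)%C).
  replace (k * (l * d))%C with ((k * l) * d)%C by ring.
  apply (cder_vder (fun w => k * F w)%C (fun u => z + RtoC u * d)%C).
  - now apply cder_scal.
  - apply vder_line.
Qed.

(** The mean value theorem is applied to a real projection. The factor [conj d * c] is chosen so
    that the derivative along the segment becomes [|d|^2 Re (c F')]. *)
Lemma segment_lower (F F' : C -> C) (c z1 z2 : C) (m : R) :
  Cmod c = 1 ->
  (forall t, 0 <= t <= 1 ->
     cder F (z1 + RtoC t * (z2 - z1))%C (F' (z1 + RtoC t * (z2 - z1))%C) /\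
     m <= Re (c * F' (z1 + RtoC t * (z2 - z1))%C)) ->
  m * Cmod (z2 - z1) <= Cmod (F z2 - F z1).
Proof.
  intros Hc H; set (d := (z2 - z1)%C) in *; set (k := (Cconj d * c)%C).
  assert (D : forall t, 0 <= t <= 1 -> is_derive (fun u => Re (k * F (z1 + RtoC u * d)%C))
                t (Re (k * (F' (z1 + RtoC t * d)%C * d)))).
  { intros t Ht; apply is_derive_segment; now apply H. }
  destruct (MVT_gen (fun u => Re (k * F (z1 + RtoC u * d)%C)) 0 1
              (fun t => Re (k * (F' (z1 + RtoC t * d)%C * d)))) as [t [Ht E]].
  - intros t; rewrite Rmin_left, Rmax_right by lra; intros Ht; apply D; lra.
  - intros t; rewrite Rmin_left, Rmax_right by lra; intros Ht.
    apply derivable_continuous_pt; eexists; apply is_derive_Reals, D; lra.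
  - rewrite Rmin_left, Rmax_right in Ht by lra.
    replace (z1 + RtoC 1 * d)%C with z2 in E by (unfold d; ring).
    replace (z1 + RtoC 0 * d)%C with z1 in E by ring.
    destruct (H t Ht) as [_ Hm].
    assert (E1 : Re (k * (F' (z1 + RtoC t * d)%C * d))
                 = Cmod d * Cmod d * Re (c * F' (z1 + RtoC t * d)%C)).
    { rewrite Cmod_sqr; unfold k, Re, Im; simpl; ring. }
    assert (E2 : Re (k * F z2) - Re (k * F z1) = Re (k * (F z2 - F z1))).
    { unfold Re; simpl; ring. }
    assert (L := Re_le_Cmod (k * (F z2 - F z1))).
    rewrite Cmod_mult in L; unfold k in L; rewrite Cmod_mult, Cmod_conj, Hc in L.
    fold k in L; rewrite <- E2, E, E1 in L.
    assert (P := Cmod_ge_0 d); assert (P' := Cmod_ge_0 (F z2 - F z1)).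
    destruct (Req_dec (Cmod d) 0) as [Z|Z]; [rewrite Z; lra|].
    apply Rmult_le_reg_l with (Cmod d); [lra|].
    assert (Cmod d * Cmod d * m
            <= Cmod d * Cmod d * Re (c * F' (z1 + RtoC t * d)%C))
      by (apply Rmult_le_compat_l; [nra|exact Hm]).
    lra.
Qed.

(* The least real part on the circle [|z| = t] of the values of holomorphic
   functions on the unit disk bounded by [N] with value [1] at [0]. *)
Definition landau_slope (N t : R) : R := N * (1 - N * t) / (N - t).

(* The primitive of [landau_slope N] vanishing at [0]; its value at [1 / N] is
   the radius r1 of the schlicht disk. *)
Definition landau_growth (N t : R) : R :=
  N * N * t + (N ^ 3 - N) * ln (1 - t / N).

(** * Monotonicity and positivity of the comparison functions *)

Lemma landau_slope_decreasing (N s t : R) :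
  1 <= N -> s <= t < 1 -> landau_slope N t <= landau_slope N s.
Proof.
  intros HN H; unfold landau_slope.
  apply Rmult_le_reg_r with ((N - s) * (N - t)); [nra|].
  replace (N * (1 - N * t) / (N - t) * ((N - s) * (N - t)))
    with (N * (1 - N * t) * (N - s)) by (field; lra).
  replace (N * (1 - N * s) / (N - s) * ((N - s) * (N - t)))
    with (N * (1 - N * s) * (N - t)) by (field; lra).
  assert (0 <= N * ((t - s) * (N * N - 1))).
  { apply Rmult_le_pos; [lra|]; apply Rmult_le_pos; nra. }
  nra.
Qed.

Lemma landau_slope_pos (N t : R) :
  1 <= N -> t < 1 / N -> 0 < landau_slope N t.
Proof.
  intros HN H; assert (Ht : N * t < 1).
  { apply Rmult_lt_compat_l with (r := N) in H; [|lra].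
    replace (N * (1 / N)) with 1 in H by (field; lra); exact H. }
  assert (t < N) by nra.
  apply Rdiv_lt_0_compat; [apply Rmult_lt_0_compat; lra|lra].
Qed.

Lemma is_derive_landau_growth (N t : R) :
  1 < N -> t < N -> is_derive (landau_growth N) t (landau_slope N t).
Proof.
  intros HN Ht; unfold landau_growth, landau_slope; auto_derive.
  - assert (t / N < 1).
    { apply Rmult_lt_reg_r with N; [lra|]; unfold Rdiv; rewrite Rmult_assoc, Rinv_l; lra. }
    lra.
  - field; lra.
Qed.

Lemma landau_growth_0 (N : R) : landau_growth N 0 = 0.
Proof.
  unfold landau_growth; replace (1 - 0 / N) with 1 by (unfold Rdiv; ring).
  rewrite ln_1; ring.
Qed.

Lemma landau_growth_le (N s t : R) :
  1 < N -> s <= t <= 1 / N -> landau_growth N s <= landau_growth N t.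
Proof.
  intros HN H.
  assert (HN1 : 1 / N < 1).
  { apply Rmult_lt_reg_r with N; [lra|]; unfold Rdiv; rewrite Rmult_assoc, Rinv_l; lra. }
  destruct (MVT_gen (landau_growth N) s t (landau_slope N)) as [c [Hc E]].
  - intros x; rewrite Rmin_left, Rmax_right by lra; intros Hx.
    apply is_derive_landau_growth; lra.
  - intros x; rewrite Rmin_left, Rmax_right by lra; intros Hx.
    apply derivable_continuous_pt; eexists.
    apply is_derive_Reals, is_derive_landau_growth; lra.
  - rewrite Rmin_left, Rmax_right in Hc by lra.
    assert (0 <= landau_slope N c).
    { unfold landau_slope; apply Rmult_le_pos.
      - apply Rmult_le_pos; [lra|].
        assert (N * c <= N * (1 / N)) by (apply Rmult_le_compat_l; lra).
        replace (N * (1 / N)) with 1 in H0 by (field; lra); lra.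
      - left; apply Rinv_0_lt_compat; lra. }
    nra.
Qed.

Lemma landau_growth_pos (N : R) : 1 < N -> 0 < landau_growth N (1 / N).
Proof.
  intros HN.
  assert (P : 0 < 1 / N) by (apply Rdiv_lt_0_compat; lra).
  assert (HN1 : 1 / N < 1).
  { apply Rmult_lt_reg_r with N; [lra|]; unfold Rdiv; rewrite Rmult_assoc, Rinv_l; lra. }
  (* The slope vanishes at [1 / N], and the intermediate point of the mean value theorem may be an
     endpoint; on the first half of the interval the slope is strictly positive. *)
  apply Rlt_le_trans with (landau_growth N (1 / N / 2));
    [|apply landau_growth_le; lra].
  destruct (MVT_gen (landau_growth N) 0 (1 / N / 2) (landau_slope N)) as [c [Hc E]].
  - intros x; rewrite Rmin_left, Rmax_right by lra; intros Hx.
    apply is_derive_landau_growth; lra.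
  - intros x; rewrite Rmin_left, Rmax_right by lra; intros Hx.
    apply derivable_continuous_pt; eexists.
    apply is_derive_Reals, is_derive_landau_growth; lra.
  - rewrite Rmin_left, Rmax_right in Hc by lra.
    rewrite landau_growth_0 in E.
    assert (0 < landau_slope N c) by (apply landau_slope_pos; lra).
    nra.
Qed.

(** A constant lower bound for [Re (c F')] would lose the sharp radius. Instead the projection of
    [F] along the radius is compared with [|z|] times the primitive of the slope, and the difference
    [phi] has nonnegative derivative. *)
Lemma radial_lower (F F' : C -> C) (c z : C) (N : R) :
  1 < N -> Cmod z < 1 -> Cmod c = 1 ->
  (forall u, Cmod u < 1 ->
     cder F u (F' u) /\ landau_slope N (Cmod u) <= Re (c * F' u)) ->
  landau_growth N (Cmod z) <= Cmod (F z - F 0%C).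
Proof.
  intros HN Hz Hc H; set (k := (Cconj z * c)%C); assert (Pz := Cmod_ge_0 z).
  assert (Hin : forall t, 0 <= t <= 1 -> Cmod (0 + RtoC t * z) = t * Cmod z).
  { intros t Ht; replace (0 + RtoC t * z)%C with (RtoC t * z)%C by ring.
    rewrite Cmod_mult, Cmod_R, Rabs_pos_eq; lra. }
  assert (Hlt : forall t, 0 <= t <= 1 -> t * Cmod z < 1) by (intros; nra).
  set (phi := fun u => Re (k * F (0 + RtoC u * z)%C) - Cmod z * landau_growth N (u * Cmod z)).
  set (dphi := fun t => Re (k * (F' (0 + RtoC t * z)%C * z))
                        - Cmod z * (Cmod z * landau_slope N (t * Cmod z))).
  assert (D : forall t, 0 <= t <= 1 -> is_derive phi t (dphi t)).
  { intros t Ht; apply (is_derive_minus (V := R_NormedModule)).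
    - apply is_derive_segment, H; rewrite Hin by exact Ht; auto.
    - apply (is_derive_scal (fun u => landau_growth N (u * Cmod z)) t (Cmod z)).
      apply (is_derive_comp (landau_growth N) (fun u => u * Cmod z)).
      + apply is_derive_landau_growth; [exact HN|]; specialize (Hlt t Ht); lra.
      + auto_derive; [auto|ring]. }
  destruct (MVT_gen phi 0 1 dphi) as [t [Ht E]].
  - intros t; rewrite Rmin_left, Rmax_right by lra; intros Ht; apply D; lra.
  - intros t; rewrite Rmin_left, Rmax_right by lra; intros Ht.
    apply derivable_continuous_pt; eexists; apply is_derive_Reals, D; lra.
  - rewrite Rmin_left, Rmax_right in Ht by lra.
    assert (Pd : 0 <= dphi t).
    { unfold dphi.
      assert (E1 : Re (k * (F' (0 + RtoC t * z)%C * z))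
                   = Cmod z * Cmod z * Re (c * F' (0 + RtoC t * z)%C)).
      { rewrite Cmod_sqr; unfold k, Re, Im; simpl; ring. }
      destruct (H (0 + RtoC t * z)%C) as [_ Hs]; [rewrite Hin; auto|].
      rewrite Hin in Hs by exact Ht; rewrite E1.
      assert (Cmod z * Cmod z * landau_slope N (t * Cmod z)
              <= Cmod z * Cmod z * Re (c * F' (0 + RtoC t * z)%C))
        by (apply Rmult_le_compat_l; [nra|exact Hs]).
      lra. }
    unfold phi at 1 2 in E.
    replace (0 + RtoC 1 * z)%C with z in E by ring.
    replace (0 + RtoC 0 * z)%C with (RtoC 0) in E by ring.
    rewrite Rmult_1_l, Rmult_0_l, landau_growth_0 in E.
    assert (E2 : Re (k * F z) - Re (k * F 0%C) = Re (k * (F z - F 0%C))).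
    { unfold Re; simpl; ring. }
    assert (L := Re_le_Cmod (k * (F z - F 0%C))).
    rewrite Cmod_mult in L; unfold k in L; rewrite Cmod_mult, Cmod_conj, Hc in L.
    fold k in L; rewrite <- E2 in L.
    assert (P' := Cmod_ge_0 (F z - F 0%C)).
    destruct (Req_dec (Cmod z) 0) as [Z|Z]; [rewrite Z, landau_growth_0; exact P'|].
    apply Rmult_le_reg_l with (Cmod z); lra.
Qed.

(** All that the distortion estimates use of the mapping, expressed through [h] and [g]: [Lambda] is
    at most [N] and [lambda] at 0 is at least 1. These pass to every rotation [h + e g]. *)
Definition landau_pair (N : R) (h h' g g' : C -> C) : Prop :=
  (forall z, Cmod z < 1 -> cder h z (h' z)) /\
  (forall z, Cmod z < 1 -> cder g z (g' z)) /\
  (exists h'', hol1 h' h'') /\ (exists g'', hol1 g' g'') /\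
  (forall z, Cmod z < 1 -> Cmod (h' z) + Cmod (g' z) <= N) /\
  1 <= Rabs (Cmod (h' 0%C) - Cmod (g' 0%C)).

Lemma hol1_rotation (F F' G G' : C -> C) (e : C) :
  hol1 F F' -> hol1 G G' ->
  hol1 (fun z => F z + e * G z)%C (fun z => F' z + e * G' z)%C.
Proof.
  intros HF HG z Hz; destruct (HF z Hz) as [D1 C1]; destruct (HG z Hz) as [D2 C2]; split.
  - apply cder_plus; [exact D1|now apply cder_scal].
  - apply ccont_plus; [exact C1|]; apply ccont_mult; [apply ccont_const|exact C2].
Qed.

Lemma Cmod_rotation_le (a b e : C) :
  Cmod e = 1 -> Cmod (a + e * b) <= Cmod a + Cmod b.
Proof.
  intros He; apply Rle_trans with (1 := Cmod_triangle _ _).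
  rewrite Cmod_mult, He; lra.
Qed.

(** The order of choices matters: [c] depends on [e] but not on [z], so one projection serves a
    whole segment. *)
Lemma landau_pair_direction (N : R) (h h' g g' : C -> C) (e : C) :
  1 <= N -> landau_pair N h h' g g' -> Cmod e = 1 ->
  exists c, Cmod c = 1 /\ forall z, Cmod z < 1 ->
    cder (fun u => h u + e * g u)%C z (h' z + e * g' z)%C /\
    landau_slope N (Cmod z) <= Re (c * (h' z + e * g' z)).
Proof.
  intros HN [Hh [Hg [[h'' Hh'] [[g'' Hg'] [HB H1]]]]] He.
  destruct (schwarz_pick_Re (fun z => h' z + e * g' z)%C
              (fun z => h'' z + e * g'' z)%C N) as [c [Hc Hl]]; auto.
  - now apply hol1_rotation.
  - intros z Hz; apply Rle_trans with (2 := HB z Hz); now apply Cmod_rotation_le.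
  - apply Rle_trans with (1 := H1); now apply Cmod_rotation_ge.
  - exists c; split; [exact Hc|]; intros z Hz; split; [|now apply Hl].
    apply cder_plus; [now apply Hh|]; apply cder_scal; now apply Hg.
Qed.

(** The rotation [e] is fitted to the two points; as the slope decreases, its value at [r] bounds it
    from below on the whole segment, which stays in [|z| <= r] by convexity. *)
Lemma landau_pair_dist (N : R) (h h' g g' : C -> C) (r : R) (z1 z2 : C) :
  1 <= N -> landau_pair N h h' g g' -> r < 1 -> Cmod z1 <= r -> Cmod z2 <= r ->
  landau_slope N r * Cmod (z2 - z1)
    <= Rabs (Cmod (h z2 - h z1) - Cmod (g z2 - g z1)).
Proof.
  intros HN HP Hr H1 H2.
  destruct (rotation_align (h z2 - h z1) (g z2 - g z1)) as [e [He <-]].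
  destruct (landau_pair_direction N h h' g g' e HN HP He) as [c [Hc Hl]].
  replace (h z2 - h z1 + e * (g z2 - g z1))%C
    with ((h z2 + e * g z2) - (h z1 + e * g z1))%C by ring.
  apply (segment_lower (fun u => h u + e * g u)%C (fun u => h' u + e * g' u)%C c);
    [exact Hc|]; intros t Ht.
  set (u := (z1 + RtoC t * (z2 - z1))%C).
  assert (Hu : Cmod u <= r).
  { unfold u; replace (z1 + RtoC t * (z2 - z1))%C
      with (RtoC (1 - t) * z1 + RtoC t * z2)%C by (rewrite RtoC_minus; ring).
    apply Rle_trans with (1 := Cmod_triangle _ _).
    rewrite !Cmod_mult, !Cmod_R, !Rabs_pos_eq by lra; nra. }
  destruct (Hl u ltac:(lra)) as [D L]; split; [exact D|].
  apply Rle_trans with (2 := L); apply landau_slope_decreasing; lra.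
Qed.

Lemma landau_pair_growth (N : R) (h h' g g' : C -> C) (z : C) :
  1 < N -> landau_pair N h h' g g' -> Cmod z < 1 ->
  landau_growth N (Cmod z) <= Rabs (Cmod (h z - h 0%C) - Cmod (g z - g 0%C)).
Proof.
  intros HN HP Hz.
  destruct (rotation_align (h z - h 0%C) (g z - g 0%C)) as [e [He <-]].
  destruct (landau_pair_direction N h h' g g' e ltac:(lra) HP He) as [c [Hc Hl]].
  replace (h z - h 0%C + e * (g z - g 0%C))%C
    with ((h z + e * g z) - (h 0%C + e * g 0%C))%C by ring.
  now apply (radial_lower (fun u => h u + e * g u)%C (fun u => h' u + e * g' u)%C c).
Qed.

(** If the moduli agreed, some rotation [h' + e g'] would vanish at [z], although its projection is
    at least the positive slope. *)
Lemma landau_pair_jacobian (N : R) (h h' g g' : C -> C) (z : C) :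
  1 <= N -> landau_pair N h h' g g' -> Cmod z < 1 / N -> Cmod (h' z) <> Cmod (g' z).
Proof.
  intros HN HP Hz E.
  destruct (rotation_align (h' z) (g' z)) as [e [He Ha]].
  destruct (landau_pair_direction N h h' g g' e HN HP He) as [c [Hc Hl]].
  assert (HN1 : 1 / N <= 1).
  { apply Rmult_le_reg_r with N; [lra|]; unfold Rdiv; rewrite Rmult_assoc, Rinv_l; lra. }
  destruct (Hl z) as [_ L]; [lra|].
  assert (P := landau_slope_pos N (Cmod z) HN Hz).
  rewrite E in Ha; replace (Cmod (g' z) - Cmod (g' z)) with 0 in Ha by ring.
  rewrite Rabs_R0 in Ha.
  assert (X := Re_le_Cmod (c * (h' z + e * g' z))).
  rewrite Cmod_mult, Ha in X; lra.
Qed.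

Lemma Cmod_harmonic_diff (a b c d : C) :
  Rabs (Cmod (a - b) - Cmod (c - d)) <= Cmod ((a + Cconj c) - (b + Cconj d)).
Proof.
  replace ((a + Cconj c) - (b + Cconj d))%C with ((a - b) + 1 * Cconj (c - d))%C
    by (rewrite Cminus_conj; ring).
  rewrite <- (Cmod_conj (c - d)); apply Cmod_rotation_ge, Cmod_1.
Qed.

Lemma landau_pair_schlicht (N : R) (f h h' g g' : C -> C) :
  1 < N -> landau_pair N h h' g g' ->
  (forall z, Cmod z < 1 -> f z = (h z + Cconj (g z))%C) -> f 0%C = 0%C ->
  univalent_in (disk 0 (1 / N)) f /\
  contains_schlicht_disk f (1 / N) 0 (landau_growth N (1 / N)).
Proof.
  intros HN HP Hf H0.
  assert (P : 0 < 1 / N) by (apply Rdiv_lt_0_compat; lra).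
  assert (HN1 : 1 / N < 1).
  { apply Rmult_lt_reg_r with N; [lra|]; unfold Rdiv; rewrite Rmult_assoc, Rinv_l; lra. }
  assert (Hlow : forall r, r < 1 / N -> exists m, 0 < m /\ forall z1 z2,
     Cmod z1 <= r -> Cmod z2 <= r -> m * Cmod (z1 - z2) <= Cmod (f z1 - f z2)).
  { intros r Hr; exists (landau_slope N r); split; [apply landau_slope_pos; lra|].
    intros z1 z2 H1 H2; rewrite !Hf by lra.
    apply Rle_trans with (2 := Cmod_harmonic_diff _ _ _ _).
    apply (landau_pair_dist N h h' g g'); auto; lra. }
  split; [now apply univalent_of_lower_bound|].
  assert (Hloc : forall z, Cmod z < 1 -> exists d, 0 < d /\
            forall u, Cmod (u - z) < d -> f u = (h u + Cconj (g u))%C).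
  { intros z Hz; exists (1 - Cmod z); split; [lra|]; intros u Hu; apply Hf.
    assert (X := Cmod_triangle_rev u z); lra. }
  assert (HP' := HP); destruct HP' as [Hh [Hg _]].
  apply schlicht_disk_criterion; auto.
  - now apply landau_growth_pos.
  - intros z Hz.
    apply ccont_ext_loc with (fun u => h u + Cconj (g u))%C.
    + destruct (Hloc z ltac:(lra)) as [d [Pd Hd]]; exists d; split; [exact Pd|].
      intros u Hu; symmetry; auto.
    + apply ccont_plus; [|apply ccont_conj];
        eapply cder_ccont; [apply Hh|apply Hg]; lra.
  - intros rho Hrho.
    (* [|f z|] is at least the growth function at [|z|], so continuity of that function at [1 / N]
       supplies a radius beyond which values exceed [rho]. *)
    assert (D := is_derive_landau_growth N (1 / N) HN ltac:(lra)).
    assert (Cn : continuity_pt (landau_growth N) (1 / N)).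
    { apply derivable_continuous_pt; eexists; apply is_derive_Reals, D. }
    destruct (Cn (landau_growth N (1 / N) - rho)) as [d [Pd Hd]]; [lra|].
    set (r := 1 / N - Rmin d (1 / N) / 2).
    assert (Q := Rmin_pos d (1 / N) Pd P).
    assert (Q1 := Rmin_l d (1 / N)); assert (Q2 := Rmin_r d (1 / N)).
    exists r; split; [unfold r; lra|]; intros z Hz.
    apply Rlt_le_trans with (landau_growth N r).
    + specialize (Hd r); simpl in Hd; unfold Rdist, D_x, no_cond in Hd.
      assert (Hx : Rabs (landau_growth N r - landau_growth N (1 / N))
                   < landau_growth N (1 / N) - rho).
      { apply Hd; split; [split; [exact I|unfold r; lra]|].
        apply Rabs_def1; unfold r; lra. }
      apply Rabs_def2 in Hx; lra.
    + apply Rle_trans with (landau_growth N (Cmod z));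
        [apply landau_growth_le; lra|].
      replace (f z) with (f z - f 0%C)%C by (rewrite H0; ring).
      rewrite !Hf by (rewrite ?Cmod_0; lra).
      apply Rle_trans with (2 := Cmod_harmonic_diff _ _ _ _).
      apply (landau_pair_growth N h h' g g'); auto; lra.
  - intros z v Hz Hmin.
    apply (local_min_harmonic f h g z v (h' z) (g' z)); auto.
    + apply Hloc; lra.
    + apply Hh; lra.
    + apply Hg; lra.
    + apply (landau_pair_jacobian N h h' g g'); auto; lra.
Qed.

(** * Wirtinger derivatives *)

Lemma vder_ext_loc (gamma delta : R -> C) (t : R) (l : C) :
  locally t (fun u => gamma u = delta u) -> vder gamma t l -> vder delta t l.
Proof.
  intros [d Hd] [q [Hq [Eq [d' [Pd' E]]]]].
  exists q; split; [exact Hq|]; split; [exact Eq|].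
  exists (Rmin d d'); split; [apply Rmin_pos; [apply cond_pos|exact Pd']|]; intros u Hu.
  rewrite <- !Hd; [apply E| |].
  - apply Rlt_le_trans with (1 := Hu), Rmin_r.
  - apply ball_center.
  - apply Rlt_le_trans with (1 := Hu), Rmin_l.
Qed.

Lemma vder_plus (gamma delta : R -> C) (t : R) (l m : C) :
  vder gamma t l -> vder delta t m -> vder (fun u => (gamma u + delta u)%C) t (l + m)%C.
Proof.
  intros [q [Hq [Eq [d [Pd E]]]]] [q' [Hq' [Eq' [d' [Pd' E']]]]].
  exists (fun u => (q u + q' u)%C); split.
  { apply vcont_ccont; apply vcont_ccont in Hq; apply vcont_ccont in Hq'.
    now apply (ccont_plus (fun w => q (Re w)) (fun w => q' (Re w))). }
  split; [now rewrite Eq, Eq'|].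
  exists (Rmin d d'); split; [now apply Rmin_pos|]; intros u Hu.
  rewrite (E u), (E' u); [ring| |].
  - apply Rlt_le_trans with (1 := Hu), Rmin_r.
  - apply Rlt_le_trans with (1 := Hu), Rmin_l.
Qed.

Lemma vder_scal (c : C) (gamma : R -> C) (t : R) (l : C) :
  vder gamma t l -> vder (fun u => (c * gamma u)%C) t (c * l)%C.
Proof.
  intros H; apply (cder_vder (fun w => c * w)%C gamma); [|exact H].
  assert (D := cder_scal c _ _ _ (cder_id (gamma t))).
  now replace (c * 1)%C with c in D by ring.
Qed.

Lemma vder_conj (gamma : R -> C) (t : R) (l : C) :
  vder gamma t l -> vder (fun u => Cconj (gamma u)) t (Cconj l).
Proof.
  intros H; apply (vder_pair (fun u => Re (gamma u)) (fun u => - Im (gamma u))).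
  - now apply vder_Re.
  - apply (is_derive_opp (fun u => Im (gamma u))); now apply vder_Im.
Qed.

Lemma cder_vder_x (F : C -> C) (z l : C) :
  cder F z l -> vder (fun t => F (t, Im z)) (Re z) l.
Proof.
  intros H; replace l with (l * (1%R, 0%R))%C
    by (apply injective_projections; simpl; ring).
  apply (cder_vder F (fun t => (t, Im z))); [now destruct z|].
  apply vder_pair; auto_derive; auto.
Qed.

Lemma cder_vder_y (F : C -> C) (z l : C) :
  cder F z l -> vder (fun t => F (Re z, t)) (Im z) (l * Ci)%C.
Proof.
  intros H; apply (cder_vder F (fun t => (Re z, t))); [now destruct z|].
  apply vder_pair; auto_derive; auto.
Qed.

Lemma locally_slice_x (z : C) (P : C -> Prop) :
  locally z P -> locally (Re z) (fun t => P (t, Im z)).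
Proof.
  intros [d Hd]; exists d; intros t Ht; apply Hd; split; [exact Ht|apply ball_center].
Qed.

Lemma locally_slice_y (z : C) (P : C -> Prop) :
  locally z P -> locally (Im z) (fun t => P (Re z, t)).
Proof.
  intros [d Hd]; exists d; intros t Ht; apply Hd; split; [apply ball_center|exact Ht].
Qed.

Lemma locally_unit_disk (z : C) : Cmod z < 1 -> locally z (fun w => Cmod w < 1).
Proof.
  intros Hz; apply locally_Cmod; exists (1 - Cmod z); split; [lra|]; intros w Hw.
  assert (X := Cmod_triangle_rev w z); lra.
Qed.

Lemma locally_2d_C (P : C -> Prop) (x y : R) :
  locally ((x, y) : C) P -> locally_2d (fun u v => P (u, v)) x y.
Proof.
  intros [d Hd]; exists d; intros u v Hu Hv; apply Hd; split; assumption.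
Qed.

Lemma continuity_2d_ccont_id (F : C -> C) (x y : R) :
  ccont F (x, y) ->
  continuity_2d_pt (fun u v => Re (F (u, v))) x y /\
  continuity_2d_pt (fun u v => Im (F (u, v))) x y.
Proof.
  intros H; apply (continuity_2d_ccont F (fun u _ => u) (fun _ v => v)); auto.
  - apply continuity_2d_pt_id1.
  - apply continuity_2d_pt_id2.
Qed.

(** The theorem on symmetry of second derivatives speaks of iterated [Derive]. The given partials
    agree with these on the open disk, hence near every point of it, and may be exchanged for
    them. *)
Lemma mixed_partials (a p q s t : R -> R -> R) :
  (forall x y, Cmod (x, y) < 1 ->
     is_derive (fun u => a u y) x (p x y) /\ is_derive (fun v => a x v) y (q x y) /\
     is_derive (fun v => p x v) y (s x y) /\ is_derive (fun u => q u y) x (t x y) /\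
     continuity_2d_pt s x y /\ continuity_2d_pt t x y) ->
  forall x y, Cmod (x, y) < 1 -> s x y = t x y.
Proof.
  intros H x y Hxy.
  assert (Hx : forall x y, Cmod (x, y) < 1 -> locally x (fun u => Cmod (u, y) < 1)).
  { intros u v Huv; exact (locally_slice_x (u, v) _ (locally_unit_disk _ Huv)). }
  assert (Hy : forall x y, Cmod (x, y) < 1 -> locally y (fun v => Cmod (x, v) < 1)).
  { intros u v Huv; exact (locally_slice_y (u, v) _ (locally_unit_disk _ Huv)). }
  assert (HS : forall x y, Cmod (x, y) < 1 ->
     is_derive (fun v => Derive (fun u => a u v) x) y (s x y)).
  { intros u v Huv; apply is_derive_ext_loc with (fun v => p u v).
    - generalize (Hy u v Huv); apply filter_imp; intros v' Hv'.
      symmetry; apply is_derive_unique; now apply H.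
    - now apply H. }
  assert (HT : forall x y, Cmod (x, y) < 1 ->
     is_derive (fun u => Derive (fun v => a u v) y) x (t x y)).
  { intros u v Huv; apply is_derive_ext_loc with (fun u => q u v).
    - generalize (Hx u v Huv); apply filter_imp; intros v' Hv'.
      symmetry; apply is_derive_unique; now apply H.
    - now apply H. }
  assert (HL := locally_2d_C _ x y (locally_unit_disk _ Hxy)).
  rewrite <- (is_derive_unique _ _ _ (HS x y Hxy)).
  rewrite <- (is_derive_unique _ _ _ (HT x y Hxy)).
  symmetry; apply Schwarz.
  - revert HL; apply locally_2d_impl, locally_2d_forall; intros u v Huv.
    destruct (H u v Huv) as [A [B _]].
    split; [|split; [|split]]; eexists;
      [exact A|exact B|exact (HT u v Huv)|exact (HS u v Huv)].
  - apply continuity_2d_pt_ext_loc with t; [|now apply H].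
    revert HL; apply locally_2d_impl, locally_2d_forall; intros u v Huv.
    symmetry; apply is_derive_unique; now apply HT.
  - apply continuity_2d_pt_ext_loc with s; [|now apply H].
    revert HL; apply locally_2d_impl, locally_2d_forall; intros u v Huv.
    symmetry; apply is_derive_unique; now apply HS.
Qed.

Lemma ccont_continuous (F : C -> C) (z : C) : ccont F z <-> continuous F z.
Proof.
  split.
  - intros H P HP; apply locally_Cmod in HP; destruct HP as [e [Pe He]].
    apply locally_Cmod; destruct (H e Pe) as [d [Pd Hd]]; exists d; auto.
  - intros H eps He.
    assert (L : locally (F z) (fun w => Cmod (w - F z) < eps)).
    { apply locally_Cmod; exists eps; auto. }
    apply H, locally_Cmod in L; exact L.
Qed.

(** It suffices that one partial derivative exist nearby and be continuous at [z], while the other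
    merely exists at [z]. *)
Lemma partials_differentiable (a p : C -> R) (z : C) (b : R) :
  locally z (fun u => is_derive (fun t => a (t, Im u)) (Re u) (p u)) ->
  is_derive (fun t => a (Re z, t)) (Im z) b ->
  continuous p z ->
  forall eps, 0 < eps -> exists delta, 0 < delta /\ forall u, Cmod (u - z) < delta ->
    Rabs (a u - a z - ((Re u - Re z) * p z + (Im u - Im z) * b)) <= eps * Cmod (u - z).
Proof.
  intros H1 H2 H3 eps He; destruct z as [x y].
  destruct (is_derive_filterdiff (fun u v => a (u, v)) x y (fun u v => p (u, v)) b)
    as [_ D].
  - revert H1; apply filter_imp; intros [u v] H; exact H.
  - exact H2.
  - apply continuous_ext with p; [now intros [u v]|exact H3].
  - specialize (D (x, y) (fun P HP => HP) (mkposreal eps He)).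
    apply locally_Cmod in D; destruct D as [d [Pd Hd]].
    exists d; split; [exact Pd|]; intros [u v] Hu.
    assert (X := Hd (u, v) Hu); simpl in X.
    apply Rle_trans with (1 := X), Req_le, f_equal.
    (* The product norm on pairs is Euclidean, hence equal to [Cmod]. *)
    unfold norm; simpl; unfold prod_norm, norm, Cmod; simpl; unfold abs; simpl.
    rewrite !Rmult_1_r, <- !Rabs_mult, !Rabs_pos_eq; try reflexivity; nra.
Qed.

(** The second hypothesis is the Cauchy-Riemann equation [F_y = i F_x] at [z]. With it the real
    differentials of [Re F] and [Im F] combine into multiplication by [Fx z]. *)
Lemma cauchy_riemann_cder (F Fx : C -> C) (z : C) :
  locally z (fun u => vder (fun t => F (t, Im u)) (Re u) (Fx u)) ->
  vder (fun t => F (Re z, t)) (Im z) (Fx z * Ci)%C ->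
  ccont Fx z -> cder F z (Fx z).
Proof.
  intros H1 H2 H3; apply cder_eps_delta; intros eps He.
  assert (CR : continuous (fun u => Re (Fx u)) z).
  { intros P [e HP]; apply locally_Cmod; destruct (H3 e (cond_pos e)) as [d [Pd Hd]].
    exists d; split; [exact Pd|]; intros u Hu; apply HP.
    apply Rle_lt_trans with (2 := Hd u Hu); exact (re_le_Cmod (Fx u - Fx z)). }
  assert (CI : continuous (fun u => Im (Fx u)) z).
  { intros P [e HP]; apply locally_Cmod; destruct (H3 e (cond_pos e)) as [d [Pd Hd]].
    exists d; split; [exact Pd|]; intros u Hu; apply HP.
    apply Rle_lt_trans with (2 := Hd u Hu); exact (im_le_Cmod (Fx u - Fx z)). }
  destruct (partials_differentiable (fun u => Re (F u)) (fun u => Re (Fx u)) z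
              (Re (Fx z * Ci))) with (eps := eps / 2) as [d1 [P1 D1]]; auto; try lra.
  { revert H1; apply filter_imp; intros u Hu; exact (vder_Re _ _ _ Hu). }
  { exact (vder_Re _ _ _ H2). }
  destruct (partials_differentiable (fun u => Im (F u)) (fun u => Im (Fx u)) z
              (Im (Fx z * Ci))) with (eps := eps / 2) as [d2 [P2 D2]]; auto; try lra.
  { revert H1; apply filter_imp; intros u Hu; exact (vder_Im _ _ _ Hu). }
  { exact (vder_Im _ _ _ H2). }
  exists (Rmin d1 d2); split; [now apply Rmin_pos|]; intros u Hu.
  assert (X := D1 u (Rlt_le_trans _ _ _ Hu (Rmin_l _ _))).
  assert (Y := D2 u (Rlt_le_trans _ _ _ Hu (Rmin_r _ _))).
  apply Rle_trans with (1 := Cmod_le_Re_Im _).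
  replace (Re (F u - F z - (u - z) * Fx z))
    with (Re (F u) - Re (F z) - ((Re u - Re z) * Re (Fx z) + (Im u - Im z) * Re (Fx z * Ci)))
    by (unfold Re, Im; simpl; ring).
  replace (Im (F u - F z - (u - z) * Fx z))
    with (Im (F u) - Im (F z) - ((Re u - Re z) * Im (Fx z) + (Im u - Im z) * Im (Fx z * Ci)))
    by (unfold Re, Im; simpl; ring).
  lra.
Qed.

(* By the symmetry of second derivatives, the derivative of a holomorphic
   function satisfies the Cauchy-Riemann equations. *)
Lemma hol1_of_C1_derivative (G G' Gx Gy : C -> C) :
  (forall z, Cmod z < 1 -> cder G z (G' z)) ->
  (forall z, Cmod z < 1 ->
     vder (fun t => G' (t, Im z)) (Re z) (Gx z) /\
     vder (fun t => G' (Re z, t)) (Im z) (Gy z) /\ ccont Gx z /\ ccont Gy z) ->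
  hol1 G' Gx.
Proof.
  intros HG HP.
  (* Since [G_x = G'] and [G_y = i G'], equality of the mixed partials of [G] reads
     [G'_y = i G'_x]. *)
  assert (CRe : forall x y, Cmod (x, y) < 1 -> Re (Gy (x, y)) = Re (Gx (x, y) * Ci)).
  { apply (mixed_partials (fun x y => Re (G (x, y))) (fun x y => Re (G' (x, y)))
             (fun x y => Re (G' (x, y) * Ci)) (fun x y => Re (Gy (x, y)))
             (fun x y => Re (Gx (x, y) * Ci))).
    intros x y Hxy; destruct (HP _ Hxy) as [Vx [Vy [Cx Cy]]].
    refine (conj _ (conj _ (conj _ (conj _ (conj _ _))))).
    - exact (vder_Re _ _ _ (cder_vder_x _ _ _ (HG _ Hxy))).
    - exact (vder_Re _ _ _ (cder_vder_y _ _ _ (HG _ Hxy))).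
    - exact (vder_Re _ _ _ Vy).
    - replace (Gx (x, y) * Ci)%C with (Ci * Gx (x, y))%C by ring.
      apply is_derive_ext with (fun u => Re (Ci * G' (u, y))); [intros u; f_equal; ring|].
      exact (vder_Re _ _ _ (vder_scal Ci _ _ _ Vx)).
    - now apply continuity_2d_ccont_id.
    - apply (continuity_2d_ccont_id (fun u => Gx u * Ci)%C).
      apply ccont_mult; [exact Cx|apply ccont_const]. }
  assert (CIm : forall x y, Cmod (x, y) < 1 -> Im (Gy (x, y)) = Im (Gx (x, y) * Ci)).
  { apply (mixed_partials (fun x y => Im (G (x, y))) (fun x y => Im (G' (x, y)))
             (fun x y => Im (G' (x, y) * Ci)) (fun x y => Im (Gy (x, y)))
             (fun x y => Im (Gx (x, y) * Ci))).
    intros x y Hxy; destruct (HP _ Hxy) as [Vx [Vy [Cx Cy]]].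
    refine (conj _ (conj _ (conj _ (conj _ (conj _ _))))).
    - exact (vder_Im _ _ _ (cder_vder_x _ _ _ (HG _ Hxy))).
    - exact (vder_Im _ _ _ (cder_vder_y _ _ _ (HG _ Hxy))).
    - exact (vder_Im _ _ _ Vy).
    - replace (Gx (x, y) * Ci)%C with (Ci * Gx (x, y))%C by ring.
      apply is_derive_ext with (fun u => Im (Ci * G' (u, y))); [intros u; f_equal; ring|].
      exact (vder_Im _ _ _ (vder_scal Ci _ _ _ Vx)).
    - now apply continuity_2d_ccont_id.
    - apply (continuity_2d_ccont_id (fun u => Gx u * Ci)%C).
      apply ccont_mult; [exact Cx|apply ccont_const]. }
  intros z Hz; split; [|now apply HP].
  apply cauchy_riemann_cder.
  - generalize (locally_unit_disk z Hz); apply filter_imp; intros u Hu; now apply HP.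
  - replace (Gx z * Ci)%C with (Gy z); [now apply HP|].
    destruct z as [x y]; apply injective_projections; [now apply CRe|now apply CIm].
  - now apply HP.
Qed.

(** * From the partial derivatives of the mapping to the derivatives of [h] and [g] *)

Lemma unit_disk_Cmod (z : C) : unit_disk z <-> Cmod z < 1.
Proof.
  unfold unit_disk, disk; now replace (z - 0)%C with z by ring.
Qed.

Lemma vder_dx (F : C -> C) (z l : C) :
  vder (fun t => F (t, Im z)) (Re z) l -> ex_dx F z /\ dx F z = l.
Proof.
  intros H; assert (A := vder_Re _ _ _ H); assert (B := vder_Im _ _ _ H).
  split; [split; eexists; eassumption|].
  apply injective_projections;
    [exact (is_derive_unique _ _ _ A)|exact (is_derive_unique _ _ _ B)].
Qed.

Lemma vder_dy (F : C -> C) (z l : C) :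
  vder (fun t => F (Re z, t)) (Im z) l -> ex_dy F z /\ dy F z = l.
Proof.
  intros H; assert (A := vder_Re _ _ _ H); assert (B := vder_Im _ _ _ H).
  split; [split; eexists; eassumption|].
  apply injective_projections;
    [exact (is_derive_unique _ _ _ A)|exact (is_derive_unique _ _ _ B)].
Qed.

Lemma ex_dx_vder (F : C -> C) (z : C) :
  ex_dx F z -> vder (fun t => F (t, Im z)) (Re z) (dx F z).
Proof.
  intros [A B]; apply vder_ext_loc with (fun t => (Re (F (t, Im z)), Im (F (t, Im z)))).
  - apply filter_forall; intros t; symmetry; apply surjective_pairing.
  - apply vder_pair; now apply Derive_correct.
Qed.

Lemma ex_dy_vder (F : C -> C) (z : C) :
  ex_dy F z -> vder (fun t => F (Re z, t)) (Im z) (dy F z).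
Proof.
  intros [A B]; apply vder_ext_loc with (fun t => (Re (F (Re z, t)), Im (F (Re z, t)))).
  - apply filter_forall; intros t; symmetry; apply surjective_pairing.
  - apply vder_pair; now apply Derive_correct.
Qed.

Lemma harmonic_vder (f h g : C -> C) (z A B : C) :
  (forall w, Cmod w < 1 -> f w = (h w + Cconj (g w))%C) -> Cmod z < 1 ->
  cder h z A -> cder g z B ->
  vder (fun t => f (t, Im z)) (Re z) (A + Cconj B)%C /\
  vder (fun t => f (Re z, t)) (Im z) (A * Ci + Cconj (B * Ci))%C.
Proof.
  intros Hf Hz HA HB; split.
  - apply vder_ext_loc with (fun t => h (t, Im z) + Cconj (g (t, Im z)))%C.
    + generalize (locally_slice_x _ _ (locally_unit_disk z Hz)).
      apply filter_imp; intros t Ht; symmetry; now apply Hf.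
    + apply vder_plus; [now apply cder_vder_x|].
      apply vder_conj; now apply cder_vder_x.
  - apply vder_ext_loc with (fun t => h (Re z, t) + Cconj (g (Re z, t)))%C.
    + generalize (locally_slice_y _ _ (locally_unit_disk z Hz)).
      apply filter_imp; intros t Ht; symmetry; now apply Hf.
    + apply vder_plus; [now apply cder_vder_y|].
      apply vder_conj; now apply cder_vder_y.
Qed.

Lemma wirtinger_harmonic (f h g : C -> C) (z A B : C) :
  (forall w, Cmod w < 1 -> f w = (h w + Cconj (g w))%C) -> Cmod z < 1 ->
  cder h z A -> cder g z B -> d_z f z = A /\ d_zbar f z = Cconj B.
Proof.
  intros Hf Hz HA HB; destruct (harmonic_vder f h g z A B Hf Hz HA HB) as [Vx Vy].
  unfold d_z, d_zbar.
  rewrite (proj2 (vder_dx _ _ _ Vx)), (proj2 (vder_dy _ _ _ Vy)).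
  split; apply injective_projections; simpl; field.
Qed.

(** The cases [e = - Ci] and [e = Ci] are the Wirtinger derivatives [d_z f] and [d_zbar f]. *)
Lemma wirtinger_vder (f : C -> C) (e : C) :
  C2_in unit_disk f -> exists Px Py : C -> C, forall z, Cmod z < 1 ->
    vder (fun t => (dx f (t, Im z) + e * dy f (t, Im z)) / 2)%C (Re z) (Px z) /\
    vder (fun t => (dx f (Re z, t) + e * dy f (Re z, t)) / 2)%C (Im z) (Py z) /\
    ccont Px z /\ ccont Py z.
Proof.
  intros [_ [H1 H2]].
  exists (fun z => / 2 * (dx (dx f) z + e * dx (dy f) z))%C.
  exists (fun z => / 2 * (dy (dx f) z + e * dy (dy f) z))%C.
  intros z Hz; apply unit_disk_Cmod in Hz.
  destruct (H1 z Hz) as [A1 [A2 [A3 A4]]]; destruct (H2 z Hz) as [B1 [B2 [B3 B4]]].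
  apply ccont_continuous in A3; apply ccont_continuous in A4.
  apply ccont_continuous in B3; apply ccont_continuous in B4.
  repeat split.
  - apply vder_ext_loc with (fun t => / 2 * (dx f (t, Im z) + e * dy f (t, Im z)))%C.
    + apply filter_forall; intros t; unfold Cdiv; ring.
    + apply vder_scal, vder_plus; [now apply ex_dx_vder|].
      apply vder_scal; now apply ex_dx_vder.
  - apply vder_ext_loc with (fun t => / 2 * (dx f (Re z, t) + e * dy f (Re z, t)))%C.
    + apply filter_forall; intros t; unfold Cdiv; ring.
    + apply vder_scal, vder_plus; [now apply ex_dy_vder|].
      apply vder_scal; now apply ex_dy_vder.
  - apply ccont_mult; [apply ccont_const|]; apply ccont_plus; [exact A3|].
    apply ccont_mult; [apply ccont_const|exact B3].
  - apply ccont_mult; [apply ccont_const|]; apply ccont_plus; [exact A4|].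
    apply ccont_mult; [apply ccont_const|exact B4].
Qed.

Lemma holomorphic_cder (F : C -> C) (z : C) :
  holomorphic_in unit_disk F -> Cmod z < 1 -> cder F z (C_derive F z).
Proof.
  intros H Hz; apply is_derive_cder, C_derive_correct; [exact z|].
  now apply H, unit_disk_Cmod.
Qed.

Lemma d_z_alt (f : C -> C) (z : C) :
  d_z f z = ((dx f z + - Ci * dy f z) / 2)%C.
Proof.
  unfold d_z, Cdiv; ring.
Qed.

(** As [h' = f_z] and [g' = conj f_zbar], the second-order smoothness of [f] gives [h'] and [g']
    continuous partial derivatives, which makes them holomorphic with continuous derivative. *)
Lemma landau_hypotheses_pair (K M : R) (f h g : C -> C) :
  1 <= K -> landau_hypotheses K M f h g ->
  landau_pair (K * M) h (C_derive h) g (C_derive g).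
Proof.
  intros HK [[HC2 _] [Hh [Hg [Hf [[_ HQ] [_ [H1 HM]]]]]]].
  assert (Hf' : forall w, Cmod w < 1 -> f w = (h w + Cconj (g w))%C).
  { intros w Hw; now apply Hf, unit_disk_Cmod. }
  assert (Dh : forall z, Cmod z < 1 -> cder h z (C_derive h z)).
  { intros z Hz; now apply holomorphic_cder. }
  assert (Dg : forall z, Cmod z < 1 -> cder g z (C_derive g z)).
  { intros z Hz; now apply holomorphic_cder. }
  assert (W : forall z, Cmod z < 1 ->
            d_z f z = C_derive h z /\ d_zbar f z = Cconj (C_derive g z)).
  { intros z Hz; apply (wirtinger_harmonic f h g); auto. }
  assert (EL : forall z, Cmod z < 1 ->
     Lambda f z = Cmod (C_derive h z) + Cmod (C_derive g z) /\
     lambda f z = Rabs (Cmod (C_derive h z) - Cmod (C_derive g z))).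
  { intros z Hz; unfold Lambda, lambda; destruct (W z Hz) as [-> ->].
    now rewrite Cmod_conj. }
  repeat split; auto.
  - destruct (wirtinger_vder f (- Ci) HC2) as [Px [Py HP]].
    exists Px; apply (hol1_of_C1_derivative h _ Px Py); [exact Dh|].
    intros z Hz; destruct (HP z Hz) as [V1 [V2 [C1 C2]]].
    repeat split; auto.
    + apply vder_ext_loc with (2 := V1).
      generalize (locally_slice_x _ _ (locally_unit_disk z Hz)).
      apply filter_imp; intros t Ht; transitivity (d_z f (t, Im z)).
      * symmetry; apply d_z_alt.
      * now apply W.
    + apply vder_ext_loc with (2 := V2).
      generalize (locally_slice_y _ _ (locally_unit_disk z Hz)).
      apply filter_imp; intros t Ht; transitivity (d_z f (Re z, t)).
      * symmetry; apply d_z_alt.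
      * now apply W.
  - destruct (wirtinger_vder f Ci HC2) as [Px [Py HP]].
    exists (fun z => Cconj (Px z)).
    apply (hol1_of_C1_derivative g _ (fun z => Cconj (Px z)) (fun z => Cconj (Py z)));
      [exact Dg|].
    intros z Hz; destruct (HP z Hz) as [V1 [V2 [C1 C2]]].
    repeat split; auto using ccont_conj.
    + apply vder_ext_loc with (2 := vder_conj _ _ _ V1).
      generalize (locally_slice_x _ _ (locally_unit_disk z Hz)).
      apply filter_imp; intros t Ht; transitivity (Cconj (d_zbar f (t, Im z))).
      * reflexivity.
      * rewrite (proj2 (W _ Ht)); apply Cconj_conj.
    + apply vder_ext_loc with (2 := vder_conj _ _ _ V2).
      generalize (locally_slice_y _ _ (locally_unit_disk z Hz)).
      apply filter_imp; intros t Ht; transitivity (Cconj (d_zbar f (Re z, t))).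
      * reflexivity.
      * rewrite (proj2 (W _ Ht)); apply Cconj_conj.
  (* The chain is [|h'| + |g'| = Lambda <= K lambda <= K M]. *)
  - intros z Hz; destruct (EL z Hz) as [<- _]; apply unit_disk_Cmod in Hz.
    apply Rle_trans with (1 := HQ z Hz), Rmult_le_compat_l; [lra|auto].
  - rewrite <- (proj2 (EL 0%C ltac:(rewrite Cmod_0; lra))), H1; lra.
Qed.

(** * The case of equality *)

Lemma cder_zero_const (F : C -> C) :
  (forall z, Cmod z < 1 -> cder F z 0%C) -> forall z, Cmod z < 1 -> F z = F 0%C.
Proof.
  intros H z Hz; set (v := (F z - F 0%C)%C); set (k := Cconj v).
  assert (D : forall t, 0 <= t <= 1 ->
            is_derive (fun u => Re (k * F (0 + RtoC u * z)%C)) t (Re (k * (0 * z)))).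
  { intros t Ht; apply is_derive_segment, H.
    replace (0 + RtoC t * z)%C with (RtoC t * z)%C by ring.
    rewrite Cmod_mult, Cmod_R, Rabs_pos_eq by lra.
    assert (P := Cmod_ge_0 z); nra. }
  destruct (MVT_gen (fun u => Re (k * F (0 + RtoC u * z)%C)) 0 1
              (fun _ => Re (k * (0 * z)))) as [t [_ E]].
  - intros t; rewrite Rmin_left, Rmax_right by lra; intros Ht; apply D; lra.
  - intros t; rewrite Rmin_left, Rmax_right by lra; intros Ht.
    apply derivable_continuous_pt; eexists; apply is_derive_Reals, D; lra.
  - replace (0 + RtoC 1 * z)%C with z in E by ring.
    replace (0 + RtoC 0 * z)%C with (RtoC 0) in E by ring.
    replace (k * (0 * z))%C with (RtoC 0) in E by ring.
    assert (E1 : Cmod v * Cmod v = 0).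
    { transitivity (Re (k * F z) - Re (k * F 0%C)).
      - rewrite Cmod_sqr; unfold k, v, Re, Im; simpl; ring.
      - rewrite E; simpl; ring. }
    assert (Cv : Cmod v = 0) by nra.
    apply Cmod_eq_0 in Cv; replace (F z) with (v + F 0%C)%C by (unfold v; ring).
    rewrite Cv; ring.
Qed.

Lemma cis_surjective (A : C) : Cmod A = 1 -> exists th, A = (cos th, sin th).
Proof.
  intros H; assert (S := Cmod_sqr A); rewrite H in S; destruct A as [x y].
  unfold Re, Im in S; simpl in S.
  assert (Hx : -1 <= x <= 1) by nra.
  assert (Hs : sqrt (1 - Rsqr x) = Rabs y).
  { replace (1 - Rsqr x) with (Rsqr y) by (unfold Rsqr; lra); apply sqrt_Rsqr_abs. }
  destruct (Rle_lt_dec 0 y) as [Hy|Hy].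
  - exists (acos x); rewrite cos_acos, sin_acos, Hs, Rabs_pos_eq by lra; reflexivity.
  - exists (- acos x); rewrite cos_neg, sin_neg, cos_acos, sin_acos, Hs by lra.
    rewrite Rabs_left by lra; f_equal; ring.
Qed.

(** For [|a| = 1], where [a = w 0], one has [1 - conj a * w = conj a * (a - w)]. Schwarz-Pick then
    reads [|w - a| <= |z| |w - a|] with [|z| < 1]. *)
Lemma schwarz_pick_rigid (w w' : C -> C) :
  hol1 w w' -> (forall z, Cmod z < 1 -> Cmod (w z) <= 1) -> 1 <= Cmod (w 0%C) ->
  forall z, Cmod z < 1 -> w z = w 0%C.
Proof.
  intros Hw HB H1 z Hz.
  assert (Ha : Cmod (w 0%C) = 1).
  { apply Rle_antisym; [apply HB; rewrite Cmod_0; lra|exact H1]. }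
  assert (SP := schwarz_pick w w' 1 ltac:(lra) Hw HB z Hz).
  replace (RtoC (1 * 1) - Cconj (w 0%C) * w z)%C
    with (Cconj (w 0%C) * (w 0%C - w z))%C in SP.
  - rewrite Cmod_mult, Cmod_conj, Ha, (Cmod_minus_sym (w 0%C)) in SP.
    assert (P := Cmod_ge_0 (w z - w 0%C)).
    assert (Z : Cmod (w z - w 0%C) = 0) by nra.
    apply Cmod_eq_0 in Z; replace (w z) with (w z - w 0%C + w 0%C)%C by ring.
    rewrite Z; ring.
  - assert (S := Cmod_sqr (w 0%C)); rewrite Ha in S; unfold Re, Im in S.
    apply injective_projections; simpl; lra.
Qed.

(** Each rotation [h' + e g'] is constant; [e = 1] and [e = -1] recover [h'] and [g'] separately. *)
Lemma landau_pair_rigid (h h' g g' : C -> C) :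
  landau_pair 1 h h' g g' ->
  forall z, Cmod z < 1 -> h' z = h' 0%C /\ g' z = g' 0%C.
Proof.
  intros [_ [_ [[h'' Hh] [[g'' Hg] [HB H1]]]]] z Hz.
  assert (K : forall e, Cmod e = 1 -> (h' z + e * g' z)%C = (h' 0%C + e * g' 0%C)%C).
  { intros e He; apply (schwarz_pick_rigid (fun u => h' u + e * g' u)%C
                         (fun u => h'' u + e * g'' u)%C); auto.
    - now apply hol1_rotation.
    - intros u Hu; apply Rle_trans with (2 := HB u Hu); now apply Cmod_rotation_le.
    - apply Rle_trans with (1 := H1); now apply Cmod_rotation_ge. }
  assert (K1 := K 1%C Cmod_1); assert (K2 := K (- (1))%C Cmod_m1).
  apply (f_equal fst) in K1 as K1x; apply (f_equal snd) in K1 as K1y.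
  apply (f_equal fst) in K2 as K2x; apply (f_equal snd) in K2 as K2y.
  simpl in K1x, K1y, K2x, K2y.
  split; apply injective_projections; lra.
Qed.

Lemma rotation_schlicht (f : C -> C) (A : C) :
  Cmod A = 1 -> (forall z, Cmod z < 1 -> f z = (A * z)%C) ->
  univalent_in unit_disk f /\ contains_schlicht_disk f 1 0 1.
Proof.
  intros HA Hf.
  assert (Hd : forall z1 z2, Cmod z1 < 1 -> Cmod z2 < 1 ->
            Cmod (f z1 - f z2) = Cmod (z1 - z2)).
  { intros z1 z2 H1 H2; rewrite !Hf by assumption.
    replace (A * z1 - A * z2)%C with (A * (z1 - z2))%C by ring.
    rewrite Cmod_mult, HA; ring. }
  assert (H0 : f 0%C = 0%C) by (rewrite Hf by (rewrite Cmod_0; lra); ring).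
  assert (Hlow : forall r, r < 1 -> exists m, 0 < m /\ forall z1 z2,
     Cmod z1 <= r -> Cmod z2 <= r -> m * Cmod (z1 - z2) <= Cmod (f z1 - f z2)).
  { intros r Hr; exists 1; split; [lra|]; intros z1 z2 H1 H2; rewrite Hd by lra; lra. }
  split; [exact (univalent_of_lower_bound f 1 Hlow)|].
  assert (Hloc : forall z, Cmod z < 1 -> exists d, 0 < d /\
            forall u, Cmod (u - z) < d -> f u = (A * u)%C).
  { intros z Hz; exists (1 - Cmod z); split; [lra|]; intros u Hu; apply Hf.
    assert (X := Cmod_triangle_rev u z); lra. }
  apply schlicht_disk_criterion; auto; try lra.
  - intros z Hz; apply ccont_ext_loc with (fun u => A * u)%C.
    + destruct (Hloc z Hz) as [d [Pd E]]; exists d; split; [exact Pd|].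
      intros u Hu; symmetry; auto.
    + apply ccont_mult; [apply ccont_const|apply ccont_id].
  (* The entry [1 / 2] keeps the radius positive when [rho] is negative; the other lies strictly
     between [rho] and 1. *)
  - intros rho Hrho; exists (Rmax (1 / 2) ((1 + rho) / 2)).
    assert (X := Rmax_l (1 / 2) ((1 + rho) / 2)).
    assert (Y := Rmax_r (1 / 2) ((1 + rho) / 2)).
    split; [split; [lra|apply Rmax_lub_lt; lra]|]; intros z Hz.
    rewrite Hf, Cmod_mult, HA by lra; lra.
  - intros z v Hz.
    apply (local_min_harmonic f (fun u => A * u)%C (fun _ => 0%C) z v (A * 1)%C 0%C).
    + destruct (Hloc z Hz) as [d [Pd E]]; exists d; split; [exact Pd|].
      intros u Hu; rewrite (E u Hu); apply injective_projections; simpl; ring.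
    + apply cder_scal, cder_id.
    + apply cder_const.
    + rewrite Cmod_mult, HA, Cmod_1, Cmod_0; lra.
Qed.

(** At 0, [|h'| + |g'| <= 1 <= | |h'| - |g'| |] forces one of the derivatives to vanish. The point
    of positive Jacobian decides that it is [g'], which excludes the mappings [A * conj z]. *)
Lemma landau_rigid (f h h' g g' : C -> C) :
  landau_pair 1 h h' g g' ->
  (forall z, Cmod z < 1 -> f z = (h z + Cconj (g z))%C) -> f 0%C = 0%C ->
  (exists z, Cmod z < 1 /\ Cmod (g' z) < Cmod (h' z)) ->
  exists A, Cmod A = 1 /\ forall z, Cmod z < 1 -> f z = (A * z)%C.
Proof.
  intros HP Hf H0 [z0 [Hz0 HJ]].
  assert (R := landau_pair_rigid h h' g g' HP).
  destruct (R z0 Hz0) as [E1 E2]; rewrite E1, E2 in HJ.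
  destruct HP as [Hh [Hg [_ [_ [HB H1]]]]].
  assert (HB0 := HB 0%C ltac:(rewrite Cmod_0; lra)).
  rewrite Rabs_pos_eq in H1 by lra.
  assert (Pg := Cmod_ge_0 (g' 0%C)).
  assert (Zg : Cmod (g' 0%C) = 0) by lra.
  assert (Zg' := Cmod_eq_0 _ Zg).
  exists (h' 0%C); split; [lra|]; intros z Hz.
  set (A := h' 0%C) in *.
  assert (Eh : (h z - A * z)%C = (h 0%C - A * 0)%C).
  { apply (cder_zero_const (fun u => h u - A * u)%C); [|exact Hz]; intros u Hu.
    replace (RtoC 0) with (h' u - A * 1)%C by (rewrite (proj1 (R u Hu)); fold A; ring).
    apply cder_minus; [now apply Hh|apply cder_scal, cder_id]. }
  assert (Eg : g z = g 0%C).
  { apply (cder_zero_const g); [|exact Hz]; intros u Hu.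
    rewrite <- Zg', <- (proj2 (R u Hu)); now apply Hg. }
  rewrite Hf in H0 by (rewrite Cmod_0; lra).
  rewrite (Hf z Hz), Eg.
  replace (h z) with ((h z - A * z) + A * z)%C by ring; rewrite Eh.
  replace (h 0%C - A * 0 + A * z + Cconj (g 0%C))%C
    with (A * z + (h 0%C + Cconj (g 0%C)))%C by ring.
  rewrite H0; ring.
Qed.

(** * The extremal function *)

Lemma Cminus_neq_0_Re (M : R) (u : C) : Re u < M -> (RtoC M - u)%C <> 0%C.
Proof.
  intros H E; apply (f_equal fst) in E; unfold Re in H; simpl in E; lra.
Qed.

(* The principal branch of [log (M - z)]. *)
Definition clog (M : R) (z : C) : C :=
  (/ 2 * ln ((M - Re z) * (M - Re z) + Im z * Im z), atan (- Im z / (M - Re z))).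

(** For [Re z < M] the number [M - z] lies in the right half-plane, where [atan] gives its argument;
    the derivative is verified through the Cauchy-Riemann equations. *)
Lemma cder_clog (M : R) (z : C) :
  Re z < M -> cder (clog M) z (- / (RtoC M - z))%C.
Proof.
  intros Hz.
  assert (E : forall u : C, Re u < M -> (- / (RtoC M - u))%C =
    (- (M - Re u) / ((M - Re u) * (M - Re u) + Im u * Im u),
     - Im u / ((M - Re u) * (M - Re u) + Im u * Im u))).
  { intros [x y] Hu; unfold Re, Im in *; simpl in *.
    assert (0 < (M - x) * (M - x)) by nra.
    apply injective_projections; simpl; field; nra. }
  apply (cauchy_riemann_cder (clog M) (fun u => - / (RtoC M - u))%C).
  - apply locally_Cmod; exists (M - Re z); split; [lra|]; intros u Hu.
    assert (Hu' : Re u < M).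
    { assert (X := Re_le_Cmod (u - z)); unfold Re in *; simpl in X; lra. }
    rewrite (E u Hu').
    assert (0 < (M - Re u) * (M - Re u)) by nra.
    apply vder_pair; unfold Re, Im in *; simpl; auto_derive.
    + nra.
    + field; nra.
    + lra.
    + field; repeat split; nra.
  - replace (- / (RtoC M - z) * Ci)%C
      with ((Im z / ((M - Re z) * (M - Re z) + Im z * Im z),
             - (M - Re z) / ((M - Re z) * (M - Re z) + Im z * Im z)) : C).
    2: { rewrite (E z Hz); apply injective_projections; simpl; unfold Rdiv; ring. }
    assert (0 < (M - Re z) * (M - Re z)) by nra.
    apply vder_pair; unfold Re, Im in *; simpl; auto_derive.
    + nra.
    + field; nra.
    + auto.
    + field; repeat split; nra.
  - apply ccont_opp, ccont_inv; [|now apply Cminus_neq_0_Re].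
    apply ccont_minus; [apply ccont_const|apply ccont_id].
Qed.

Definition f0' (M : R) (z : C) : C := (M * ((1 - M * z) / (M - z)))%C.

(** Left unsimplified, in the shape that [cder_div] produces. *)
Definition f0'' (M : R) (z : C) : C :=
  (M * (((0 - M * 1) * (M - z) - (1 - M * z) * (0 - 1)) / ((M - z) * (M - z))))%C.

(** Integrates the partial fraction form [M^2 - (M^3 - M) / (M - z)] of [f0']. *)
Definition f0_primitive (M : R) (z : C) : C :=
  (RtoC (M * M) * z + RtoC (M ^ 3 - M) * clog M z)%C.

Lemma Re_lt_of_unit_disk (M : R) (z : C) : 1 < M -> Cmod z < 1 -> Re z < M.
Proof.
  intros HM Hz; assert (X := Re_le_Cmod z); lra.
Qed.

Lemma hol1_f0' (M : R) : 1 < M -> hol1 (f0' M) (f0'' M).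
Proof.
  intros HM z Hz.
  assert (Hn := Cminus_neq_0_Re M z (Re_lt_of_unit_disk M z HM Hz)).
  assert (C1 : forall a b : C, ccont (fun u => a - b * u)%C z).
  { intros a b; apply ccont_minus; [apply ccont_const|].
    apply ccont_mult; [apply ccont_const|apply ccont_id]. }
  assert (C2 : ccont (fun u => RtoC M - u)%C z)
    by (apply ccont_minus; [apply ccont_const|apply ccont_id]).
  split.
  - apply cder_scal, (cder_div (fun u => 1 - M * u)%C (fun u => M - u)%C); [| |exact Hn].
    + apply cder_minus; [apply cder_const|apply cder_scal, cder_id].
    + apply cder_minus; [apply cder_const|apply cder_id].
  - apply ccont_mult; [apply ccont_const|]; apply ccont_div.
    + apply ccont_minus; apply ccont_mult; auto using ccont_const.
    + now apply ccont_mult.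
    + now apply Cmult_neq_0.
Qed.

Lemma cder_f0_primitive (M : R) (z : C) :
  1 < M -> Cmod z < 1 -> cder (f0_primitive M) z (f0' M z).
Proof.
  intros HM Hz; assert (HR := Re_lt_of_unit_disk M z HM Hz).
  assert (Hn := Cminus_neq_0_Re M z HR).
  replace (f0' M z) with (RtoC (M * M) * 1 + RtoC (M ^ 3 - M) * (- / (RtoC M - z)))%C.
  - apply cder_plus; apply cder_scal; [apply cder_id|now apply cder_clog].
  - unfold f0'; rewrite RtoC_minus, RtoC_pow, RtoC_mult; field; exact Hn.
Qed.

Lemma f0_closed_form (M : R) (z : C) :
  1 < M -> Cmod z < 1 -> f0 M z = (f0_primitive M z - f0_primitive M 0)%C.
Proof.
  intros HM Hz.
  set (P := fun t => f0_primitive M (0 + RtoC t * z)%C).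
  set (p := fun t => (f0' M (0 + RtoC t * z)%C * z)%C).
  assert (Hin : forall t, 0 <= t <= 1 -> Cmod (0 + RtoC t * z) < 1).
  { intros t Ht; replace (0 + RtoC t * z)%C with (RtoC t * z)%C by ring.
    rewrite Cmod_mult, Cmod_R, Rabs_pos_eq by lra.
    assert (X := Cmod_ge_0 z); nra. }
  assert (DP : forall t, 0 <= t <= 1 -> vder P t (p t)).
  { intros t Ht; apply (cder_vder (f0_primitive M) (fun t => 0 + RtoC t * z)%C).
    - apply cder_f0_primitive; auto.
    - apply vder_line. }
  assert (Dp : forall t, 0 <= t <= 1 ->
            vder p t (z * (f0'' M (0 + RtoC t * z)%C * z))%C).
  { intros t Ht; apply vder_ext_loc with (fun u => z * f0' M (0 + RtoC u * z)%C)%C.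
    - apply filter_forall; intros u; unfold p; apply Cmult_comm.
    - apply vder_scal, (cder_vder (f0' M) (fun t => 0 + RtoC t * z)%C).
      + apply hol1_f0'; auto.
      + apply vder_line. }
  transitivity (RInt (V := C_R_CompleteNormedModule) p 0 1).
  { apply (RInt_ext (V := C_R_CompleteNormedModule)); intros t _; unfold p, f0'.
    replace (0 + RtoC t * z)%C with (RtoC t * z)%C by ring; reflexivity. }
  apply (is_RInt_unique (V := C_R_CompleteNormedModule)).
  replace (f0_primitive M z - f0_primitive M 0)%C
    with (((Re (P 1) - Re (P 0))%R, (Im (P 1) - Im (P 0))%R) : C).
  2: { unfold P; replace (0 + RtoC 1 * z)%C with z by ring.
       replace (0 + RtoC 0 * z)%C with (RtoC 0) by ring; reflexivity. }
  (* The complex integral is evaluated by components, each by the fundamental theorem; the second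
     derivative [Dp] provides continuity of the integrand. *)
  apply (is_RInt_fct_extend_pair (U := R_NormedModule) (V := R_NormedModule)).
  - apply (is_RInt_derive (V := R_CompleteNormedModule)
             (fun t => Re (P t)) (fun t => Re (p t)));
      intros t; rewrite Rmin_left, Rmax_right by lra; intros Ht.
    + exact (vder_Re _ _ _ (DP t Ht)).
    + apply (@ex_derive_continuous R_AbsRing R_NormedModule); eexists.
      exact (vder_Re _ _ _ (Dp t Ht)).
  - apply (is_RInt_derive (V := R_CompleteNormedModule)
             (fun t => Im (P t)) (fun t => Im (p t)));
      intros t; rewrite Rmin_left, Rmax_right by lra; intros Ht.
    + exact (vder_Im _ _ _ (DP t Ht)).
    + apply (@ex_derive_continuous R_AbsRing R_NormedModule); eexists.
      exact (vder_Im _ _ _ (Dp t Ht)).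
Qed.

(** * The hypotheses for the extremal function *)

Lemma hol1_ext (F G F' : C -> C) :
  (forall z, Cmod z < 1 -> F z = G z) -> hol1 F F' -> hol1 G F'.
Proof.
  intros E H z Hz; destruct (H z Hz) as [D D']; split; [|exact D'].
  apply cder_ext_loc with (2 := D).
  exists (1 - Cmod z); split; [lra|]; intros w Hw; apply E.
  assert (X := Cmod_triangle_rev w z); lra.
Qed.

Lemma hol1_f0 (M : R) : 1 < M -> hol1 (f0 M) (f0' M).
Proof.
  intros HM; apply hol1_ext with (fun z => f0_primitive M z - f0_primitive M 0)%C.
  - intros z Hz; symmetry; now apply f0_closed_form.
  - intros z Hz; destruct (hol1_f0' M HM z Hz) as [D _]; split.
    + replace (f0' M z) with (f0' M z - 0)%C by ring.
      apply cder_minus; [now apply cder_f0_primitive|apply cder_const].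
    + exact (cder_ccont _ _ _ D).
Qed.

Lemma hol1_partials (F F' : C -> C) (z : C) :
  hol1 F F' -> Cmod z < 1 ->
  ex_dx F z /\ ex_dy F z /\ dx F z = F' z /\ dy F z = (F' z * Ci)%C.
Proof.
  intros H Hz; destruct (H z Hz) as [D _].
  destruct (vder_dx _ _ _ (cder_vder_x _ _ _ D)) as [A B].
  destruct (vder_dy _ _ _ (cder_vder_y _ _ _ D)) as [A' B']; auto.
Qed.

Lemma hol1_C1_in (F F' : C -> C) : hol1 F F' -> C1_in unit_disk F.
Proof.
  intros H z Hz; rewrite unit_disk_Cmod in Hz.
  destruct (hol1_partials F F' z H Hz) as [A [B _]].
  assert (L : exists d, 0 < d /\ forall w, Cmod (w - z) < d ->
            F' w = dx F w /\ (F' w * Ci)%C = dy F w).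
  { exists (1 - Cmod z); split; [lra|]; intros w Hw.
    assert (X := Cmod_triangle_rev w z).
    destruct (hol1_partials F F' w H) as [_ [_ [-> ->]]]; [lra|auto]. }
  destruct L as [d [Pd L]].
  destruct (H z Hz) as [_ D].
  repeat split; try apply A; try apply B.
  - apply ccont_continuous, ccont_ext_loc with F'; [|exact D].
    exists d; split; [exact Pd|]; intros w Hw; now apply L.
  - apply ccont_continuous, ccont_ext_loc with (fun w => F' w * Ci)%C.
    + exists d; split; [exact Pd|]; intros w Hw; now apply L.
    + apply ccont_mult; [exact D|apply ccont_const].
Qed.

Lemma hol1_scal (c : C) (F F' : C -> C) :
  hol1 F F' -> hol1 (fun z => F z * c)%C (fun z => F' z * c)%C.
Proof.
  intros H z Hz; destruct (H z Hz) as [D D']; split.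
  - replace (F' z * c)%C with (F' z * c + F z * 0)%C by ring.
    apply (cder_mult F (fun _ => c)); [exact D|apply cder_const].
  - apply ccont_mult; [exact D'|apply ccont_const].
Qed.

Lemma hol1_harmonic (F F' F'' : C -> C) :
  hol1 F F' -> hol1 F' F'' -> harmonic_mapping F.
Proof.
  intros H H'.
  assert (E : forall z, Cmod z < 1 -> dx F z = F' z /\ dy F z = (F' z * Ci)%C).
  { intros z Hz; now destruct (hol1_partials F F' z H Hz) as [_ [_ ?]]. }
  split; [split; [|split]|].
  - exact (hol1_C1_in F F' H).
  - apply hol1_C1_in with F''; apply hol1_ext with F'; [|exact H'].
    intros z Hz; symmetry; now apply E.
  - apply hol1_C1_in with (fun z => F'' z * Ci)%C.
    apply hol1_ext with (fun z => F' z * Ci)%C; [|now apply hol1_scal].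
    intros z Hz; symmetry; now apply E.
  - intros z Hz; rewrite unit_disk_Cmod in Hz.
    assert (Hd : hol1 (d_z F) F'').
    { apply hol1_ext with F'; [|exact H']; intros u Hu; unfold d_z.
      destruct (E u Hu) as [-> ->]; apply injective_projections; simpl; field. }
    destruct (hol1_partials _ _ z Hd Hz) as [_ [_ [E1 E2]]].
    unfold d_zbar; rewrite E1, E2; apply injective_projections; simpl; field.
Qed.

Lemma f0'_neq_0 (M : R) (z : C) :
  1 < M -> Cmod z < 1 -> z <> RtoC (1 / M) -> 0 < Cmod (f0' M z).
Proof.
  intros HM Hz Hn; apply Cmod_gt_0; unfold f0'.
  assert (HM0 : RtoC M <> 0%C) by (intros E; apply RtoC_inj in E; lra).
  assert (Hd := Cminus_neq_0_Re M z (Re_lt_of_unit_disk M z HM Hz)).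
  assert (Hu : (1 - M * z)%C <> 0%C).
  { intros E; apply Hn; unfold Rdiv; rewrite RtoC_mult, RtoC_inv by lra.
    replace (1 * / RtoC M)%C with ((1 - M * z) / RtoC M + z)%C by (field; auto).
    rewrite E; field; auto. }
  apply Cmult_neq_0; [exact HM0|]; apply Cmult_neq_0; [exact Hu|].
  apply Cmod_gt_0; rewrite Cmod_inv by exact Hd.
  apply Rinv_0_lt_compat; now apply Cmod_gt_0.
Qed.

Lemma f0'_bound (M : R) (z : C) : 1 < M -> Cmod z < 1 -> Cmod (f0' M z) <= M.
Proof.
  intros HM Hz; unfold f0'.
  assert (Hd := Cminus_neq_0_Re M z (Re_lt_of_unit_disk M z HM Hz)).
  rewrite Cmod_mult, Cmod_div, Cmod_R, Rabs_pos_eq by (auto; lra).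
  assert (P := proj1 (Cmod_gt_0 _) Hd).
  rewrite <- (Rmult_1_r M) at 4; apply Rmult_le_compat_l; [lra|].
  apply Rmult_le_reg_r with (Cmod (RtoC M - z)); [exact P|].
  unfold Rdiv; rewrite Rmult_assoc, Rinv_l, Rmult_1_r, Rmult_1_l by lra.
  apply Rsqr_incr_0; [|apply Cmod_ge_0|lra].
  unfold Rsqr; rewrite !Cmod_sqr.
  assert (S := Cmod_sqr z); assert (P' := Cmod_ge_0 z).
  (* This product equals [|M - z|^2 - |1 - M z|^2]. *)
  assert (0 <= (M * M - 1) * (1 - Cmod z * Cmod z)) by (apply Rmult_le_pos; nra).
  rewrite S in H; unfold Re, Im in *; simpl; nra.
Qed.

Lemma f0_landau_hypotheses (M : R) :
  1 < M -> landau_hypotheses 1 M (f0 M) (f0 M) (fun _ => 0%C).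
Proof.
  intros HM; assert (H := hol1_f0 M HM).
  assert (W : forall z, Cmod z < 1 -> d_z (f0 M) z = f0' M z /\ d_zbar (f0 M) z = 0%C).
  { intros z Hz.
    destruct (wirtinger_harmonic (f0 M) (f0 M) (fun _ => 0%C) z (f0' M z) 0%C)
      as [E1 E2]; auto.
    - intros w _; apply injective_projections; simpl; ring.
    - now apply H.
    - apply cder_const.
    - split; [exact E1|]; rewrite E2; apply injective_projections; simpl; ring. }
  assert (EL : forall z, Cmod z < 1 ->
    Lambda (f0 M) z = Cmod (f0' M z) /\ lambda (f0 M) z = Cmod (f0' M z) /\
    Jac (f0 M) z = Cmod (f0' M z) ^ 2).
  { intros z Hz; unfold Lambda, lambda, Jac; destruct (W z Hz) as [-> ->].
    rewrite Cmod_0, Rminus_0_r, Rabs_pos_eq by apply Cmod_ge_0.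
    repeat split; ring. }
  split; [exact (hol1_harmonic _ _ _ H (hol1_f0' M HM))|].
  split.
  { intros z Hz; rewrite unit_disk_Cmod in Hz; eexists; apply cder_is_derive; now apply H. }
  split.
  { intros z Hz; eexists; apply cder_is_derive, cder_const. }
  split.
  { intros z _; apply injective_projections; simpl; ring. }
  split.
  { split.
    - intros a Ha; rewrite unit_disk_Cmod in Ha.
      assert (K : forall z, unit_disk z -> z <> RtoC (1 / M) -> 0 < Jac (f0 M) z).
      { intros z Hz Hn; rewrite unit_disk_Cmod in Hz.
        rewrite (proj2 (proj2 (EL z Hz))).
        apply pow_lt; now apply f0'_neq_0. }
      (* At the critical point [1 / M] the punctured neighbourhood already omits it; around any
         other [a] the disk of radius [|1 / M - a|] does. *)
      destruct (excluded_middle_informative (a = RtoC (1 / M))) as [->|Hn].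
      + unfold locally', within; apply filter_forall; intros z Hz Hu; now apply K.
      + apply locally_Cmod; exists (Cmod (RtoC (1 / M) - a)); split.
        * apply Cmod_gt_0; intros E; apply Hn.
          replace (RtoC (1 / M)) with (RtoC (1 / M) - a + a)%C by ring; rewrite E; ring.
        * intros z Hz _ Hu; apply K; [exact Hu|]; intros ->; lra.
    - intros z Hz; rewrite unit_disk_Cmod in Hz.
      destruct (EL z Hz) as [-> [-> _]]; lra. }
  assert (Z0 : Cmod 0 < 1) by (rewrite Cmod_0; lra).
  split.
  { rewrite f0_closed_form by assumption; ring. }
  split.
  { rewrite (proj1 (proj2 (EL 0%C Z0))); unfold f0'.
    replace (M * ((1 - M * 0) / (M - 0)))%C with (RtoC 1); [apply Cmod_1|].
    field; intros E; apply RtoC_inj in E; lra. }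
  intros z Hz; rewrite unit_disk_Cmod in Hz.
  rewrite (proj1 (proj2 (EL z Hz))); now apply f0'_bound.
Qed.

(** On the real axis the logarithms combine to [ln (1 - t / M)], so [f0] restricts to the growth
    function and univalence becomes a question of real calculus. *)
Lemma f0_real (M t : R) :
  1 < M -> -1 < t < 1 -> f0 M (RtoC t) = RtoC (landau_growth M t).
Proof.
  intros HM Ht.
  rewrite f0_closed_form; [|exact HM|rewrite Cmod_R; apply Rabs_def1; lra].
  unfold f0_primitive, landau_growth, clog, Re, Im; simpl.
  replace (- 0 / (M - t)) with 0 by (field; lra).
  replace (- 0 / (M - 0)) with 0 by (field; lra).
  rewrite atan_0.
  replace ((M - t) * (M - t) + 0 * 0) with ((M - t) * (M - t)) by ring.
  replace ((M - 0) * (M - 0) + 0 * 0) with (M * M) by ring.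
  replace (1 - t / M) with ((M - t) * / M) by (field; lra).
  rewrite ln_mult, ln_mult, ln_mult, ln_Rinv by (try apply Rinv_0_lt_compat; lra).
  apply injective_projections; simpl; field.
Qed.

(** On the real axis [f0] climbs from 0 to a positive value at [1 / M] and does not rise afterwards.
    Past [1 / M] some value taken earlier must recur. *)
Lemma f0_not_univalent (M r : R) :
  1 < M -> 1 / M < r <= 1 -> ~ univalent_in (disk 0 r) (f0 M).
Proof.
  intros HM Hr HU.
  assert (P : 0 < 1 / M) by (apply Rdiv_lt_0_compat; lra).
  set (q := landau_growth M); set (b := (1 / M + r) / 2).
  assert (Hb : 1 / M < b < r) by (unfold b; lra).
  assert (Hinj : forall s t, 0 <= s < r -> 0 <= t < r -> q s = q t -> s = t).
  { intros s t Hs Ht E; apply RtoC_inj, HU.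
    - unfold disk; rewrite <- RtoC_minus, Cmod_R, Rabs_pos_eq; lra.
    - unfold disk; rewrite <- RtoC_minus, Cmod_R, Rabs_pos_eq; lra.
    - rewrite !f0_real by lra; fold q; now rewrite E. }
  assert (Cq : forall c t, 0 <= t <= b -> continuity_pt (fun u => q u - c) t).
  { intros c t Ht; apply continuity_pt_minus.
    - apply derivable_continuous_pt; eexists.
      apply is_derive_Reals, is_derive_landau_growth; lra.
    - apply continuity_pt_const; intros x y; reflexivity. }
  assert (Q0 : q 0 = 0) by apply landau_growth_0.
  assert (Q1 : 0 < q (1 / M)) by now apply landau_growth_pos.
  assert (Hle : q b <= q (1 / M)).
  { destruct (MVT_gen q (1 / M) b (landau_slope M)) as [c [Hc E]].
    - intros x; rewrite Rmin_left, Rmax_right by lra; intros Hx.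
      apply is_derive_landau_growth; lra.
    - intros x; rewrite Rmin_left, Rmax_right by lra; intros Hx.
      apply derivable_continuous_pt; eexists.
      apply is_derive_Reals, is_derive_landau_growth; lra.
    - rewrite Rmin_left, Rmax_right in Hc by lra.
      assert (landau_slope M c <= 0).
      { unfold landau_slope.
        assert (M * (1 / M) <= M * c) by (apply Rmult_le_compat_l; lra).
        replace (M * (1 / M)) with 1 in H by (field; lra).
        assert (0 < / (M - c)) by (apply Rinv_0_lt_compat; lra).
        assert (0 <= M * (M * c - 1) * / (M - c)).
        { apply Rmult_le_pos; [apply Rmult_le_pos|]; lra. }
        unfold Rdiv; lra. }
      nra. }
  (* A negative [q b] gives a second zero between [1 / M] and [b], and [q b = 0] is itself one; a
     positive [q b] is already attained on [[0, 1 / M]]. *)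
  destruct (Rtotal_order (q b) 0) as [L|[L|L]].
  - destruct (IVT_interv (fun u => 0 - q u) (1 / M) b) as [y [Hy Ey]]; try lra.
    + intros a Ha; apply continuity_pt_minus.
      * apply continuity_pt_const; intros x y; reflexivity.
      * apply derivable_continuous_pt; eexists.
        apply is_derive_Reals, is_derive_landau_growth; lra.
    + assert (0 = y) by (apply Hinj; lra); lra.
  - assert (0 = b) by (apply Hinj; lra); lra.
  - destruct Hle as [Hlt|He].
    + destruct (IVT_interv (fun u => q u - q b) 0 (1 / M)) as [y [Hy Ey]]; try lra.
      * intros a Ha; apply Cq; lra.
      * assert (y = b) by (apply Hinj; lra); lra.
    + assert (b = 1 / M) by (apply Hinj; lra); lra.
Qed.

Theorem theorem3p1 :
  (forall (K M : R) (f h g : C -> C),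
     1 <= K ->
     landau_hypotheses K M f h g ->
     (1 < K * M ->
        let r0 := 1 / (K * M) in
        let r1 := K * M + ((K * M) ^ 3 - K * M) * ln (1 - 1 / (K * M) ^ 2) in
        univalent_in (disk 0 r0) f /\
        contains_schlicht_disk f r0 0 r1) /\
     (K * M = 1 ->
        univalent_in unit_disk f /\
        contains_schlicht_disk f 1 0 1 /\
        exists theta : R, forall z : C, unit_disk z ->
          f z = ((cos theta, sin theta) * z)%C)) /\
  (forall M : R,
     1 < M ->
     landau_hypotheses 1 M (f0 M) (f0 M) (fun _ : C => 0%C) /\
     forall r : R, 1 / M < r <= 1 -> ~ univalent_in (disk 0 r) (f0 M)).
Proof.
  split.
  - intros K M f h g HK HL.
    assert (HP := landau_hypotheses_pair K M f h g HK HL).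
    destruct HL as [_ [Hh [Hg [Hf [[HS _] [H0 _]]]]]].
    assert (Hf' : forall w, Cmod w < 1 -> f w = (h w + Cconj (g w))%C).
    { intros w Hw; now apply Hf, unit_disk_Cmod. }
    split.
    + intros HN r0 r1.
      replace r1 with (landau_growth (K * M) (1 / (K * M))).
      * now apply (landau_pair_schlicht _ f h (C_derive h) g (C_derive g)).
      * unfold r1, landau_growth.
        replace (1 / (K * M) / (K * M)) with (1 / (K * M) ^ 2) by (field; nra).
        replace (K * M * (K * M) * (1 / (K * M))) with (K * M) by (field; nra).
        reflexivity.
    + intros HN; rewrite HN in HP.
      destruct (landau_rigid f h (C_derive h) g (C_derive g)) as [A [HA EA]]; auto.
      (* [sense_preserving] speaks of punctured neighbourhoods, so a point of positive Jacobian is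
         taken on the real axis close to 0 rather than at 0. *)
      { assert (Z0 : unit_disk 0) by (apply unit_disk_Cmod; rewrite Cmod_0; lra).
        assert (L := HS 0%C Z0); apply locally_Cmod in L; destruct L as [d [Pd Hd]].
        set (x := Rmin d 1 / 2).
        assert (Q := Rmin_pos d 1 Pd Rlt_0_1).
        assert (Q1 := Rmin_l d 1); assert (Q2 := Rmin_r d 1).
        assert (Hx : 0 < x < 1 /\ x < d) by (unfold x; lra).
        assert (Cx : Cmod (RtoC x) = x) by (rewrite Cmod_R; apply Rabs_pos_eq; lra).
        exists (RtoC x); rewrite Cx; split; [lra|].
        assert (J : 0 < Jac f (RtoC x)).
        { apply Hd.
          - replace (RtoC x - 0)%C with (RtoC x) by ring; lra.
          - intros E; apply RtoC_inj in E; lra.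
          - apply unit_disk_Cmod; lra. }
        unfold Jac in J.
        destruct (wirtinger_harmonic f h g (RtoC x) (C_derive h (RtoC x))
                    (C_derive g (RtoC x))) as [E1 E2]; auto; try lra.
        { apply holomorphic_cder; [exact Hh|lra]. }
        { apply holomorphic_cder; [exact Hg|lra]. }
        rewrite E1, E2, Cmod_conj in J.
        assert (P1 := Cmod_ge_0 (C_derive h (RtoC x))).
        assert (P2 := Cmod_ge_0 (C_derive g (RtoC x))); nra. }
      destruct (rotation_schlicht f A HA EA) as [U1 U2].
      split; [exact U1|]; split; [exact U2|].
      destruct (cis_surjective A HA) as [th ->]; exists th; intros z Hz.
      now apply EA, unit_disk_Cmod.
  - intros M HM; split; [now apply f0_landau_hypotheses|].
    intros r Hr; now apply f0_not_univalent.
Qed.
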